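(* Let $0<\alpha<\frac16$. The probability that a uniformly random size $n$ finitely generated subgroup of $\mathrm{PSL}_2(\mathbb Z)$ is almost malnormal is $O(n^{-\alpha})$ as $n\to\infty$.
   Context: $\mathrm{PSL}_2(\mathbb Z)=\langle a,b\mid a^2=b^3=1\rangle$. Each element has a unique shortest (geodesic, or normal) representative: these are the words over $\{a,b,b^{-1}\}$ of length at most 1 and the words alternating the letter $a$ and letters in $\{b,b^{-1}\}$. The Schreier graph of a subgroup $H$ has as vertices the cosets $Hg$, with an $a$-edge from $Hg$ to $Hga$ (viewed as undirected) and a directed $b$-edge from $Hg$ to $Hgb$ (read as $b$ forward, $b^{-1}$ backward). The Stallings graph $(\Gamma(H),v_0)$ is the subgraph spanned by the loops at $v_0=H$ labeled by the geodesic representatives of the elements of $H$, rooted at $v_0$. It is finite if and only if $H$ is finitely generated, and it determines $H$. The size of a finitely generated subgroup $H$ is the number of vertices of $\Gamma(H)$. There are finitely many subgroups of each size $n$, and ''random'' refers to the uniform distribution on the set of size $n$ subgroups. A subgroup $H$ is almost malnormal if $H\cap H^x$ is finite for every $x\notin H$, where $H^x$ is the conjugate of $H$ by $x$. *)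

(* Defs.v *)
From HB Require Import structures.
From mathcomp Require Import all_boot all_order all_algebra finmap.
From mathcomp Require Import all_classical all_reals all_analysis.

Set Implicit Arguments.
Unset Strict Implicit.
Unset Printing Implicit Defensive.

Import Order.TTheory GRing.Theory Num.Theory.
Local Open Scope classical_set_scope.
Local Open Scope quotient_scope.
Local Open Scope group_scope.

(* [La], [Lb], [Lb'] stand for a, b, b^-1; no separate letter is needed for
   a^-1, since a^2 = 1. *)
Variant letter := La | Lb | Lb'.

Definition letter_code (l : letter) : option bool :=
  match l with La => None | Lb => Some true | Lb' => Some false end.
Definition letter_decode (c : option bool) : letter :=
  match c with None => La | Some true => Lb | Some false => Lb' end.
Lemma letter_codeK : cancel letter_code letter_decode. Proof. by case. Qed.
HB.instance Definition _ := Finite.copy letter (can_type letter_codeK).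

Definition word := seq letter.

Definition letter_inv (l : letter) : letter :=
  match l with La => La | Lb => Lb' | Lb' => Lb end.

Definition word_inv (w : word) : word := rev (map letter_inv w).

Definition relators : seq word :=
  [:: [:: La; La]; [:: Lb; Lb; Lb]; [:: Lb; Lb']; [:: Lb'; Lb]].

Inductive word_eqv : word -> word -> Prop :=
| WordRel u r v : r \in relators -> word_eqv (u ++ r ++ v) (u ++ v)
| WordRefl u : word_eqv u u
| WordSym u v : word_eqv u v -> word_eqv v u
| WordTrans u v w : word_eqv u v -> word_eqv v w -> word_eqv u w.

Definition word_eqb : rel word := fun u v => `[< word_eqv u v >].

Lemma word_eqb_refl : reflexive word_eqb.
Proof. by move=> u; apply/asboolP; exact: WordRefl. Qed.

Lemma word_eqb_sym : symmetric word_eqb.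
Proof. by move=> u v; apply/asboolP/asboolP; exact: WordSym. Qed.

Lemma word_eqb_trans : transitive word_eqb.
Proof.
by move=> v u w /asboolP uv /asboolP vw; apply/asboolP; exact: WordTrans uv vw.
Qed.

Canonical word_equiv :=
  EquivRel word_eqb word_eqb_refl word_eqb_sym word_eqb_trans.

(* PSL_2(Z) = < a, b | a^2 = b^3 = 1 > *)
Definition psl2z := {eq_quot word_equiv}.
HB.instance Definition _ := Choice.on psl2z.
HB.instance Definition _ := EqQuotient.on psl2z.

Definition of_word (w : word) : psl2z := \pi_psl2z w.

Lemma of_wordP u v : of_word u = of_word v <-> word_eqv u v.
Proof.
split => [/eqquotP/asboolP //|uv]; apply/eqquotP; exact/asboolP.
Qed.

Lemma of_word_repr (x : psl2z) : of_word (repr x) = x.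
Proof. exact: reprK. Qed.

Lemma word_eqv_catl w u v : word_eqv u v -> word_eqv (w ++ u) (w ++ v).
Proof.
elim=> {u v} [u r v rP|u|u v _ +|u v t _ + _ +].
- by have := @WordRel (w ++ u) r v rP; rewrite -!catA.
- exact: WordRefl.
- exact: WordSym.
- exact: WordTrans.
Qed.

Lemma word_eqv_catr w u v : word_eqv u v -> word_eqv (u ++ w) (v ++ w).
Proof.
elim=> {u v} [u r v rP|u|u v _ +|u v t _ + _ +].
- by rewrite -!catA; exact/WordRel.
- exact: WordRefl.
- exact: WordSym.
- exact: WordTrans.
Qed.

Lemma word_eqv_inv u v : word_eqv u v -> word_eqv (word_inv u) (word_inv v).
Proof.
elim=> {u v} [u r v rP|u|u v _ +|u v t _ + _ +].
- rewrite /word_inv !map_cat !rev_cat -catA.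
  have : rev (map letter_inv r) \in relators \/
         r = [:: Lb; Lb; Lb].
    by move: rP; rewrite !inE => /or4P[]/eqP->; [left|right|left|left].
  case=> [rP'|->]; first exact: WordRel.
  move: (rev (map _ v)) (rev (map _ u)) => s t.
  rewrite -[rev _]/[:: Lb'; Lb'; Lb'].
  apply: (@WordTrans _ (s ++ [:: Lb; Lb; Lb] ++ [:: Lb'; Lb'; Lb'] ++ t)).
    exact/WordSym/(WordRel s (r := [:: Lb; Lb; Lb])).
  apply: (@WordTrans _ (s ++ [:: Lb; Lb] ++ [:: Lb'; Lb'] ++ t)).
    by have := @WordRel (s ++ [:: Lb; Lb]) [:: Lb; Lb'] ([:: Lb'; Lb'] ++ t) isT;
      rewrite -!catA.
  apply: (@WordTrans _ (s ++ [:: Lb] ++ [:: Lb'] ++ t)).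
    by have := @WordRel (s ++ [:: Lb]) [:: Lb; Lb'] ([:: Lb'] ++ t) isT;
      rewrite -!catA.
  exact: (@WordRel s [:: Lb; Lb'] t).
- exact: WordRefl.
- exact: WordSym.
- exact: WordTrans.
Qed.

Lemma word_eqv_mulV w : word_eqv (w ++ word_inv w) [::].
Proof.
elim: w => [|l w IH]; first exact: WordRefl.
rewrite /word_inv /= rev_cons -cats1 catA.
apply: (@WordTrans _ ([:: l] ++ [:: letter_inv l])).
  exact: (word_eqv_catl [:: l] (word_eqv_catr [:: letter_inv l] IH)).
by apply: (WordRel [::] (r := [:: l; letter_inv l]) [::]); case: l.
Qed.

Lemma word_invK : involutive word_inv.
Proof.
move=> w; rewrite /word_inv map_rev revK -map_comp map_id_in // => l _ /=.
by case: l.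
Qed.

Definition psl2z_one : psl2z := of_word [::].
Definition psl2z_inv (x : psl2z) : psl2z := of_word (word_inv (repr x)).
Definition psl2z_mul (x y : psl2z) : psl2z := of_word (repr x ++ repr y).

Lemma repr_of_word w : word_eqv (repr (of_word w)) w.
Proof. by apply/of_wordP; rewrite of_word_repr. Qed.

Lemma psl2z_mulE u v : psl2z_mul (of_word u) (of_word v) = of_word (u ++ v).
Proof.
apply/of_wordP; apply: WordTrans (word_eqv_catl u (repr_of_word v)).
exact/word_eqv_catr/repr_of_word.
Qed.

Lemma psl2z_invE u : psl2z_inv (of_word u) = of_word (word_inv u).
Proof. exact/of_wordP/word_eqv_inv/repr_of_word. Qed.

Lemma psl2z_mulA : associative psl2z_mul.
Proof.
move=> x y z; rewrite -[x]of_word_repr -[y]of_word_repr -[z]of_word_repr.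
by rewrite !psl2z_mulE catA.
Qed.

Lemma psl2z_mul1 : left_id psl2z_one psl2z_mul.
Proof. by move=> x; rewrite -[x]of_word_repr psl2z_mulE. Qed.

Lemma psl2z_mulr1 : right_id psl2z_one psl2z_mul.
Proof. by move=> x; rewrite -[x]of_word_repr psl2z_mulE cats0. Qed.

Lemma psl2z_mulrV : right_inverse psl2z_one psl2z_inv psl2z_mul.
Proof.
move=> x; rewrite -[x]of_word_repr psl2z_invE psl2z_mulE.
exact/of_wordP/word_eqv_mulV.
Qed.

Lemma psl2z_mulVr : left_inverse psl2z_one psl2z_inv psl2z_mul.
Proof.
move=> x; rewrite -[x]of_word_repr psl2z_invE psl2z_mulE.
by apply/of_wordP; have := word_eqv_mulV (word_inv (repr x)); rewrite word_invK.
Qed.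

HB.instance Definition _ := isGroup.Build psl2z
  psl2z_mulA psl2z_mul1 psl2z_mulr1 psl2z_mulVr psl2z_mulrV.

Lemma of_word_cat u v : of_word (u ++ v) = of_word u * of_word v.
Proof. by rewrite -psl2z_mulE. Qed.

Lemma of_word_inv u : of_word (word_inv u) = (of_word u)^-1.
Proof. by rewrite -psl2z_invE. Qed.

(* In a normal word exactly one of any two consecutive letters is [La]; this
   includes all the words of length at most 1. *)
Definition normal_word (w : word) : bool :=
  sorted (fun l l' => (l == La) != (l' == La)) w.

Definition subgroup (G : groupType) (H : set G) : Prop :=
  [/\ H 1, forall x y, H x -> H y -> H (x * y) & forall x, H x -> H x^-1].

Definition finitely_generated (G : groupType) (H : set G) : Prop :=
  exists2 S : set G, finite_set S & H = smallest (@subgroup G) S.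

(* the right coset H g *)
Definition coset (G : groupType) (H : set G) (g : G) : set G :=
  [set h * g | h in H].

(* the conjugate H^x = x^-1 H x *)
Definition conj_set (G : groupType) (H : set G) (x : G) : set G :=
  [set conjg h x | h in H].

Definition almost_malnormal (G : groupType) (H : set G) : Prop :=
  forall x : G, ~ H x -> finite_set (H `&` conj_set H x).

(* Rooted graphs with [a]-edges and directed [b]-edges; the [a]-edges are
   undirected in the sense that [aedges] is a symmetric set of pairs in all the
   graphs below. *)
Record rgraph (V : Type) := RGraph {
  vertices : set V;
  aedges : set (V * V);
  bedges : set (V * V);
  root : V }.

Definition step (V : Type) (Gamma : rgraph V) (u : V) (l : letter) (v : V) :=
  match l with
  | La => aedges Gamma (u, v)
  | Lb => bedges Gamma (u, v)
  | Lb' => bedges Gamma (v, u)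
  end.

Fixpoint path_labeled (V : Type) (Gamma : rgraph V) (u : V) (w : word) (v : V)
    : Prop :=
  if w is l :: w' then exists2 u', step Gamma u l u' & path_labeled Gamma u' w' v
  else vertices Gamma u /\ u = v.

Definition schreier (H : set psl2z) : rgraph (set psl2z) := {|
  vertices := range (coset H);
  aedges := [set (coset H g, coset H (g * of_word [:: La])) | g in setT];
  bedges := [set (coset H g, coset H (g * of_word [:: Lb])) | g in setT];
  root := H |}.

(* [visited H v]: a loop at the root of the Schreier graph, labeled by the
   normal form of an element of [H], goes through the vertex [v]. *)
Definition visited (H : set psl2z) (v : set psl2z) : Prop :=
  exists w1 w2 : word,
    [/\ normal_word (w1 ++ w2), H (of_word (w1 ++ w2)),
        path_labeled (schreier H) H w1 v & path_labeled (schreier H) v w2 H].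

(* [traversed H u l v]: such a loop goes from [u] to [v] reading [l]. *)
Definition traversed (H : set psl2z) (u : set psl2z) (l : letter)
    (v : set psl2z) : Prop :=
  exists w1 w2 : word,
    [/\ normal_word (w1 ++ l :: w2), H (of_word (w1 ++ l :: w2)),
        path_labeled (schreier H) H w1 u, step (schreier H) u l v
      & path_labeled (schreier H) v w2 H].

Definition stallings (H : set psl2z) : rgraph (set psl2z) := {|
  vertices := visited H;
  aedges := [set e | traversed H e.1 La e.2 \/ traversed H e.2 La e.1];
  bedges := [set e | traversed H e.1 Lb e.2 \/ traversed H e.2 Lb' e.1];
  root := H |}.

Definition subgroups_of_size (n : nat) : set (set psl2z) :=
  [set H | [/\ subgroup H, finitely_generated H
             & (vertices (stallings H) #= `I_n)%card]].

(* The probability of [E] under the uniform distribution on the subgroups of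
   size [n]; [fset_set] is meaningful because there are finitely many of them. *)
Definition prob_size (R : realType) (n : nat) (E : set (set psl2z)) : R :=
  (#|` fset_set (subgroups_of_size n `&` E)|%:R /
   #|` fset_set (subgroups_of_size n)|%:R)%R.

(* Main.v *)
Require Import Defs.
From HB Require Import structures.
From mathcomp Require Import all_boot all_order all_algebra finmap.
From mathcomp Require Import fingroup perm action.
From mathcomp Require Import all_classical all_reals all_analysis.
From mathcomp Require Import zify ring lra.
Import Order.TTheory GRing.Theory Num.Theory.
Import numFieldNormedType.Exports.

(* A subgroup of size n, with a labeling of its n vertices, is an involution a
   (the fixed points are the a-loops) together with a partial permutation b whose
   orbits are loops, isolated edges and triangles; only the root may lack an
   a-edge or a b-edge. Conversely every connected such pair comes from a subgroup,
   because a normal path in it can be continued along permutations until it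
   closes up. So it suffices to estimate proportions of pairs (a, b), provided
   that a positive proportion of them is connected.

   If the Stallings graph has a loop labeled (ba)^j at a vertex y which is moved
   by ba, then a conjugate g of ba is not in H while g^j is, and the infinite
   subgroup generated by g^j is contained in the intersection of H and H^g. So an
   almost malnormal subgroup has no cycle of length j >= 2 labeled by ba. Let e_j
   be the proportion of the pairs without cycles of lengths 2, ..., j. For fixed b
   and for a vertex y, conjugating a by the transposition (y p), where p is the
   endpoint of the path labeled (ba)^j at y, creates a cycle of length j through
   y. As long as the neighbourhood of y looks like a tree, it creates no other
   cycle of length at most j, and the move is undone by choosing y among j
   vertices and p among n; hence e_j <= j (e_(j-1) - e_j) + eta, where eta is the
   mean proportion of bad vertices. Summing up, e_N <= 2/N + eta.

   Isolated edges are the main reason for a vertex to be bad: merging or cutting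
   orbits shows that there are O(n^(2/3)) of them on average, against O(n^(1/2))
   a-loops and O(n^(1/3)) b-loops. So eta = O(N n^(-1/3) + N^2 / n), and
   N = n^(1/6) gives e_N = O(n^(-1/6)).

   For connectivity, conjugate a by a random permutation. The mean number of
   k-sets stable under a and b is N_a(k) N_b(k) / 'C(n, k), where N_a(k) is about
   'C(n, k)^(1/2) and N_b(k) is about 'C(n, k)^(1/3), up to a factor
   exp(O(k^(2/3))) accounting for the loops and isolated edges. The sum over
   1 <= k <= n/2 is at most 1/2 for n large. *)

Set Implicit Arguments.
Unset Strict Implicit.
Unset Printing Implicit Defensive.

(** * Walks without collisions *)

Section Walks.
Variables (V : finType) (b : {perm V}).
Implicit Types (a : {perm V}) (v y : V) (e : nat -> bool).

Definition involutions : {set {perm V}} := [set a : {perm V} | [forall v, a (a v) == v]].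

Lemma involutionsP a : reflect (involutive a) (a \in involutions).
Proof. by rewrite inE; apply: (iffP forallP) => h v; apply/eqP/h. Qed.

Definition tri v := (b (b (b v)) == v) && (b v != v).

Lemma tri_b v : tri (b v) = tri v.
Proof. by rewrite /tri !(inj_eq perm_inj). Qed.

Lemma tri_bV v : tri (b^-1%g v) = tri v.
Proof. by rewrite -tri_b permKV. Qed.

Definition bsgn (s : bool) : {perm V} := if s then b else b^-1%g.

Lemma bsgn_neq s v : tri v -> bsgn s v != v.
Proof.
case/andP=> _ h; case: s => //=; apply: contra_neq h => h.
by rewrite -{1}h permKV.
Qed.

Lemma porbit_b v : porbit b (b v) = porbit b v.
Proof. by rewrite -[RHS](porbit_perm b 1) expg1. Qed.

Lemma porbit_bsgn s v : porbit b (bsgn s v) = porbit b v.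
Proof. by case: s => /=; rewrite ?porbit_b // -{2}(permKV b v) porbit_b. Qed.

Lemma tri_expgM3 v m : tri v -> (b ^+ (3 * m))%g v = v.
Proof.
move=> /andP[/eqP h _]; elim: m => [|m IH]; first by rewrite expg0 perm1.
by rewrite mulnS expgD permM expgS expgS expg1 !permM h.
Qed.

Lemma tri_iter v k : tri v -> (b ^+ (k %% 3)) %g v = (b ^+ k)%g v.
Proof.
by move=> tv; rewrite [in RHS](divn_eq k 3) mulnC expgD permM tri_expgM3.
Qed.

Lemma porbit_eq_tri u v : tri u -> porbit b v = porbit b u ->
  exists r : 'I_3, v = (b ^+ r)%g u.
Proof.
move=> tu /eqP; rewrite eq_porbit_mem => /porbitP[k ->].
by exists (inord (k %% 3)); rewrite inordK ?ltn_mod // tri_iter.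
Qed.

(** For an involution [t] this is conjugation by [t]; it is applied to transpositions. *)
Definition cj a (t : {perm V}) : {perm V} := (t * a * t)%g.

Lemma cjE a t v : cj a t v = t (a (t v)).
Proof. by rewrite /cj !permM. Qed.

Lemma cjK a x y : cj (cj a (tperm x y)) (tperm x y) = a.
Proof. by apply/permP => v; rewrite !cjE !tpermK. Qed.

Lemma cj_invol a x y : a \in involutions -> cj a (tperm x y) \in involutions.
Proof.
by move/involutionsP => h; apply/involutionsP => v; rewrite !cjE tpermK h tpermK.
Qed.

Fixpoint walk a e v k : V :=
  if k is k'.+1 then a (bsgn (e k') (walk a e v k')) else v.

Lemma walk_inj a e k : injective (fun v => walk a e v k).
Proof. by elim: k => [|k IH] u v //= /perm_inj /perm_inj /IH. Qed.

(** Distinct triangles along the walk express that its neighbourhood looks like a tree. *)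
Definition clean a e K v :=
  [forall k : 'I_K.+1, tri (walk a e v k)] &&
  [forall k : 'I_K.+1, forall l : 'I_K.+1,
     (l < k) ==> (porbit b (walk a e v k) != porbit b (walk a e v l))].

Definition ntri := #|[set v | ~~ tri v]|.
Definition fixn a := #|[set v | a v == v]|.

(** The walk first fails at step [k.+1], where it enters the orbit of its [l]-th vertex at the point
    singled out by [r]; arriving by an a-loop is excluded. *)
Definition collision e k (l : nat) (r : 'I_3) : {set {perm V} * V} :=
  [set av | [&& av.1 \in involutions,
    [forall i : 'I_k.+1, tri (walk av.1 e av.2 i)],
    [forall i : 'I_k.+1, forall j : 'I_k.+1, (j < i) ==>
        (porbit b (walk av.1 e av.2 i) != porbit b (walk av.1 e av.2 j))],
    walk av.1 e av.2 k.+1 != bsgn (e k) (walk av.1 e av.2 k) &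
    walk av.1 e av.2 k.+1 == (b ^+ r)%g (walk av.1 e av.2 l)]].

(* The walk is forced to go to an arbitrary vertex [t] off the walk instead of
   colliding with itself, by conjugating [a] with the transposition of [t] and
   the collision point. *)
Lemma collision_bound e k l r : l <= k ->
  #|collision e k l r| * (#|V| - (2 * k).+1) <= #|involutions| * #|V|.
Proof.
move=> lk.
pose W (a : {perm V}) (v : V) : {set V} :=
  [set walk a e v i | i : 'I_k.+1] :|: [set bsgn (e (i : 'I_k.+1)) (walk a e v i) | i : 'I_k.+1].
(* The ends of the a-edges of the first [k] steps and the start of the last one, at most 2k + 1
   vertices: a [t] outside this set can replace the collision point without disturbing the walk
   before it. *)
pose W1 (a : {perm V}) (v : V) : {set V} :=
  [set walk a e v i.+1 | i : 'I_k] :|: [set bsgn (e (i : 'I_k.+1)) (walk a e v i) | i : 'I_k.+1].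
pose D := [set x : ({perm V} * V) * V | (x.1 \in collision e k l r) &&
                                        (x.2 \notin W1 x.1.1 x.1.2)].
have cD : #|collision e k l r| * (#|V| - (2 * k).+1) <= #|D|.
  rewrite -[leqRHS]sum1_card (eq_bigl _ _ (finset.in_set _)) /=.
  rewrite -(pair_big_dep (mem (collision e k l r)) (fun av t => t \notin W1 av.1 av.2) (fun _ _ => 1)) /=.
  rewrite -sum_nat_const; apply: leq_sum => av _; rewrite sum1_card.
  have -> : #|[pred t | t \notin W1 av.1 av.2]| = #|~: W1 av.1 av.2|.
    by apply: eq_card => t; rewrite !inE.
  rewrite finset.cardsCs finset.setCK; apply: leq_sub2l.
  apply: leq_trans (leq_card_setU _ _) _.
  rewrite (_ : (2 * k).+1 = k + k.+1); last by lia.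
  by apply: leq_add; rewrite (leq_trans (leq_imset_card _ _)) // card_ord.
apply: leq_trans cD _.
rewrite -cardsT -finset.cardsX.
pose phi (x : ({perm V} * V) * V) :=
  (cj x.1.1 (tperm (walk x.1.1 e x.1.2 k.+1) x.2), x.1.2).
have phiW x : x \in D -> (forall i, i <= k -> walk (phi x).1 e x.1.2 i = walk x.1.1 e x.1.2 i)
    /\ walk (phi x).1 e x.1.2 k.+1 = x.2.
  case: x => [[a v] t]; rewrite inE /= => /andP[]; rewrite inE /=.
  case/and5P => /involutionsP ai /forallP tr /forallP di nf _ nt.
  set z := a _ in nf *; set w := walk a e v.
  have zE : z = w k.+1 by [].
  have tri_w i : i <= k -> tri (w i).
    by move=> ik; have := tr (Ordinal (ik : i < k.+1)).
  have orb i j : i <= k -> j <= k -> porbit b (w i) = porbit b (w j) -> i = j.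
    move=> ik jk E; case: (ltngtP i j) => // ij.
      have := di (Ordinal (jk : j < k.+1)) => /forallP/(_ (Ordinal (ik : i < k.+1))).
      by rewrite /= ij /= -/w E eqxx.
    have := di (Ordinal (ik : i < k.+1)) => /forallP/(_ (Ordinal (jk : j < k.+1))).
    by rewrite /= ij /= -/w E eqxx.
  have ntw i : i < k -> t != w i.+1.
    move=> ik; apply: contra nt => /eqP ->; apply/setUP; left.
    by apply/imsetP; exists (Ordinal ik).
  have ntz i : i <= k -> t != bsgn (e i) (w i).
    move=> ik; apply: contra nt => /eqP ->; apply/setUP; right.
    by apply/imsetP; exists (Ordinal (ik : i < k.+1)).
  (* If [z] were the start of the [i]-th a-edge, [w i.+1] would be in the orbit of [w k], so
     [i.+1 = k] and [bsgn] would fix a triangle vertex. For [i = k] the a-edge would be a loop. *)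
  have nzz i : i <= k -> z != bsgn (e i) (w i).
    move=> ik; apply/negP => /eqP E.
    have : a z = w i.+1 by rewrite /w /= -/(w i) -E.
    rewrite {1}/z ai => E2.
    case: (ltnP i k) => ik2.
      have /orb : porbit b (w k) = porbit b (w i.+1) by rewrite -E2 porbit_bsgn.
      move=> /(_ (leqnn _) ik2) ki; move: E2; rewrite -ki; apply/eqP.
      by rewrite bsgn_neq // tri_w.
    have ik3 : i = k by apply/eqP; rewrite eqn_leq ik ik2.
    by case/eqP: nf; rewrite E ik3.
  have nzw i : i < k -> z != w i.+1.
    move=> ik; apply/negP => /eqP; rewrite zE /= => /perm_inj E.
    have /orb : porbit b (w k) = porbit b (w i) by rewrite -(porbit_bsgn (e k)) E porbit_bsgn.
    by move=> /(_ (leqnn _) (ltnW ik)) ki; move: ik; rewrite ki ltnn.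
  have sw i : i <= k -> walk (cj a (tperm z t)) e v i = w i.
    elim: i => [//|i IH] ik /=; rewrite IH ?(ltnW ik) //.
    have ik' := ltnW ik.
    by rewrite cjE (tpermD (nzz _ ik') (ntz _ ik')) tpermD ?ntw ?nzw.
  split=> //=.
  by rewrite sw // cjE (tpermD (nzz _ (leqnn _)) (ntz _ (leqnn _))) -/w tpermL.
(* The new walk still determines the collision point as a power of [b] applied to its [l]-th vertex,
   and its last vertex is [t]; conjugating back recovers [a]. *)
have injphi : {in D &, injective phi}.
  move=> x y xD yD E.
  have [wx tx] := phiW _ xD; have [wy ty] := phiW _ yD.
  have Ev : x.1.2 = y.1.2 by case: E.
  have Et : x.2 = y.2 by rewrite -tx -ty Ev E.
  have Ez : walk x.1.1 e x.1.2 k.+1 = walk y.1.1 e y.1.2 k.+1.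
    move: xD yD; rewrite !inE => /andP[/and5P[_ _ _ _ /eqP ->] _].
    move=> /andP[/and5P[_ _ _ _ /eqP ->] _].
    by rewrite -wx // -wy // E Ev.
  case: x y E Ev Et Ez {xD yD wx wy tx ty} => [[a v] t] [[a' v'] t'].
  move=> /= [E _] Ev Et; rewrite /phi /= in E * => Ez.
  subst v' t'; rewrite Ez in E; congr (_, _, _).
  by rewrite -[a](cjK _ (walk a' e v k.+1) t) /= E cjK.
rewrite -(card_in_imset injphi); apply/subset_leq_card/fintype.subsetP => _ /imsetP[x xD ->].
rewrite finset.in_setX finset.in_setT andbT.
move: xD; rewrite !inE => /andP[/and5P[h _ _ _ _] _].
have := cj_invol (walk x.1.1 e x.1.2 k.+1) x.2 (a := x.1.1); rewrite !inE; exact.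
Qed.

Lemma sum_card_pred (T : finType) (P : pred T) : #|[set v | P v]| = \sum_v P v.
Proof.
rewrite -sum1_card big_mkcond /=; apply: eq_bigr => v _.
by rewrite inE; case: (P v).
Qed.

(** Absent the first two defects, the least index whose orbit was met before gives a [collision]. *)
Lemma uncleanP a e K v : a \in involutions -> ~~ clean a e K v ->
  [\/ exists k : 'I_K.+1, ~~ tri (walk a e v k),
      exists k : 'I_K, a (bsgn (e k) (walk a e v k)) == bsgn (e k) (walk a e v k) |
      exists k l : 'I_K, exists r, (l <= k) && ((a, v) \in collision e k l r)].
Proof.
move=> ai nc; set w := walk a e v.
have [/existsP h|/existsPn tr] := boolP [exists k : 'I_K.+1, ~~ tri (w k)]; first by constructor 1.
have [/existsP h|/existsPn nf] := boolP [exists k : 'I_K,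
   a (bsgn (e k) (w k)) == bsgn (e k) (w k)]; first by constructor 2.
constructor 3.
have tri_w i : i <= K -> tri (w i).
  by move=> ik; have := tr (Ordinal (ik : i < K.+1)); rewrite negbK.
pose P k := (k <= K) && [exists l : 'I_K.+1, (l < k) && (porbit b (w k) == porbit b (w l))].
have exP : exists k, P k.
  move: nc; rewrite negb_and => /orP[/forallPn[k]|/forallPn[k /forallPn[l]]].
    by rewrite tri_w // -ltnS ltn_ord.
  rewrite negb_imply negbK => /andP[lk E]; exists k; rewrite /P -ltnS ltn_ord /=.
  by apply/existsP; exists l; rewrite lk.
case: (ex_minnP exP) => -[|k] /andP[kK /existsP[l /andP[lk E]]] kmin //.
have lK : l < K by apply: leq_trans lk kK.
have [r Er] := porbit_eq_tri (tri_w l (ltnW lK)) (eqP E).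
exists (Ordinal kK), (Ordinal lK), r; rewrite /= -ltnS lk /= inE /= ai /=.
apply/and4P; split.
- by apply/forallP => i; apply: tri_w; apply: leq_trans (leq_ord i) (ltnW kK).
- apply/forallP => i; apply/forallP => j; apply/implyP => ji; apply/negP => E'.
  suff /kmin : P i by rewrite ltnNge -ltnS ltn_ord.
  have iK : i <= K by apply: leq_trans (leq_ord i) (ltnW kK).
  rewrite /P iK /=; apply/existsP.
  by exists (Ordinal (leq_trans ji (leqW iK))); rewrite /= ji.
- exact: (nf (Ordinal kK)).
- exact/eqP.
Qed.

(** Union bound over the steps. For fixed [a], the [k]-th vertex is an injective function of the
    origin, so over all origins each step meets at most [ntri] bad orbits and [fixn a] loops. Each
    of at most 3 K^2 collision sets has at most 2 elements per involution, because at least half of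
    the vertices are available as [t] in [collision_bound]. *)
Lemma unclean_bound e K : 4 * K + 2 <= #|V| ->
  \sum_(a in involutions) #|[set v | ~~ clean a e K v]| <=
  K.+1 * ntri * #|involutions| + K * (\sum_(a in involutions) fixn a)
    + 6 * K ^ 2 * #|involutions|.
Proof.
move=> Kn.
pose t1 (a : {perm V}) v := \sum_(k < K.+1) ~~ tri (walk a e v k).
pose t2 (a : {perm V}) v := \sum_(k < K)
  (a (bsgn (e k) (walk a e v k)) == bsgn (e k) (walk a e v k)).
pose t3 (a : {perm V}) v := \sum_(k < K) \sum_(l < K | l <= k)
  \sum_(r < 3) ((a, v) \in collision e k l r).
have le1 (a : {perm V}) : a \in involutions ->
  #|[set v | ~~ clean a e K v]| <= \sum_v t1 a v + \sum_v t2 a v + \sum_v t3 a v.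
  move=> ai; rewrite sum_card_pred -!big_split /=; apply: leq_sum => v _.
  case: (boolP (clean a e K v)) => //= nc.
  have [[k h]|[k h]|[k [l [r /andP[lk h]]]]] := uncleanP ai nc.
  - by rewrite -addnA; apply: leq_trans _ (leq_addr _ _); rewrite /t1 (bigD1 k) //= h.
  - rewrite addnAC; apply: leq_trans _ (leq_addl _ _).
    by rewrite /t2 (bigD1 k) //= h.
  - apply: leq_trans _ (leq_addl _ _).
    by rewrite /t3 (bigD1 k) //= (bigD1 l) //= (bigD1 r) //= h.
apply: (@leq_trans (\sum_(a in involutions)
  (\sum_v t1 a v + \sum_v t2 a v + \sum_v t3 a v))); first exact: leq_sum.
rewrite !big_split /=; apply: leq_add; first apply: leq_add.
- rewrite [leqRHS]mulnC -sum_nat_const; apply: leq_sum => a _.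
  rewrite /t1 exchange_big /= -[X in _ <= X * _](card_ord K.+1) -sum_nat_const; apply: leq_sum => k _.
  rewrite -(sum_card_pred (fun v => ~~ tri (walk a e v k))).
  rewrite -(card_imset _ (@walk_inj a e k)); apply/subset_leq_card/fintype.subsetP => _ /imsetP[v + ->].
  by rewrite !inE.
- rewrite big_distrr /=; apply: leq_sum => a _.
  rewrite /t2 exchange_big /= -[X in _ <= X * _](card_ord K) -sum_nat_const; apply: leq_sum => k _.
  rewrite -(sum_card_pred (fun v => a (bsgn (e k) (walk a e v k)) == bsgn (e k) (walk a e v k))).
  rewrite -(card_imset _ (inj_comp (@perm_inj _ (bsgn (e k))) (@walk_inj a e k))).
  by apply/subset_leq_card/fintype.subsetP => _ /imsetP[v + ->]; rewrite !inE.
- have col k l r : k < K -> l <= k -> #|collision e k l r| <= 2 * #|involutions|.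
    move=> kK lk; have := collision_bound e r lk.
    have : #|V| <= 2 * (#|V| - (2 * k).+1) by lia.
    move: #|collision _ _ _ _| #|involutions| (#|V| - _) => x y z; nia.
  have t3E : \sum_(a in involutions) \sum_v t3 a v <=
     \sum_(k < K) \sum_(l < K | l <= k) \sum_(r < 3) #|collision e k l r|.
    rewrite pair_big_dep /= /t3 exchange_big /=; apply: leq_sum => k _.
    rewrite exchange_big /=; apply: leq_sum => l _.
    rewrite exchange_big /=; apply: leq_sum => r _.
    rewrite -[leqRHS]sum1_card [leqRHS]big_mkcond /=.
    rewrite [leqLHS]big_mkcond /=; apply: leq_sum => -[a v] _ /=.
    by case: ifP => _; case: (_ \in collision _ _ _ _).
  apply: leq_trans t3E _.
  apply: (@leq_trans (\sum_(k < K) \sum_(l < K) \sum_(r < 3) 2 * #|involutions|)).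
    apply: leq_sum => k _; rewrite big_mkcond /=; apply: leq_sum => l _.
    by case: ifP => // lk; apply: leq_sum => r _; apply: col.
  rewrite !sum_nat_const !card_ord -mulnn; move: #|involutions| => x; nia.
Qed.

End Walks.

(** * Creating a short cycle by a switch *)

Ltac nat_lia := repeat match goal with H : ?T |- _ =>
  lazymatch T with
  | nat => fail
  | is_true (leq _ _) => fail
  | _ => clear H
  end end; lia.

Section Switch.
Variables (V : finType) (b : {perm V}).
Implicit Types (a : {perm V}) (v y : V).

Definition ab a v := a (b v).

Lemma ab_inj a : injective (ab a).
Proof. by move=> u v /perm_inj /perm_inj. Qed.

(** Cycles of length exactly [j], through triangles only: there the letters of ba can be read in the
    graph of the subgroup. *)
Definition cyc a j v := [&& iter j (ab a) v == v,
  [forall i : 'I_j, (0 < i) ==> (iter i (ab a) v != v)] &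
  [forall i : 'I_j, tri b (iter i (ab a) v)]].

Definition acyc j : {set {perm V}} := [set a in involutions V |
  [forall i : 'I_j.+1, forall v, (1 < i) ==> ~~ cyc a i v]].

Lemma acycP j a : reflect (a \in involutions V /\
   forall i v, 1 < i -> i <= j -> ~~ cyc a i v) (a \in acyc j).
Proof.
rewrite [X in reflect _ X]finset.in_set; apply: (iffP andP) => -[ai h]; split=> //.
  move=> i v i1 ij; have := forallP h (Ordinal (ij : i < j.+1)).
  by move=> /forallP/(_ v); rewrite i1.
by apply/forallP => i; apply/forallP => v; apply/implyP => i1; apply: h (leq_ord i).
Qed.

Definition target a j y := iter j (ab a) y.
Definition switch a j y := cj a (tperm y (target a j y)).

(** Signs of four walks: A goes back from [p] to [q] along the path and then forward from [q]; B
    passes through [x] and goes forward; C follows the path from [y], leaves its last triangle by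
    the third vertex and so continues the path from [x]; D goes forward through [y] all along. *)
Definition sgA j k := j < k.
Definition sgB (k : nat) := 0 < k.
Definition sgC (j k : nat) := k != j.
Definition sgD (k : nat) := true.

(* With [p := target a j y], [q := a y] and [x := a p], the walks from [b p] and
   [b^-1 q] contain the vertices reached by the paths labeled [(ba)^i], [i < j],
   from the ends [x], [y], [p], [q] of the edges changed by the switch. *)
Definition good a j y := [&& clean b a (sgA j) (2 * j) (b (target a j y)),
   clean b a sgB (2 * j) (b (target a j y)),
   clean b a (sgC j) (2 * j) (b^-1%g (a y)) &
   clean b a sgD (2 * j) (b^-1%g (a y))].

Lemma cleanP a e K v : clean b a e K v ->
  (forall k, k <= K -> tri b (walk b a e v k)) /\
  (forall k l, k <= K -> l <= K -> k != l ->
     porbit b (walk b a e v k) != porbit b (walk b a e v l)).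
Proof.
case/andP=> /forallP tr /forallP di; split=> [k kK|k l kK lK].
  exact: (tr (Ordinal (kK : k < K.+1))).
rewrite neq_ltn => /orP[kl|lk].
  have := di (Ordinal (lK : l < K.+1)) => /forallP/(_ (Ordinal (kK : k < K.+1))).
  by rewrite /= kl eq_sym.
have := di (Ordinal (kK : k < K.+1)) => /forallP/(_ (Ordinal (lK : l < K.+1))).
by rewrite /= lk.
Qed.

Lemma walkS a e v k :
  walk b a e v k.+1 = a (bsgn b (e k) (walk b a e v k)).
Proof. by []. Qed.

Section Good.
Variables (a : {perm V}) (j : nat) (y : V).
Hypotheses (ai : a \in involutions V) (j1 : 1 < j) (gd : good a j y).
Let p := target a j y.
Let q := a y.
Let x := a p.
Let a' := switch a j y.
Let O v := porbit b v.
Let g := ab a.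

Let aK : involutive a. Proof. exact/involutionsP. Qed.

Let x_def : x = b (iter j.-1 g y).
Proof. by rewrite /x /p /target -{1}(ltn_predK j1) iterS aK. Qed.

Let walkA i : i <= j.+1 -> walk b a (sgA j) (b p) i =
  if i is i'.+1 then a (iter (j - i') g y) else b p.
Proof.
elim: i => [//|i IH] ij /=; rewrite IH ?(ltnW ij) //.
rewrite /sgA ltnNge -ltnS ij /=; case: i ij {IH} => [|i] ij.
  by rewrite permK subn0.
by rewrite subnS -(@prednK (j - i)) ?subn_gt0 // iterS /g /ab aK permK.
Qed.

Let walkA2 i : walk b a (sgA j) (b p) (j.+1 + i) = iter i g q.
Proof.
elim: i => [|i IH]; first by rewrite addn0 walkA // subnn.
by rewrite addnS walkS IH /sgA leq_addr.
Qed.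

Let walkB i : walk b a sgB (b p) i.+1 = iter i g x.
Proof. by elim: i => [|i IH] /=; rewrite ?permK // -IH. Qed.

Let walkD i : walk b a sgD (b^-1%g q) i.+1 = iter i g y.
Proof. by elim: i => [|i IH] /=; rewrite ?permKV ?aK // -IH. Qed.

Let walkC i : i < j -> walk b a (sgC j) (b^-1%g q) i.+1 = iter i g y.
Proof.
elim: i => [|i IH] ij /=; first by rewrite /sgC /= ltn_eqF ?(ltnW j1) //= permKV aK.
by rewrite -IH ?(ltnW ij) //= /sgC ltn_eqF.
Qed.

Let O_A k l : k <= 2 * j -> l <= 2 * j -> k != l ->
  O (walk b a (sgA j) (b p) k) != O (walk b a (sgA j) (b p) l).
Proof. by case/and4P: gd => /cleanP[_ h] _ _ _; exact: h. Qed.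
Let O_B k l : k <= 2 * j -> l <= 2 * j -> k != l ->
  O (walk b a sgB (b p) k) != O (walk b a sgB (b p) l).
Proof. by case/and4P: gd => _ /cleanP[_ h] _ _; exact: h. Qed.
Let O_C k l : k <= 2 * j -> l <= 2 * j -> k != l ->
  O (walk b a (sgC j) (b^-1%g q) k) != O (walk b a (sgC j) (b^-1%g q) l).
Proof. by case/and4P: gd => _ _ /cleanP[_ h] _; exact: h. Qed.
Let O_D k l : k <= 2 * j -> l <= 2 * j -> k != l ->
  O (walk b a sgD (b^-1%g q) k) != O (walk b a sgD (b^-1%g q) l).
Proof. by case/and4P: gd => _ _ _ /cleanP[_ h]; exact: h. Qed.

Let Ob v : O (b v) = O v. Proof. exact: porbit_b. Qed.
Let Oq : O (b^-1%g q) = O q. Proof. by rewrite -Ob permKV. Qed.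

Let tri_y i : i < 2 * j -> tri b (iter i g y).
Proof. by move=> ij; case/and4P: gd => _ _ _ /cleanP[/(_ i.+1 ij)]; rewrite walkD. Qed.

Let tri_q : tri b q.
Proof.
case/and4P: gd => _ _ /cleanP[/(_ 0 isT)] + _ _.
by rewrite /= tri_bV.
Qed.

Let tri_x i : i < 2 * j -> tri b (iter i g x).
Proof. by move=> ij; case/and4P: gd => _ /cleanP[/(_ i.+1 ij)]; rewrite walkB. Qed.

Let nb_y i : i < 2 * j -> b (iter i g y) != iter i g y.
Proof. by move=> /tri_y/andP[]. Qed.
Let nb_x i : i < 2 * j -> b (iter i g x) != iter i g x.
Proof. by move=> /tri_x/andP[]. Qed.

Let Oyy i k : i < 2 * j -> k < 2 * j -> i != k -> O (iter i g y) != O (iter k g y).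
Proof. by move=> ij kj ik; rewrite -!walkD; apply: O_D. Qed.

Let Oyq i : i < 2 * j -> O (iter i g y) != O q.
Proof. by move=> ij; rewrite -walkD -Oq; apply: (@O_D _ 0). Qed.

Let Ox0 : O x = O (iter j.-1 g y). Proof. by rewrite x_def Ob. Qed.

(* Since the orbits on [y]'s cycle are triangles, [b x = b^-1 (g^(j-1) y)]. *)
Let walkC2 i : walk b a (sgC j) (b^-1%g q) (j.+1 + i) = iter i.+1 g x.
Proof.
elim: i => [|i IH]; last by rewrite addnS walkS IH /sgC gtn_eqF // ltn_addr.
have := @walkC j.-1; rewrite (ltn_predK j1) leqnn => /(_ isT) wj.
rewrite addn0 walkS wj /sgC eqxx /= /g /ab; congr (a _).
apply: (@perm_inj _ b); rewrite permKV x_def.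
have lt : j.-1 < 2 * j by nat_lia.
by have /andP[/eqP -> _] := tri_y lt.
Qed.

Let Oxq i : 0 < i -> i < j -> O (iter i g x) != O q.
Proof.
case: i => // i _ ij; rewrite -walkC2 -Oq; apply: (@O_C _ 0) => //; nat_lia.
Qed.

Let Oxy i k : 0 < i -> i < j -> k < j -> O (iter i g x) != O (iter k g y).
Proof.
case: i => // i _ ij kj; rewrite -walkC2 -walkC //; apply: O_C; nat_lia.
Qed.

Let Oxp i : i < j -> O (iter i g x) != O p.
Proof. by move=> ij; rewrite -walkB -(Ob p); apply: (@O_B _ 0); nat_lia. Qed.

Let Oqp i : i < j -> O (iter i g q) != O p.
Proof. by move=> ij; rewrite -walkA2 -(Ob p); apply: (@O_A _ 0); nat_lia. Qed.

Let Oqy i k : i < j -> 0 < k -> k <= j -> O (iter i g q) != O (a (iter k g y)).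
Proof.
move=> ij k0 kj; rewrite -walkA2.
have -> : a (iter k g y) = walk b a (sgA j) (b p) (j - k).+1.
  by rewrite walkA ?subKn // ltnS leq_subr.
by apply: O_A; nat_lia.
Qed.

Let Oqy0 i : i < j -> O (iter i g q) != O y.
Proof. by move=> ij; rewrite -(Ob y) -[b y]aK; apply: (@Oqy i 1) => //; exact: ltnW. Qed.
Let Oqx i : i < j -> O (iter i g q) != O x.
Proof. by move=> ij; apply: (@Oqy i j); rewrite // ltnW. Qed.
Let Oqq i : 0 < i -> i < j -> O (iter i g q) != O q.
Proof.
move=> i0 ij; rewrite -walkA2 -[q]/(iter 0 g q) -walkA2; apply: O_A; nat_lia.
Qed.

Let Oneq u v : O u != O v -> u != v.
Proof. by apply: contra_neq => ->. Qed.
Let Obneq u v : O u != O v -> b u != v.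
Proof. by move=> h; apply: Oneq; rewrite Ob. Qed.

Let yp : y != p. Proof. by apply/Oneq/(@Oyy 0 j); nat_lia. Qed.
Let yq : y != q. Proof. by apply/Oneq/(@Oyq 0); nat_lia. Qed.
Let yx : y != x. Proof. by apply/Oneq; rewrite Ox0; apply/(@Oyy 0); nat_lia. Qed.
Let pq : p != q. Proof. by apply/Oneq/(@Oyq j); nat_lia. Qed.
Let px : p != x. Proof. by apply/Oneq; rewrite Ox0; apply/(@Oyy j); nat_lia. Qed.
Let qx : q != x. Proof. by apply/Oneq/(@Oqx 0); nat_lia. Qed.

Let a'y : a' y = x.
Proof. by rewrite /a' /switch cjE tpermL -/p -/x tpermD. Qed.
Let a'x : a' x = y.
Proof. by rewrite /a' /switch cjE (tpermD yx px) /x aK tpermR. Qed.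
Let a'p : a' p = q.
Proof. by rewrite /a' /switch cjE tpermR -/q tpermD. Qed.
Let a'q : a' q = p.
Proof. by rewrite /a' /switch cjE (tpermD yq pq) /q aK tpermL. Qed.
Let a'E v : v \notin [:: y; p; q; x] -> a' v = a v.
Proof.
rewrite !inE !negb_or => /and4P[vy vp vq vx].
rewrite /a' /switch cjE [tperm _ _ v]tpermD 1?eq_sym // tpermD //.
  by apply: contra_neq vq => yE; rewrite /q yE aK.
by apply: contra_neq vx => pE; rewrite /x /p pE aK.
Qed.
Let g' := ab a'.
Let special v := b v \in [:: y; p; q; x].
Let g'E v : ~~ special v -> g' v = g v.
Proof. exact: a'E. Qed.

Let iter_y i : i < j -> iter i g' y = iter i g y.
Proof.
elim: i => [//|i IH] ij /=; rewrite IH ?(ltnW ij) // g'E //.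
rewrite /special !inE !negb_or; apply/and4P; split.
- case: (posnP i) => [->|i0]; first by apply: (@nb_y 0); nat_lia.
  by apply/Obneq/(@Oyy i 0); nat_lia.
- by apply/Obneq/(@Oyy i j); nat_lia.
- by apply/Obneq/Oyq; nat_lia.
- by apply/Obneq; rewrite Ox0; apply/Oyy; nat_lia.
Qed.

(** The path from [y] is unchanged up to its last a-edge, which led from [x] to [p] and now leads
    from [x] to [y]. *)
Let g'j : iter j g' y = y.
Proof.
by rewrite -(ltn_predK j1) iterS iter_y ?ltn_predL ?(ltnW j1) // /g' /ab -x_def a'x.
Qed.

(** The clean walks keep the forward paths from the other three ends away from the changed edges for
    [j] steps. *)
Let free s i : s \in [:: x; p; q] -> i < j ->
  iter i g' s = iter i g s /\ ~~ special (iter i g s).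
Proof.
move=> sS; have sp k : k < j -> ~~ special (iter k g s).
  move=> kj; move: sS; rewrite /special !inE !negb_or => /or3P[]/eqP->.
  - case: (posnP k) => [->/=|k0].
      apply/and4P; split.
      + by apply/Obneq; rewrite Ox0; apply/(@Oyy _ 0); nat_lia.
      + by apply/Obneq; rewrite Ox0; apply/(@Oyy _ j); nat_lia.
      + by apply/Obneq; rewrite Ox0; apply/Oyq; nat_lia.
      + by apply: (@nb_x 0); nat_lia.
    apply/and4P; split.
    + by apply/Obneq/(@Oxy _ 0); nat_lia.
    + by apply/Obneq/Oxp; nat_lia.
    + by apply/Obneq/Oxq.
    + by apply/Obneq; rewrite Ox0; apply/Oxy; nat_lia.
  - rewrite -iterD; apply/and4P; split.
    + by apply/Obneq/(@Oyy _ 0); nat_lia.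
    + case: (posnP k) => [->|k0]; last by apply/Obneq/(@Oyy _ j); nat_lia.
      by apply: (@nb_y j); nat_lia.
    + by apply/Obneq/Oyq; nat_lia.
    + by apply/Obneq; rewrite Ox0; apply/Oyy; nat_lia.
  - apply/and4P; split.
    + exact/Obneq/Oqy0.
    + exact/Obneq/Oqp.
    + case: (posnP k) => [->|k0]; last exact/Obneq/Oqq.
      by case/andP: tri_q.
    + exact/Obneq/Oqx.
move=> ij; split; last exact: sp.
elim: i ij => [//|i IH] ij /=; rewrite IH ?(ltnW ij) // g'E // sp //; exact: ltnW.
Qed.

(** A short closed path either lies on the new cycle or avoids every changed edge. *)
Let other i v : 0 < i -> i <= j -> iter i g' v = v ->
  (exists k : 'I_j, v = iter k g' y) \/ (forall k, iter k g' v = iter k g v).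
Proof.
move=> i0 ij iv.
have [[k sk]|ns] := pselect (exists k, special (iter k g' v)); last first.
  right; elim=> [//|k IH] /=; rewrite IH g'E // -IH.
  by apply/negP => h; apply: ns; exists k.
left; set w := iter k g' v in sk.
have iw : iter i g' w = w by rewrite /w -iterD addnC iterD iv.
have inC u : (exists l, u = iter l g' y) -> exists l : 'I_j, u = iter l g' y.
  move=> [l ->]; exists (Ordinal (ltn_pmod l (ltnW j1))) => /=.
  rewrite {1}(divn_eq l j) addnC iterD; congr (iter _ _ _).
  by elim: (l %/ j) => [//|m IH]; rewrite mulSn iterD IH g'j.
have wC : exists l, w = iter l g' y.
  have [/eqP|nbx] := boolP (b w == x).
    rewrite x_def => /perm_inj ->; exists j.-1.
    (* This settles the edge from [x] to [y]. Any other changed edge leads to [x], [p] or [q], and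
       by [free] no changed edge follows within the [i.-1] steps that return to [w], a
       contradiction. *)
    by rewrite iter_y // (ltn_predK j1).
  exfalso.
  have gw : g' w \in [:: x; p; q].
    move: sk; rewrite /special -/w !inE (negPf nbx) orbF /g' /ab.
    by case/or3P=> /eqP->; rewrite ?a'y ?a'p ?a'q eqxx ?orbT.
  have lt : i.-1 < j by rewrite (ltn_predK i0).
  have [E] := free gw lt.
  by rewrite -E -iterSr (ltn_predK i0) iw sk.
apply: inC; case: wC => l wl; exists (l + (k * i - k)).
have -> : v = iter (k * i - k) g' w.
  rewrite /w -iterD subnK ?leq_pmulr //.
  by elim: k {sk w iw wl} => [//|m IH]; rewrite mulSn iterD -IH iv.
by rewrite wl -iterD addnC.
Qed.

Lemma switch_cyc : cyc a' j y.
Proof.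
apply/and3P; split; first by rewrite -/g' g'j.
  apply/forallP => i; apply/implyP => i0; rewrite -/g' iter_y //.
  by apply/Oneq/(@Oyy _ 0); have := ltn_ord i; nat_lia.
apply/forallP => i; rewrite -/g' iter_y //; apply: tri_y; have := ltn_ord i; nat_lia.
Qed.

(** A [j]-cycle avoiding the changed edges would be one of [a], which has none. Hence an image of
    the switch has at most [j] candidates for [y]. *)
Lemma switch_cycE v : a \in acyc j -> cyc a' j v -> exists k : 'I_j, v = iter k (ab a') y.
Proof.
case/acycP=> _ h /and3P[/eqP jv nv tv]; have [//|E] := other (ltnW j1) (leqnn _) jv.
have := h j v j1 (leqnn _); case/negP; apply/and3P; split.
- by rewrite -[ab a]/g -E jv.
- by apply/forallP => i; have := forallP nv i; rewrite -[ab a]/g -E.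
- by apply/forallP => i; have := forallP tv i; rewrite -[ab a]/g -E.
Qed.

(** A shorter cycle cannot lie on the new one, whose [j] vertices are distinct, and cannot come from
    [a]. *)
Lemma switch_acyc : a \in acyc j -> a' \in acyc j.-1.
Proof.
move=> /acycP[_ h]; apply/acycP; split; first exact: cj_invol.
move=> i v i1 ij; apply/negP => /and3P[/eqP iv nv tv].
have ij' : i < j by nat_lia.
have [[k vk]|E] := other (ltnW i1) (ltnW ij') iv.
  have : iter i g' y = y.
    move: iv; rewrite vk -iterD addnC iterD.
    by elim: (k : nat) => [//|m IH] /= /ab_inj.
  rewrite iter_y //; apply/eqP/Oneq/(@Oyy _ 0); nat_lia.
have := h i v i1 (ltnW ij'); case/negP; apply/and3P; split.
- by rewrite -[ab a]/g -E iv.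
- by apply/forallP => l; have := forallP nv l; rewrite -[ab a]/g -E.
- by apply/forallP => l; have := forallP tv l; rewrite -[ab a]/g -E.
Qed.

End Good.

Lemma acyc_sub j : 1 < j -> acyc j \subset acyc j.-1.
Proof.
move=> j1; apply/fintype.subsetP => a /acycP[ai h]; apply/acycP; split=> // i v i1 ij.
by apply: h => //; lia.
Qed.

(** Double counting of the good pairs (a, y). The switched involution together with [y] and [p]
    determines [a]; it lies in [acyc j.-1] but not in [acyc j], with at most [j] choices of [y] and
    #|V| of [p]. *)
Lemma acyc_step j : 1 < j ->
  #|V| * #|acyc j| <= j * #|V| * (#|acyc j.-1| - #|acyc j|) +
     \sum_(a in involutions V) #|[set y | ~~ good a j y]|.
Proof.
move=> j1.
pose D := [set x : {perm V} * V | (x.1 \in acyc j) && good x.1 j x.2].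
have DE : #|D| = \sum_(a in acyc j) #|[set y | good a j y]|.
  rewrite -sum1_card (eq_bigl _ _ (finset.in_set _)) /=.
  rewrite -(pair_big_dep (mem (acyc j)) (fun a y => good a j y) (fun _ _ => 1)) /=.
  by apply: eq_bigr => a _; rewrite sum1_card; apply: eq_card => y; rewrite !inE.
pose T := [set x : {perm V} * V * V |
  [&& x.1.1 \in acyc j.-1 :\: acyc j, cyc x.1.1 j x.1.2 &
      #|[set v | cyc x.1.1 j v]| <= j]].
have cT : #|T| <= j * #|V| * (#|acyc j.-1| - #|acyc j|).
  rewrite -(cardsDS (acyc_sub j1)).
  pose P (a : {perm V}) := (a \in acyc j.-1 :\: acyc j) && (#|[set v | cyc a j v]| <= j).
  have -> : #|T| = \sum_(a | P a) \sum_(v | cyc a j v) \sum_(w : V) 1.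
    rewrite pair_big_dep /= pair_big_dep /= sum1_card; apply: eq_card => -[[a v] w].
    rewrite [in LHS]inE unfold_in /= andbT /P -andbA.
    by case: (_ \in _) => //=; rewrite andbC.
  rewrite mulnC -sum_nat_const [leqRHS]big_mkcond [leqLHS]big_mkcond /=.
  apply: leq_sum => a _; rewrite /P; case: ifP => [/andP[-> h]|]; last by case: ifP.
  rewrite sum1_card sum_nat_const leq_mul2r; apply/orP; right.
  by rewrite -[X in X <= _]cardsE.
have DT : #|D| <= #|T|.
  pose phi (x : {perm V} * V) := ((switch x.1 j x.2, x.2), target x.1 j x.2).
  have inj : injective phi.
    move=> [a y] [a' y'] [E1 yy E2]; subst y'; congr (_, _).
    move: E1; rewrite /switch -E2 => E1.
    by rewrite -[a](cjK _ y (target a j y)) E1 cjK.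
  rewrite -(card_imset _ inj); apply/subset_leq_card/fintype.subsetP => _ /imsetP[[a y] + ->].
  rewrite [in X in X -> _]inE => /andP[/= aj gd].
  have ai : a \in involutions V by case/acycP: aj.
  rewrite inE /= finset.in_setD (switch_acyc ai j1 gd aj) andbT (switch_cyc ai j1 gd) /=.
  apply/andP; split.
    apply/negP => /acycP[_ /(_ j y j1 (leqnn _))].
    by rewrite (switch_cyc ai j1 gd).
  apply: (@leq_trans #|[set iter (k : 'I_j) (ab (switch a j y)) y | k : 'I_j]|).
    apply/subset_leq_card/fintype.subsetP => v; rewrite inE => /(switch_cycE ai j1 gd aj)[k ->].
    by apply/imsetP; exists k.
  by rewrite (leq_trans (leq_imset_card _ _)) // card_ord.
apply: (@leq_trans (#|D| + \sum_(a in involutions V) #|[set y | ~~ good a j y]|)); last first.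
  by rewrite leq_add2r (leq_trans DT).
rewrite DE mulnC -sum_nat_const.
have sub : \sum_(a in acyc j) #|[set y | ~~ good a j y]| <=
           \sum_(a in involutions V) #|[set y | ~~ good a j y]|.
  rewrite [leqLHS]big_mkcond [leqRHS]big_mkcond /=; apply: leq_sum => a _.
  by case: ifP => // /acycP[-> _].
apply: leq_trans (leq_add (leqnn _) sub); rewrite -big_split /=; apply: leq_sum => a _.
rewrite -(cardsC [set y | good a j y]) leq_add2l; apply: eq_leq.
by apply: eq_card => y; rewrite !inE.
Qed.

(** The bound of [unclean_bound] for the four walks of [good], of length at most 2N; 24 N^2 is 6
    (2N)^2. *)
Definition bad_bound N := 4 * ((2 * N).+1 * ntri b * #|involutions V| +
  2 * N * (\sum_(a in involutions V) fixn a) + 24 * N ^ 2 * #|involutions V|).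

Lemma bad_boundP j N : j <= N -> 8 * N + 2 <= #|V| ->
  \sum_(a in involutions V) #|[set y | ~~ good a j y]| <= bad_bound N.
Proof.
move=> jN Nn.
have injt a : injective (fun y => b (target a j y)).
  move=> u v /perm_inj; rewrite /target.
  by elim: j {jN} => [//|k IH] /= /ab_inj /IH.
have inja a : injective (fun y => b^-1%g (a y)).
  by move=> u v /perm_inj /perm_inj.
have un e : \sum_(a in involutions V) #|[set v | ~~ clean b a e (2 * j) v]| <=
  (2 * N).+1 * ntri b * #|involutions V| +
  2 * N * (\sum_(a in involutions V) fixn a) + 24 * N ^ 2 * #|involutions V|.
  apply: leq_trans (unclean_bound b e (_ : 4 * (2 * j) + 2 <= #|V|)) _; first by lia.
  apply: leq_add; first by apply: leq_add; rewrite ?leq_mul //; lia.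
  by rewrite leq_mul // -!mulnn; nia.
apply: (@leq_trans (\sum_(a in involutions V)
   (#|[set v | ~~ clean b a (sgA j) (2 * j) v]| + #|[set v | ~~ clean b a sgB (2 * j) v]| +
   #|[set v | ~~ clean b a (sgC j) (2 * j) v]| + #|[set v | ~~ clean b a sgD (2 * j) v]|))).
  apply: leq_sum => a _.
  have pre (f : V -> V) (P : pred V) : injective f ->
      #|[set y | ~~ P (f y)]| <= #|[set v | ~~ P v]|.
    move=> fi; rewrite -(card_imset _ fi); apply/subset_leq_card/fintype.subsetP => _ /imsetP[y + ->].
    by rewrite !inE.
  have h1 := pre _ (clean b a (sgA j) (2 * j)) (injt a).
  have h2 := pre _ (clean b a sgB (2 * j)) (injt a).
  have h3 := pre _ (clean b a (sgC j) (2 * j)) (inja a).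
  have h4 := pre _ (clean b a sgD (2 * j)) (inja a).
  apply: leq_trans (leq_add (leq_add (leq_add h1 h2) h3) h4).
  rewrite !sum_card_pred -!big_split /=; apply: leq_sum => y _.
  rewrite /good; case: (clean b a (sgA j) _ _) => //=; case: (clean b a sgB _ _) => //=.
  by case: (clean b a (sgC j) _ _) => //=; case: (clean b a sgD _ _).
rewrite !big_split /= /bad_bound.
move: (_ + 24 * _ ^ 2 * _) un => X un.
have -> : 4 * X = X + X + X + X by lia.
by rewrite !leq_add.
Qed.

(** Moving the subtracted term of [acyc_step] to the left gives (j+1) e_j <= j e_(j-1) + eta for the
    proportions, so (j+1) e_j grows by at most eta at each step, starting from 2 e_1 <= 2. *)
Lemma acyc_bound N : 0 < N -> 8 * N + 2 <= #|V| ->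
  N.+1 * #|V| * #|acyc N| <= 2 * #|V| * #|involutions V| + N * bad_bound N.
Proof.
move=> N0 Nn.
suff h j : 0 < j -> j <= N ->
    j.+1 * #|V| * #|acyc j| <= 2 * #|V| * #|involutions V| + j * bad_bound N.
  exact: h.
elim: j => // -[_ _ _|j IH _ jN].
  apply: leq_trans (leq_addr _ _); apply: leq_mul => //.
  by apply/subset_leq_card/fintype.subsetP => a /acycP[].
have := IH isT (ltnW jN).
have := @acyc_step j.+2 isT; have := bad_boundP jN Nn.
have /= h1 := subset_leq_card (@acyc_sub j.+2 isT).
rewrite mulnBr /=; have := leq_mul (leqnn (j.+2 * #|V|)) h1.
rewrite [j.+3 * _]mulSn mulnDl mulSn.
move: (\sum_(a in _) _) (bad_bound N) (_ * #|acyc j.+1|) (j.+2 * #|V| * _) (#|V| * _).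
by move=> s B p q r; lia.
Qed.

End Switch.

(** * Fixed points, loops and isolated edges of a random structure *)

Section Stats.
Variable V : finType.
Implicit Types (a b : {perm V}) (v : V) (D : {set V}) (x : {perm V} * {set V}).

(* In [(b, D)], the orbits of [b] of size 1, 2, 3 stand for [b]-loops, isolated
   [b]-edges and [b]-triangles; [D] is the set of origins of the isolated edges. *)
Definition bstructures : {set {perm V} * {set V}} :=
  [set x : {perm V} * {set V} | [forall v,
     if x.1 (x.1 v) == v then (v \in x.2) + (x.1 v \in x.2) == (x.1 v != v)
     else (x.1 (x.1 (x.1 v)) == v) && (v \notin x.2)]].

Lemma bstructuresP x : reflect (forall v,
     if x.1 (x.1 v) == v then (v \in x.2) + (x.1 v \in x.2) == (x.1 v != v)
     else (x.1 (x.1 (x.1 v)) == v) && (v \notin x.2)) (x \in bstructures).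
Proof. by rewrite inE; apply: forallP. Qed.

Definition loops x := [set v | x.1 v == v].

Lemma mulpred_card (S : {set V}) :
  #|[set p : V * V | [&& p.1 \in S, p.2 \in S & p.1 != p.2]]| = #|S| * #|S|.-1.
Proof.
rewrite -sum1_card (eq_bigl (fun p : V * V => (p.1 \in S) && (p.2 \in S :\ p.1))); last first.
  case=> u v; rewrite !inE /= (eq_sym v).
  by case: (u \in S); case: (v \in S); case: (u != v).
rewrite -(pair_big_dep (mem S) (fun u v => v \in S :\ u) (fun _ _ => 1)) /=.
rewrite -sum_nat_const; apply: eq_bigr => u uS; rewrite sum1_card.
by rewrite (cardsD1 u S) uS.
Qed.

Lemma mulpred2_card (S : {set V}) :
  #|[set p : V * V * V | [&& p.1.1 \in S, p.1.2 \in S, p.2 \in S,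
     p.1.1 != p.1.2, p.1.1 != p.2 & p.1.2 != p.2]]| = #|S| * #|S|.-1 * #|S|.-2.
Proof.
pose P (p : V * V) := [&& p.1 \in S, p.2 \in S & p.1 != p.2].
rewrite -sum1_card (eq_bigl (fun p : V * V * V => P p.1 && (p.2 \in S :\ p.1.1 :\ p.1.2))); last first.
  case=> -[u v] w; rewrite /P !inE /= !(eq_sym w).
  by case: (u \in S); case: (v \in S); case: (w \in S); case: (u != v); case: (u != w); case: (v != w).
rewrite -(pair_big_dep P (fun p v => v \in S :\ p.1 :\ p.2) (fun _ _ => 1)) /=.
rewrite (eq_bigr (fun _ => #|S|.-2)).
  by rewrite sum_nat_const -mulpred_card; congr (_ * _); apply: eq_card => p; rewrite inE.
case=> u v /and3P[/= uS vS uv]; rewrite sum1_card.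
have vS' : v \in S :\ u by rewrite !inE eq_sym uv.
by rewrite (cardsD1 u S) uS (cardsD1 v (S :\ u)) vS'.
Qed.

Lemma card_dep (T U : finType) (A : {set T}) (P : T -> pred U) :
  \sum_(z in A) #|[set u | P z u]| = #|[set p : T * U | (p.1 \in A) && P p.1 p.2]|.
Proof.
rewrite -[RHS]sum1_card (eq_bigl _ _ (finset.in_set _)) /=.
rewrite -(pair_big_dep (mem A) P (fun _ _ => 1)) /=.
by apply: eq_bigr => z _; rewrite sum1_card; apply: eq_card => u; rewrite !inE.
Qed.

Lemma leq_card_inj (T U : finType) (A : {set T}) (B : {set U}) (f : T -> U) :
  {in A &, injective f} -> (forall z, z \in A -> f z \in B) -> #|A| <= #|B|.
Proof.
move=> fi fB; rewrite -(card_in_imset fi); apply/subset_leq_card/fintype.subsetP => _ /imsetP[z zA ->].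
exact: fB.
Qed.

(* Two fixed points are merged into an [a]-edge. *)
Lemma sum_fix2 :
  \sum_(a in involutions V) fixn a * (fixn a).-1 <= #|V| * #|involutions V|.
Proof.
under eq_bigr => a _ do rewrite -mulpred_card.
rewrite (card_dep (involutions V) (fun a p => [&& p.1 \in [set v | a v == v],
   p.2 \in [set v | a v == v] & p.1 != p.2])).
rewrite mulnC -cardsT -finset.cardsX.
(* Keeping one end of the new edge suffices: the other is its image. *)
apply: (@leq_card_inj _ _ _ _ (fun p => (p.1 * tperm p.2.1 p.2.2, p.2.1))%g).
  move=> [a [u w]] [a' [u' w']]; rewrite !inE /=.
  move=> /andP[_ /and3P[/eqP au _ _]] /andP[_ /and3P[/eqP au' _ _]] [E uu'].
  subst u'; have ww : w = w'.
    by have := congr1 (fun s : {perm V} => s u) E; rewrite !permM au au' !tpermL.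
  by subst w'; move/mulIg: E => ->.
move=> [a [u w]]; rewrite !inE /= andbT => /andP[/forallP ai /and3P[/eqP au /eqP aw uw]].
apply/forallP => v; rewrite !permM; apply/eqP.
have aK v' : a (a v') = v' by apply/eqP/ai.
case: (tpermP u w (a v)) => [av|av|avu avw].
- by rewrite aw tpermR; apply: (@perm_inj _ a); rewrite au.
- by rewrite au tpermL; apply: (@perm_inj _ a); rewrite aw.
- rewrite aK tpermD //; apply/eqP => E.
    by case: avu; rewrite -E au.
  by case: avw; rewrite -E aw.
Qed.

(** Either [fixn a] is at most s + 1 or it is at most [fixn a * (fixn a).-1 / s], whose mean is
    controlled by [sum_fix2]. The best [s] is of order n^(1/2). *)
Lemma sum_fix (s : nat) : s * (\sum_(a in involutions V) fixn a) <=
  (s * s.+1 + #|V|) * #|involutions V|.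
Proof.
rewrite mulnDl; apply: leq_trans (leq_add (leqnn _) sum_fix2).
rewrite big_distrr /= [X in _ <= X + _]mulnC -sum_nat_const -big_split /=.
apply: leq_sum => a _; case: (leqP (fixn a) s.+1) => h.
  by apply: leq_trans (leq_addr _ _); rewrite leq_mul2l h orbT.
apply: leq_trans (leq_addl _ _); rewrite mulnC leq_mul2l; apply/orP; right; lia.
Qed.

(* An isolated edge is cut into two loops. *)
Lemma sum_edges : \sum_(x in bstructures) #|x.2| <=
  \sum_(x in bstructures) #|loops x| * #|loops x|.-1.
Proof.
under [leqRHS]eq_bigr => x _ do rewrite -mulpred_card.
rewrite (card_dep bstructures (fun x p => [&& p.1 \in loops x, p.2 \in loops x & p.1 != p.2])).
under eq_bigr => x _ do rewrite -cardsE.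
rewrite (card_dep bstructures (fun x u => u \in x.2)).
apply: (@leq_card_inj _ _ _ _
   (fun p : ({perm V} * {set V}) * V => (((p.1.1 * tperm p.2 (p.1.1 p.2))%g, p.1.2 :\ p.2), (p.2, p.1.1 p.2)))).
  move=> [[b D] u] [[b' D'] u']; rewrite !inE /=.
  move=> /andP[_ uD] /andP[_ uD'] [E ED uu' bu]; subst u'.
  rewrite -bu in E; move/mulIg: E => ->; congr ((_, _), _).
  by rewrite -(finset.setD1K uD) ED finset.setD1K.
move=> [[b D] u]; rewrite [in X in X -> _]inE /= => /andP[/bstructuresP xP uD].
have /= := xP u; rewrite uD; case: eqP => [bbu|]; last by rewrite andbF.
rewrite add1n => h; have [buD buu] : b u \notin D /\ b u != u.
  by move: h; case: (b u \in D) => //; case: (b u != u).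
rewrite inE /=; apply/and4P; split; last by rewrite eq_sym.
- apply/bstructuresP => v /=; rewrite !permM.
  have [->|vu] := eqVneq v u.
    by rewrite tpermR tpermR !inE eqxx.
  have [->|vbu] := eqVneq v (b u).
    by rewrite bbu tpermL bbu tpermL !inE eqxx (negPf buD) andbF.
  have n1 : b v != u by apply: contra_neq vbu => E; apply: (@perm_inj _ b); rewrite bbu.
  have n2 : b v != b u by apply: contra_neq vu => /perm_inj.
  rewrite [tperm u (b u) (b v)]tpermD 1?eq_sym //.
  have n3 : b (b v) != u.
    by apply: contra_neq n2 => E; apply: (@perm_inj _ b); rewrite bbu.
  have n4 : b (b v) != b u by apply: contra_neq n1 => /perm_inj.
  rewrite [tperm u (b u) (b (b v))]tpermD 1?eq_sym // !inE vu n1 /=.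
  have := xP v; rewrite /=; case: ifP => // _ /andP[/eqP b3 ->]; rewrite b3 andbT.
  by rewrite tpermD // eq_sym.
- by rewrite inE permM tpermR.
- by rewrite inE permM bbu tpermL.
Qed.

(* Three loops are merged into a triangle. *)
Lemma sum_loops3 : \sum_(x in bstructures) #|loops x| * #|loops x|.-1 * #|loops x|.-2 <=
  #|V| * #|bstructures|.
Proof.
under eq_bigr => x _ do rewrite -mulpred2_card.
rewrite (card_dep bstructures (fun x p => [&& p.1.1 \in loops x, p.1.2 \in loops x, p.2 \in loops x,
     p.1.1 != p.1.2, p.1.1 != p.2 & p.1.2 != p.2])).
rewrite mulnC -cardsT -finset.cardsX.
pose c (u v w : V) := (tperm u v * tperm u w)%g.
have cU u v w : u != v -> v != w -> c u v w u = v.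
  by move=> uv vw; rewrite permM tpermL tpermD // eq_sym.
have cV u v w : c u v w v = w by rewrite permM tpermR tpermL.
apply: (@leq_card_inj _ _ _ _ (fun p => ((p.1.1 * c p.2.1.1 p.2.1.2 p.2.2)%g, p.1.2, p.2.1.1))).
  move=> [[b D] [[u v] w]] [[b' D'] [[u' v'] w']]; rewrite !inE /=.
  move=> /andP[_ /and4P[/eqP bu /eqP bv /eqP bw /and3P[uv uw vw]]].
  move=> /andP[_ /and4P[/eqP bu' /eqP bv' /eqP bw' /and3P[uv' uw' vw']]] [E -> uu].
  subst u'.
  have vE : v = v'.
    have := congr1 (fun s : {perm V} => s u) E.
    by rewrite permM bu cU // permM bu' cU.
  subst v'; have wE : w = w'.
    have := congr1 (fun s : {perm V} => s v) E.
    by rewrite permM bv cV permM bv' cV.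
  by subst w'; move/mulIg: E => ->.
move=> [[b D] [[u v] w]]; rewrite [in X in X -> _]inE /=.
move=> /andP[/bstructuresP xP]; rewrite !inE /= => /and4P[/eqP bu /eqP bv /eqP bw /and3P[uv uw vw]].
rewrite andbT; apply/forallP => y /=.
have cu : c u v w u = v by exact: cU.
have cv : c u v w v = w by exact: cV.
have cw : c u v w w = u by rewrite permM (tpermD uw vw) tpermR.
have cE z : z != u -> z != v -> z != w -> c u v w z = z.
  by move=> zu zv zw; rewrite permM tpermD 1?eq_sym // tpermD // eq_sym.
have uD : u \notin D by have := xP u; rewrite /= !bu eqxx; case: (u \in D).
have vD : v \notin D by have := xP v; rewrite /= !bv eqxx; case: (v \in D).
have wD : w \notin D by have := xP w; rewrite /= !bw eqxx; case: (w \in D).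
have cM z : (b * c u v w)%g z = c u v w (b z) by rewrite permM.
rewrite !cM.
have [->|yu] := eqVneq y u.
  by rewrite bu cu bv cv bw cw (eq_sym w) (negPf uw) eqxx uD.
have [->|yv] := eqVneq y v.
  by rewrite bv cv bw cw bu cu (negPf uv) eqxx vD.
have [->|yw] := eqVneq y w.
  by rewrite bw cw bu cu bv cv (negPf vw) eqxx wD.
have bn z : z != u -> z != v -> z != w -> [/\ b z != u, b z != v & b z != w].
  move=> zu zv zw; split; [move: zu|move: zv|move: zw]; apply: contra_neq => E;
  by apply: (@perm_inj _ b); rewrite E ?bu ?bv ?bw.
have [n1 n2 n3] := bn _ yu yv yw; have [n4 n5 n6] := bn _ n1 n2 n3.
have [n7 n8 n9] := bn _ n4 n5 n6.
by rewrite !cE //; apply: xP.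
Qed.

(** The same truncation against the third factorial moment; the best [s] is of order n^(1/3). *)
Lemma sum_loops (s : nat) : s ^ 2 * (\sum_(x in bstructures) #|loops x|) <=
  (s ^ 2 * s.+2 + #|V|) * #|bstructures|.
Proof.
rewrite mulnDl; apply: leq_trans (leq_add (leqnn _) sum_loops3).
rewrite big_distrr /= [X in _ <= X + _]mulnC -sum_nat_const -big_split /=.
apply: leq_sum => x _; case: (leqP #|loops x| s.+2) => h.
  by apply: leq_trans (leq_addr _ _); rewrite leq_mul2l h orbT.
apply: leq_trans (leq_addl _ _); rewrite -mulnA mulnC leq_mul2l; apply/orP; right.
by rewrite -mulnn leq_mul //; lia.
Qed.

(** Isolated edges are controlled by pairs of loops, and these, beyond s + 2 loops, by triples of
    loops. For [s] of order n^(1/3) the mean is O(n^(2/3)). *)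
Lemma sum_edges_bound (s : nat) : s * (\sum_(x in bstructures) #|x.2|) <=
  (s * (s.+2 * s.+1) + #|V|) * #|bstructures|.
Proof.
rewrite mulnDl; apply: leq_trans (leq_add (leqnn _) sum_loops3).
apply: (leq_trans (leq_mul (leqnn s) sum_edges)).
rewrite big_distrr /= [X in _ <= X + _]mulnC -sum_nat_const -big_split /=.
apply: leq_sum => x _; case: (leqP #|loops x| s.+2) => h.
  by apply: leq_trans (leq_addr _ _); rewrite leq_mul2l leq_mul ?orbT //; lia.
apply: leq_trans (leq_addl _ _); rewrite mulnC leq_mul2l; apply/orP; right; lia.
Qed.

(** A vertex off the triangles is a loop or one of the two ends of an isolated edge. *)
Lemma ntri_bound x : x \in bstructures -> ntri x.1 <= #|loops x| + 2 * #|x.2|.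
Proof.
move=> /bstructuresP xP.
have sub : [set v | ~~ tri x.1 v] \subset loops x :|: (x.2 :|: (x.1 @^-1: x.2)).
  apply/fintype.subsetP => v; rewrite !inE /tri => h; have := xP v.
  case: ifP => b2; last first.
    move=> /andP[b3 _]; move: h; rewrite b3 /= negbK => /eqP b1.
    by rewrite b1 eqxx.
  case: (x.1 v == v) => //=; case: (v \in _) => //=; by case: (_ \in _).
apply: (leq_trans (subset_leq_card sub)); apply: (leq_trans (leq_card_setU _ _)).
rewrite leq_add2l; apply: (leq_trans (leq_card_setU _ _)).
rewrite mul2n -addnn leq_add2l.
by apply: (@leq_card_inj _ _ _ _ x.1) => [u v _ _ /perm_inj //|v]; rewrite inE.
Qed.

Lemma cj_tpermE a u v w : cj a (tperm u v) (tperm u v w) = tperm u v (a w).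
Proof. by rewrite cjE tpermK. Qed.

(** By symmetry: conjugation by the transposition of [v] and [u] carries the involutions fixing [v]
    to those fixing [u]. *)
Lemma card_fix_at v : #|V| * #|[set a in involutions V | a v == v]| <=
  \sum_(a in involutions V) fixn a.
Proof.
rewrite /fixn (card_dep (involutions V) (fun a u => a u == u)) -cardsT -finset.cardsX.
apply: (@leq_card_inj _ _ _ _ (fun p => (cj p.2 (tperm v p.1), p.1))).
  move=> [u a] [u' a'] _ _ /= [E uu]; subst u'; congr (_, _).
  by rewrite -(cjK a v u) E cjK.
move=> [u a]; rewrite finset.in_setX finset.in_setT [in X in X -> _]finset.in_set /= => /andP[ai /eqP av].
rewrite finset.in_set cj_invol //=; apply/eqP.
by rewrite cjE tpermR av tpermL.
Qed.

Lemma card_loop_at v : #|V| * #|[set x in bstructures | x.1 v == v]| <=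
  \sum_(x in bstructures) #|loops x|.
Proof.
rewrite /loops (card_dep bstructures (fun x u => x.1 u == u)) -cardsT -finset.cardsX.
pose f (p : V * ({perm V} * {set V})) := (cj p.2.1 (tperm v p.1), tperm v p.1 @: p.2.2, p.1).
apply: (@leq_card_inj _ _ _ _ f).
  move=> [u [b D]] [u' [b' D']] _ _ /= [E ED uu]; subst u'; congr (_, (_, _)).
    by rewrite -(cjK b v u) E cjK.
  exact: (imset_inj (@perm_inj _ (tperm v u)) ED).
move=> [u [b D]]; rewrite finset.in_setX finset.in_setT [in X in X -> _]finset.in_set /= => /andP[/bstructuresP xP /eqP bv].
rewrite finset.in_set /=; apply/andP; split; last by apply/eqP; rewrite cjE tpermR bv tpermL.
apply/bstructuresP => w0 /=; rewrite -(tpermK v u w0); set w := tperm v u w0.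
rewrite !cj_tpermE !(mem_imset _ _ (@perm_inj _ _)) !(inj_eq perm_inj).
exact: xP.
Qed.

End Stats.

(** * Connectivity *)

Section Stable.
Variable V : finType.
Implicit Types (a b s : {perm V}) (v : V) (U : {set V}) (x : {perm V} * {set V}).

Definition stable s U := [forall v, (s v \in U) == (v \in U)].

Lemma stableP s U : reflect (forall v, (s v \in U) = (v \in U)) (stable s U).
Proof. by apply: (iffP forallP) => h v; apply/eqP/h. Qed.

Lemma stableC s U : stable s U -> stable s (~: U).
Proof. by move/stableP => h; apply/stableP => v; rewrite !inE h. Qed.

Definition conn_from v a b :=
  [forall U : {set V}, [&& v \in U, stable a U & stable b U] ==> (U == [set: V])].

Definition stables s k := [set U | stable s U & #|U| == k].

(** These permutations are empty or a coset of the stabilizer of [U1], which embeds into the product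
    of the symmetric groups of [U1] and its complement. *)
Lemma card_perm_image (U1 U2 : {set V}) :
  #|[set s : {perm V} | s @: U1 == U2]| <= (#|U1|)`! * (#|V| - #|U1|)`!.
Proof.
have stab : #|[set s : {perm V} | s @: U1 == U1]| <= (#|U1|)`! * (#|V| - #|U1|)`!.
  have <- : #|~: U1| = #|V| - #|U1| by rewrite finset.cardsCs finset.setCK.
  rewrite -!card_perm -!(cardsE (perm_on _)) -finset.cardsX.
  apply: (@leq_card_inj _ _ _ _ (fun s => (restr_perm U1 s, restr_perm (~: U1) s))).
    move=> s t; rewrite !inE => /eqP sU /eqP tU [E1 E2].
    have ns (s' : {perm V}) : s' @: U1 = U1 -> s' \in ('N(U1 | 'P))%g /\ s' \in ('N(~: U1 | 'P))%g.
      move=> h; have h1 : s' \in ('N(U1 | 'P))%g.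
        by apply/astabsP => v; rewrite /= /aperm -{1}h (mem_imset _ _ perm_inj).
      by split=> //; apply/astabsP => v; rewrite !inE (astabsP h1).
    have [s1 s2] := ns _ sU; have [t1 t2] := ns _ tU.
    apply/permP => v; have [vU|vU] := boolP (v \in U1).
      by rewrite -(restr_permE s1 vU) -(restr_permE t1 vU) E1.
    have vU' : v \in ~: U1 by rewrite inE.
    by rewrite -(restr_permE s2 vU') -(restr_permE t2 vU') E2.
  move=> s _; rewrite finset.in_setX; apply/andP; split; rewrite inE; exact: restr_perm_on.
have [->|[s0]] := set_0Vmem [set s : {perm V} | s @: U1 == U2]; first by rewrite cards0.
rewrite inE => /eqP s0U; apply: leq_trans stab.
apply: (@leq_card_inj _ _ _ _ (fun s => (s * s0^-1)%g)) => [s t _ _ /mulIg //|s].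
rewrite !inE => /eqP sU; apply/eqP.
have -> : (s * s0^-1)%g @: U1 = s0^-1%g @: (s @: U1).
  by rewrite -imset_comp; apply: eq_imset => v; rewrite /= permM.
rewrite sU -s0U -imset_comp -[RHS]imset_id; apply: eq_imset => v; exact: permK.
Qed.

(** First moment bound: a disconnected pair has a common stable set of size between 1 and n/2, after
    passing to the complement if necessary. *)
Lemma sum_nonconnected v a b :
  #|[set s : {perm V} | ~~ conn_from v (a ^ s)%g b]| <=
  \sum_(1 <= k < (#|V|./2).+1) #|stables a k| * #|stables b k| * (k`! * (#|V| - k)`!).
Proof.
pose P (s : {perm V}) k U := [&& stable (a ^ s)%g U, stable b U & #|U| == k].
apply: (@leq_trans (\sum_(s : {perm V}) \sum_(1 <= k < (#|V|./2).+1) #|[set U | P s k U]|)).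
  rewrite sum_card_pred; apply: leq_sum => s _.
  have [//|/forallPn[U]] := boolP (conn_from _ _ _); rewrite negb_imply.
  move=> /andP[/and3P[vU Ua Ub] UT].
  suff [W [k [k0 kn PW]]] : exists W k, [/\ 0 < k, k < (#|V|./2).+1 & P s k W].
    rewrite (bigD1_seq k) ?iota_uniq ?mem_index_iota ?k0 //=.
    rewrite (leq_trans _ (leq_addr _ _)) // card_gt0; apply/finset.set0Pn; exists W.
    by rewrite inE.
  have cU : #|U| + #|~: U| = #|V| := cardsC U.
  have U0 : 0 < #|U| by rewrite card_gt0; apply/finset.set0Pn; exists v.
  have U1 : 0 < #|~: U|.
    by rewrite card_gt0; apply: contra UT => /eqP h; rewrite -[U]finset.setCK h finset.setC0.
  case: (leqP #|U| #|V|./2) => h.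
    by exists U, #|U|; rewrite /P Ua Ub eqxx; split.
  exists (~: U), #|~: U|; rewrite /P !stableC // eqxx; split=> //; lia.
rewrite exchange_big /=; apply: leq_sum => k _.
rewrite (eq_bigl (fun s => s \in [set: {perm V}])); last by move=> s; rewrite inE.
rewrite (card_dep finset.setT (fun s U => P s k U)).
(* [U] is stable under the conjugate of [a] by [s] exactly when the preimage of [U] by [s] is stable
   under [a]; so the count runs over pairs of a set stable under [a] and one stable under [b]. *)
pose f (p : {perm V} * {set V}) := (p.1^-1%g @: p.2, p.2).
pose T := finset.setX (stables a k) (stables b k).
rewrite -sum1_card (partition_big f (fun q => q \in T)); last first.
  move=> [s U]; rewrite !inE /P /= => /and3P[Ua Ub Uk].
  rewrite Ub Uk card_imset ?Uk ?andbT //; last exact: perm_inj.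
  apply/stableP => v0; have /stableP/(_ (s v0)) := Ua.
  have E w : (w \in s^-1%g @: U) = (s w \in U).
    by rewrite -{1}(permK s w) (mem_imset _ _ (@perm_inj _ _)).
  by rewrite conjgE !permM permK !E.
apply: (@leq_trans (\sum_(q in T) k`! * (#|V| - k)`!)); last first.
  by rewrite sum_nat_const finset.cardsX.
apply: leq_sum => -[U1 U2] /=; rewrite finset.in_setX => /andP[]; rewrite !inE => /andP[_ /eqP U1k] _.
have := card_perm_image U1 U2; rewrite U1k; apply: leq_trans.
rewrite sum1_card; apply: (@leq_trans #|[set p : {perm V} * {set V} | (p.1 @: U1 == U2) && (p.2 == U2)]|).
  apply/subset_leq_card/fintype.subsetP => -[s U]; rewrite unfold_in inE /= => /andP[_ /eqP[<- ->]].
  rewrite eqxx andbT -imset_comp; apply/eqP; rewrite -[RHS]imset_id; apply: eq_imset => w.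
  by rewrite /= permKV.
apply: (@leq_card_inj _ _ _ _ fst) => [[s U] [t W]|[s U]]; rewrite !inE /=.
  by move=> /andP[_ /eqP ->] /andP[_ /eqP ->] ->.
by case/andP.
Qed.

Lemma card_setI_sum (U S : {set V}) : #|U :&: S| = \sum_(v in U) (v \in S).
Proof.
rewrite -sum1_card big_mkcond [RHS]big_mkcond; apply: eq_bigr => v _; rewrite inE.
by case: (v \in U); case: (v \in S).
Qed.

Lemma sum_stable s U (F : V -> nat) : stable s U ->
  \sum_(v in U) F (s v) = \sum_(v in U) F v.
Proof.
move=> /stableP h; rewrite [RHS](reindex_inj (@perm_inj _ s)) /=.
by apply: eq_bigl => v; rewrite h.
Qed.

(** One vertex in each 2-cycle, the first in the enumeration of [V]. With the loops, such
    representatives determine a stable set by its traces on them. *)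
Definition edge_reps a := [set v | enum_rank v < enum_rank (a v)].
Definition triangle_reps b := [set v | [&& tri b v, enum_rank v < enum_rank (b v) &
  enum_rank v < enum_rank (b (b v))]].

Lemma involution_reps a v : a \in involutions V ->
  (v \in [set v | a v == v]) + (v \in edge_reps a) + (a v \in edge_reps a) = 1.
Proof.
move=> /involutionsP aK; rewrite !inE aK.
have [->|nav] := eqVneq (a v) v; first by rewrite ltnn.
by case: ltngtP => // /ord_inj/enum_rank_inj E; case/eqP: nav.
Qed.

Lemma bstructure_reps x v : x \in bstructures V -> let: (b, D) := x in
  (v \in loops x) + (v \in D) + (b v \in D) + (v \in triangle_reps b) +
  (b v \in triangle_reps b) + (b (b v) \in triangle_reps b) = 1.
Proof.
case: x => b D /bstructuresP/= xP; rewrite !inE !tri_b /=; have := xP v.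
case: eqP => [b2|/eqP b2].
  have -> : tri b v = false.
    by rewrite /tri b2; case: eqP => //= ->; rewrite eqxx.
  by case: (b v == v); case: (v \in D); case: (b v \in D).
move=> /andP[b3 /negPf vD]; rewrite /tri b3 vD.
have b1 : b v != v by apply: contra b2 => /eqP E; rewrite !E.
have /= := xP (b v); rewrite (eqP b3) (eq_sym v) (negPf b1) => /andP[_ /negPf ->].
rewrite /=.
have n1 : (enum_rank v : nat) != enum_rank (b v).
  by apply: contra b1 => /eqP/ord_inj/enum_rank_inj <-.
have n2 : (enum_rank v : nat) != enum_rank (b (b v)).
  by apply: contra b2 => /eqP/ord_inj/enum_rank_inj <-.
have n3 : (enum_rank (b v) : nat) != enum_rank (b (b v)).
  by apply: contra b1 => /eqP/ord_inj/enum_rank_inj/perm_inj <-.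
move: n1 n2 n3; move: (enum_rank v : nat) (enum_rank (b v) : nat) (enum_rank (b (b v)) : nat).
move=> p q r; rewrite !neq_ltn.
by case: (ltngtP p q); case: (ltngtP p r); case: (ltngtP q r) => //=; lia.
Qed.

End Stable.

(** * Estimates for binomial coefficients *)

Lemma bin_mul_le a b c d : 'C(a, b) * 'C(c, d) <= 'C(a + c, b + d).
Proof.
rewrite -binomial.Vandermonde.
have bd : b < (b + d).+1 by rewrite ltnS leq_addr.
by rewrite (bigD1 (Ordinal bd)) //= addKn leq_addr.
Qed.

Lemma bin_exp_le d t l : 'C(t, l) ^ d <= 'C(d * t, d * l).
Proof.
elim: d => [|d IH]; first by rewrite !mul0n bin0.
by rewrite expnS !mulSn; apply: leq_trans (bin_mul_le _ _ _ _); rewrite leq_mul2l IH orbT.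
Qed.

(** Below k <= n/2, consecutive binomial coefficients have ratio at least n / (2k). *)
Lemma bin_shift n k e : k.*2 <= n -> e <= k -> 'C(n, k - e) * n ^ e <= 'C(n, k) * k.*2 ^ e.
Proof.
move=> kn; elim: e => [|e IH] ek; first by rewrite subn0 !expn0.
have := IH (ltnW ek); have -> : k - e = (k - e.+1).+1 by lia.
set k' := k - e.+1 => h.
have h2 : 'C(n, k') * n <= 'C(n, k'.+1) * k.*2.
  apply: (@leq_trans ('C(n, k') * ((n - k') * 2))).
    by rewrite leq_mul2l; apply/orP; right; lia.
  have := mul_bin_left n k'; have : k' < k by lia.
  move: ('C(n, k')) ('C(n, k'.+1)) => x y k'k E.
  have -> : x * ((n - k') * 2) = (k'.+1 * y) * 2 by rewrite E; lia.
  by rewrite -mul2n; nia.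
rewrite !expnS mulnA; apply: (@leq_trans ('C(n, k'.+1) * k.*2 * n ^ e)).
  by rewrite leq_mul2r h2 orbT.
by rewrite mulnAC [leqRHS]mulnCA mulnC leq_mul2l h orbT.
Qed.

(** Each factor (n - i) / (k - i) of the binomial coefficient is at least n / k. *)
Lemma bin_lower n k : 0 < k -> k <= n -> n ^ k <= 'C(n, k) * k ^ k.
Proof.
elim: k n => [//|[|k] IH] n _ kn; first by rewrite bin1 expn1 muln1.
have := mul_bin_diag n k.+1; case: n kn => // n kn /= E.
have := IH n isT kn; set x := 'C(n, k.+1) in E * => h.
rewrite [k.+2 ^ _]expnS mulnA [_ * k.+2]mulnC -E [n.+1 ^ _]expnS -!mulnA leq_mul2l /=.
rewrite -(leq_pmul2r (_ : 0 < k.+1 ^ k.+1)) ?expn_gt0 //.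
apply: (@leq_trans (n ^ k.+1 * k.+2 ^ k.+1)).
  by rewrite -!expnMn leq_exp2r //; lia.
by rewrite mulnAC leq_mul2r h orbT.
Qed.

(** * Stable sets of a given size *)

Section ConnectivityBounds.
Local Open Scope ring_scope.

Section StableSets.
Variables (R : realFieldType) (V : finType).
Implicit Types (L D S : {set V}).

Lemma sum_powerset L (z : R) :
  \sum_(A in powerset L) z ^+ #|A| = (1 + z) ^+ #|L|.
Proof.
rewrite exprDn (partition_big (fun A : {set V} => inord #|A| : 'I_#|L|.+1) xpredT) //=.
apply: eq_bigr => i _; rewrite expr1n mul1r.
rewrite (eq_bigr (fun _ => z ^+ i)).
  rewrite sumr_const -(cards_draws L i); congr (_ *+ _).
  apply: eq_card => A; rewrite !inE unfold_in /= powersetE.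
  case: (boolP (A \subset L)) => //= AL.
  by rewrite -val_eqE /= inordK // ltnS subset_leq_card.
move=> A /andP[]; rewrite powersetE => AL /eqP <-.
by rewrite inordK // ltnS subset_leq_card.
Qed.

(** A stable set splits into loops A, isolated edges B and orbits C of size [d]. For given A and B
    with e = |A| + 2|B|, the choices of C number at most the [d]-th root of 'C(n, k - e), hence at
    most c z^e by [bin_shift]; the sum over A and B is a product of binomial expansions. *)
Lemma count_triples (N : {set {set V}}) L D S d k (c z : R) :
  (0 < d)%N -> (0 < #|V|)%N -> (k.*2 <= #|V|)%N -> (d * #|S| <= #|V|)%N ->
  {in N &, injective (fun U => (U :&: L, U :&: D, U :&: S))} ->
  (forall U, U \in N -> #|U :&: L| + 2 * #|U :&: D| + d * #|U :&: S| = k)%N ->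
  0 <= c -> 0 <= z -> c ^+ d = 'C(#|V|, k)%:R -> z ^+ d = k.*2%:R / #|V|%:R ->
  #|N|%:R <= c * (1 + z) ^+ #|L| * (1 + z ^+ 2) ^+ #|D|.
Proof.
move=> d0 V0 kn dS Ninj Nk c0 z0 cd zd.
pose P (A B : {set V}) := [set C : {set V} | (C \subset S) && (#|A| + 2 * #|B| + d * #|C| == k)%N].
have PE (A B : {set V}) : #|P A B|%:R <= c * z ^+ (#|A| + 2 * #|B|).
  have [->|[C0]] := set_0Vmem (P A B).
    by rewrite cards0 mulr_ge0 // exprn_ge0.
  rewrite inE => /andP[CS /eqP kE].
  set e := (#|A| + 2 * #|B|)%N in kE *.
  have PC : (#|P A B| <= 'C(#|S|, #|C0|))%N.
    rewrite -cards_draws; apply/subset_leq_card/fintype.subsetP => C; rewrite !inE.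
    move=> /andP[-> /eqP kE']; rewrite -(eqn_pmul2l d0) /=; apply/eqP.
    by move: kE'; rewrite -/e -kE; apply: addnI.
  have h : (#|P A B| ^ d * #|V| ^ e <= 'C(#|V|, k) * k.*2 ^ e)%N.
    apply: leq_trans (bin_shift kn (_ : e <= k)%N); last by rewrite -kE leq_addr.
    rewrite leq_mul2r; apply/orP; right.
    apply: (@leq_trans ('C(#|S|, #|C0|) ^ d)); first by rewrite leq_exp2r.
    apply: (leq_trans (bin_exp_le _ _ _)).
    by rewrite -kE addKn; apply: leq_bin2l.
  rewrite -(@ler_pXn2r _ d) // ?nnegrE ?mulr_ge0 ?exprn_ge0 //.
  rewrite exprMn -exprM mulnC exprM cd zd expr_div_n mulrA ler_pdivlMr ?exprn_gt0 ?ltr0n //.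
  by rewrite -!natrX -!natrM ler_nat.
apply: (@le_trans _ _ (\sum_(A in powerset L) \sum_(B in powerset D) #|P A B|%:R)).
  have -> : \sum_(A in powerset L) \sum_(B in powerset D) #|P A B|%:R =
    (\sum_(A in powerset L) \sum_(B in powerset D) #|P A B|)%N%:R :> R.
    by rewrite natr_sum; apply: eq_bigr => A _; rewrite natr_sum.
  rewrite ler_nat pair_big_dep /=.
  have -> : (\sum_(p : {set V} * {set V} | (p.1 \in powerset L) && (p.2 \in powerset D)) #|P p.1 p.2| =
    \sum_(p in finset.setX (powerset L) (powerset D)) #|[set C | C \in P p.1 p.2]|)%N.
    apply: eq_big => [[A B]|[A B] _]; first by rewrite finset.in_setX.
    by apply: eq_card => C; rewrite inE.
  rewrite (card_dep (finset.setX (powerset L) (powerset D)) (fun p C => C \in P p.1 p.2)).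
  apply: (leq_card_inj Ninj) => U UN; rewrite inE /= finset.in_setX !powersetE !subsetIr /=.
  by rewrite inE subsetIr Nk //=.
apply: (@le_trans _ _ (\sum_(A in powerset L) \sum_(B in powerset D) c * z ^+ (#|A| + 2 * #|B|))).
  by apply: ler_sum => A _; apply: ler_sum => B _.
rewrite -!sum_powerset -mulrA big_distrl big_distrr /=; apply: ler_sum => A _.
rewrite big_distrr big_distrr /=; apply: ler_sum => B _.
by rewrite exprD exprM.
Qed.

Lemma stables_involution (a : {perm V}) k (c z : R) : a \in involutions V ->
  (0 < #|V|)%N -> (k.*2 <= #|V|)%N ->
  0 <= c -> 0 <= z -> c ^+ 2 = 'C(#|V|, k)%:R -> z ^+ 2 = k.*2%:R / #|V|%:R ->
  #|stables a k|%:R <= c * (1 + z) ^+ fixn a.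
Proof.
move=> ai V0 kn c0 z0 cd zd.
set L := [set v | a v == v]; set S := edge_reps a.
have id U : stable a U -> (#|U :&: L| + 2 * #|U :&: S| = #|U|)%N.
  move=> Us; rewrite mul2n -addnn addnA !card_setI_sum.
  rewrite -{2}(sum_stable (fun v => v \in S : nat) Us) -!big_split /= -sum1_card.
  by apply: eq_bigr => v _; rewrite involution_reps.
have memU U v : stable a U -> (v \in U) =
    [|| v \in U :&: L, v \in U :&: S | a v \in U :&: S].
  move=> /stableP Us; rewrite !inE Us.
  have := involution_reps v ai; rewrite !inE.
  by case: (v \in U) => //=; case: (a v == v) => //=; case: (_ < _)%N => //=; case: (_ < _)%N.
have := @count_triples (stables a k) L finset.set0 S 2 k c z isT V0 kn.
rewrite cards0 expr0 mulr1; apply=> //.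
- have := id [set: V]; rewrite !finset.setTI cardsT => <-; first exact: leq_addl.
  by apply/stableP => v; rewrite !inE.
- move=> U W; rewrite !inE => /andP[Us _] /andP[Ws _] [EL _ ES].
  by apply/setP => v; rewrite (memU U) // (memU W) // EL ES.
- by move=> U; rewrite inE => /andP[Us /eqP <-]; rewrite finset.setI0 cards0 muln0 addn0 id.
Qed.

Lemma stables_bstructure (x : {perm V} * {set V}) k (c z : R) : x \in bstructures V ->
  (0 < #|V|)%N -> (k.*2 <= #|V|)%N ->
  0 <= c -> 0 <= z -> c ^+ 3 = 'C(#|V|, k)%:R -> z ^+ 3 = k.*2%:R / #|V|%:R ->
  #|stables x.1 k|%:R <= c * (1 + z) ^+ #|loops x| * (1 + z ^+ 2) ^+ #|x.2|.
Proof.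
case: x => b D xB V0 kn c0 z0 cd zd /=.
set L := loops (b, D); set S := triangle_reps b.
have reps v := bstructure_reps v xB.
have id U : stable b U -> (#|U :&: L| + 2 * #|U :&: D| + 3 * #|U :&: S| = #|U|)%N.
  move=> Us; rewrite !card_setI_sum.
  have E1 := sum_stable (fun v => v \in D : nat) Us.
  have E2 := sum_stable (fun v => v \in S : nat) Us.
  have E3 := sum_stable (fun v => b v \in S : nat) Us.
  transitivity (\sum_(v in U) (v \in L) + \sum_(v in U) (v \in D) + \sum_(v in U) (b v \in D)
    + \sum_(v in U) (v \in S) + \sum_(v in U) (b v \in S) + \sum_(v in U) (b (b v) \in S))%N.
    by rewrite E1 E3 E2; lia.
  by rewrite -!big_split /= -sum1_card; apply: eq_bigr => v _; exact: reps.
have memU U v : stable b U -> (v \in U) =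
    [|| v \in U :&: L, v \in U :&: D, b v \in U :&: D, v \in U :&: S, b v \in U :&: S
     | b (b v) \in U :&: S].
  move=> /stableP Us; rewrite !finset.in_setI !Us.
  have := reps v; case: (v \in U) => //=; rewrite -/L -/S.
  move: (v \in L) (v \in D) (b v \in D) (v \in S) (b v \in S) (b (b v) \in S).
  by do 6 case.
have := @count_triples (stables b k) L D S 3 k c z isT V0 kn; apply=> //.
- have := id [set: V]; rewrite !finset.setTI cardsT => <-; first exact: leq_addl.
  by apply/stableP => v; rewrite !inE.
- move=> U W; rewrite !inE => /andP[Us _] /andP[Ws _] [EL ED ES].
  by apply/setP => v; rewrite (memU U) // (memU W) // EL ED ES.
- by move=> U; rewrite inE => /andP[Us /eqP <-]; rewrite id.
Qed.

End StableSets.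

(** * Summation over the sizes of stable sets *)

Section SixthRoot.
Variable R : realType.
Implicit Types x y : R.

(** All exponents that occur, 1/2, 1/3, 2/3 and 1/6, are multiples of 1/6, so integer powers of a
    sixth root express them. *)
Definition rt6 x : R := x `^ 6^-1.

Lemma rt6_ge0 x : 0 <= rt6 x. Proof. exact: powR_ge0. Qed.

Lemma rt6K x : 0 <= x -> rt6 x ^+ 6 = x.
Proof.
by move=> x0; rewrite -powR_mulrn ?powR_ge0 // /rt6 -powRrM mulVf ?powRr1 // pnatr_eq0.
Qed.

Lemma rt6_le x y : 0 <= x -> 0 <= y -> (rt6 x <= rt6 y) = (x <= y).
Proof.
by move=> x0 y0; rewrite -(@ler_pXn2r _ 6) ?nnegrE ?rt6_ge0 // !rt6K.
Qed.

Lemma rt6M x y : 0 <= x -> 0 <= y -> rt6 (x * y) = rt6 x * rt6 y.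
Proof. exact: powRM. Qed.

Lemma rt6_1 : rt6 1 = 1. Proof. by rewrite /rt6 powR1. Qed.

Lemma rt6_gt0 x : 0 < x -> 0 < rt6 x. Proof. exact: powR_gt0. Qed.

Lemma rt6_ge1 x : 1 <= x -> 1 <= rt6 x.
Proof. by move=> x1; rewrite -[X in X <= _]rt6_1 rt6_le // (le_trans ler01). Qed.

Lemma pow1D_le_expR x m : 0 <= x -> (1 + x) ^+ m <= expR (m%:R * x).
Proof.
move=> x0; rewrite expRM_natl lerXn2r ?nnegrE ?expR_ge0 ?expR_ge1Dx //.
by rewrite addr_ge0.
Qed.

Lemma geometric_tail_le (r : R) (K M : nat) : 0 <= r -> r < 1 ->
  \sum_(0 <= k < M) (if (K <= k)%N then r ^+ k else 0) <= r ^+ K / (1 - r).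
Proof.
move=> r0 r1; rewrite ler_pdivlMr ?subr_gt0 //.
suff : (\sum_(0 <= k < M) (if (K <= k)%N then r ^+ k else 0)) * (1 - r) <= r ^+ K - r ^+ maxn K M.
  by move/le_trans; apply; rewrite gerBl exprn_ge0.
elim: M => [|M IH]; first by rewrite big_nil mul0r maxn0 subrr.
rewrite big_nat_recr //= mulrDl; case: ifP => KM; last first.
  rewrite mul0r addr0; apply: le_trans IH _.
  have -> : maxn K M.+1 = maxn K M by lia.
  by [].
apply: le_trans (lerD IH (lexx _)) _.
have -> : maxn K M = M by lia.
have -> : maxn K M.+1 = M.+1 by lia.
by rewrite exprS; lra.
Qed.

(** An upper bound for 'C(n, k)^(-1/6), by [bin_lower], times the factor exp(c (2k)^(2/3)) for the
    loops and isolated edges. *)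
Definition qterm (c : R) (n k : nat) :=
  rt6 (k%:R / n%:R) ^+ k * expR (c * rt6 (k.*2%:R) ^+ 4).

(** From a fixed [K] on, the terms are dominated by a geometric series with sum at most 1/4. The
    fewer than [K] remaining terms tend to 0 with n and also contribute at most 1/4. *)
Lemma sum_qterm (c : R) : 0 < c -> exists n0, forall n, (n0 <= n)%N ->
  \sum_(1 <= k < n./2.+1) qterm c n k <= 2^-1.
Proof.
move=> c0.
set s := rt6 2^-1.
have s0 : 0 < s by rewrite rt6_gt0 // invr_gt0.
have s1 : s < 1.
  rewrite ltNge; apply/negP => /(@lerXn2r _ 6 1 s); rewrite !nnegrE ler01 rt6_ge0.
  move=> /(_ isT isT); rewrite expr1n rt6K ?invr_ge0 //; lra.
(* Half of the decay of s^k is given up to absorb the factor exp(c (2k)^(2/3)); the ratio left is r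
   = exp(-d). *)
set d := - ln s / 2.
have d0 : 0 < d by rewrite divr_gt0 // oppr_gt0 ln_lt0 // s0.
set r := expR (- d).
have rE : r = s * expR d.
  rewrite -[s in RHS](lnK s0) -expRD /r; congr expR; rewrite /d; lra.
have r0 : 0 < r by rewrite expR_gt0.
have r1 : r < 1 by rewrite expR_lt1 oppr_lt0.
have [K1 hK1] : exists K1 : nat, forall k, (K1 <= k)%N -> c * rt6 (k.*2%:R) ^+ 4 <= d * k%:R.
  set t := c * 2 / d; have t0 : 0 < t by rewrite divr_gt0 // mulr_gt0.
  exists (Num.bound (t ^+ 3)) => k hk.
  set u := rt6 _; have u0 : 0 <= u by exact: rt6_ge0.
  have u6 : u ^+ 6 = 2 * k%:R by rewrite rt6K // -mul2n natrM.
  have tu : t <= u ^+ 2.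
    rewrite -(@ler_pXn2r _ 3) ?nnegrE ?exprn_ge0 ?(ltW t0) // -exprM u6.
    have := archi_boundP (exprn_ge0 3 (ltW t0)); move=> h.
    have : (Num.bound (t ^+ 3))%:R <= k%:R :> R by rewrite ler_nat.
    have : 0 <= k%:R :> R by [].
    lra.
  have : c * u ^+ 4 * 2 <= d * (u ^+ 4 * u ^+ 2).
    have -> : c * u ^+ 4 * 2 = d * (u ^+ 4 * t).
      rewrite /t; field; rewrite gt_eqF //.
    by rewrite ler_pM2l // ler_wpM2l // exprn_ge0.
  rewrite -exprD u6; lra.
have [K2 hK2] : exists K2, forall k, (K2 <= k)%N -> r ^+ k <= (1 - r) / 4.
  have e0 : 0 < (1 - r) / 4 by rewrite divr_gt0 // subr_gt0.
  have := cvg_expr (_ : `|r| < 1); rewrite ger0_norm ?(ltW r0) // => /(_ r1) /cvgrPdist_le.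
  move=> /(_ _ e0)[K2 _ h]; exists K2 => k hk.
  by have := h k hk; rewrite /= sub0r normrN ger0_norm // exprn_ge0 // ltW.
set K := maxn 1 (maxn K1 K2).
set E := expR (c * rt6 (K.*2%:R) ^+ 4).
have E0 : 0 < E by exact: expR_gt0.
have K0 : (0 < K)%N by rewrite leq_max.
have KR0 : 0 < K%:R :> R by rewrite ltr0n.
(* Beyond this n, (K/n)^(1/6) is at most 1 / (4 K E), which makes the head of the sum at most
   1/4. *)
set B := K%:R * (4 * K%:R * E) ^+ 6.
exists (Num.bound B).+1 => n hn.
have n0 : (0 < n)%N by exact: leq_ltn_trans hn.
have nR0 : 0 < n%:R :> R by rewrite ltr0n.
have headB : rt6 (K%:R / n%:R) * E * K%:R <= 4^-1.
  have P0 : 0 < 4 * K%:R * E by rewrite !mulr_gt0.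
  have : rt6 (K%:R / n%:R) <= (4 * K%:R * E)^-1.
    rewrite -(@ler_pXn2r _ 6) ?nnegrE ?rt6_ge0 ?invr_ge0 ?(ltW P0) //.
    rewrite rt6K ?divr_ge0 // exprVn ler_pdivrMr // ler_pdivlMl ?exprn_gt0 //.
    rewrite mulrC -/B; apply: le_trans (_ : (Num.bound B)%:R <= _).
      apply/ltW/archi_boundP; rewrite mulr_ge0 // exprn_ge0 // ltW //.
    by rewrite ler_nat ltnW.
  move=> h; rewrite -mulrA.
  apply: le_trans (ler_wpM2r _ h) _; first by rewrite mulr_ge0 // ltW.
  have -> : (4 * K%:R * E)^-1 * (E * K%:R) = 4^-1; last by [].
  by field; rewrite !gt_eqF.
have term k : (1 <= k < n./2.+1)%N ->
   qterm c n k <= (if (k < K)%N then rt6 (K%:R / n%:R) * E else 0) +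
                  (if (K <= k)%N then r ^+ k else 0).
  move=> /andP[k1 kn]; rewrite /qterm.
  have kn2 : (k.*2 <= n)%N by rewrite -geq_half_double -ltnS.
  have kr0 : 0 <= k%:R / n%:R :> R by rewrite divr_ge0.
  have kr1 : k%:R / n%:R <= 2^-1 :> R.
    rewrite ler_pdivrMr // -(ler_pM2l (_ : 0 < 2)) // mulrA divff ?mul1r ?pnatr_eq0 //.
    by rewrite -natrM ler_nat mul2n.
  have rk1 : rt6 (k%:R / n%:R) <= 1.
    by rewrite -[X in _ <= X]rt6_1 rt6_le ?ler01 //; apply: le_trans kr1 _; lra.
  case: (leqP K k) => Kk; last first.
    rewrite addr0; apply: ler_pM; rewrite ?exprn_ge0 ?rt6_ge0 ?expR_ge0 //.
      apply: (@le_trans _ _ (rt6 (k%:R / n%:R))).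
        by rewrite -[leRHS]expr1 ler_wiXn2l ?rt6_ge0.
      rewrite rt6_le ?divr_ge0 // ler_pM2r ?invr_gt0 // ler_nat; exact: ltnW.
    rewrite ler_expR ler_pM2l //; apply: lerXn2r; rewrite ?nnegrE ?rt6_ge0 //.
    by rewrite rt6_le // ler_nat leq_double ltnW.
  rewrite add0r rE exprMn; apply: ler_pM; rewrite ?exprn_ge0 ?rt6_ge0 ?expR_ge0 //.
    by rewrite lerXn2r ?nnegrE ?rt6_ge0 // rt6_le // invr_ge0.
  rewrite -expRM_natl ler_expR [leRHS]mulrC hK1 //.
  by apply: leq_trans Kk; rewrite !leq_max leqnn /= orbT.
rewrite big_nat_cond.
apply: (@le_trans _ _ (\sum_(1 <= k < n./2.+1)
   ((if (k < K)%N then rt6 (K%:R / n%:R) * E else 0) + (if (K <= k)%N then r ^+ k else 0)))).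
  rewrite [leRHS]big_nat_cond; apply: ler_sum => k; rewrite andbT => h; exact: term.
have nn k : 0 <= (if (k < K)%N then rt6 (K%:R / n%:R) * E else 0) :> R.
  by case: ifP => // _; rewrite mulr_ge0 ?rt6_ge0 ?expR_ge0.
have nr k : 0 <= (if (K <= k)%N then r ^+ k else 0) :> R.
  by case: ifP => // _; rewrite exprn_ge0 ?ltW.
apply: (@le_trans _ _ (\sum_(0 <= k < n./2.+1)
   ((if (k < K)%N then rt6 (K%:R / n%:R) * E else 0) + (if (K <= k)%N then r ^+ k else 0)))).
  by rewrite [leRHS]big_ltn // lerDr addr_ge0.
rewrite big_split /=.
have -> : 2^-1 = 4^-1 + 4^-1 :> R by lra.
apply: lerD; last first.
  apply: le_trans (geometric_tail_le _ _ (ltW r0) r1) _.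
  rewrite ler_pdivrMr ?subr_gt0 // mulrC; apply: hK2.
  by rewrite !leq_max leqnn !orbT.
apply: le_trans headB.
apply: (@le_trans _ _ (\sum_(0 <= k < n./2.+1 + K)
  (if (k < K)%N then rt6 (K%:R / n%:R) * E else 0))).
  by rewrite [leRHS](big_cat_nat (leq0n _) (leq_addr K n./2.+1)) //= lerDl sumr_ge0.
rewrite (big_cat_nat (leq0n K) (leq_addl n./2.+1 K)) /=.
rewrite [X in _ + X]big_nat_cond [X in _ + X]big1 ?addr0.
  rewrite big_nat_cond (eq_bigr (fun _ => rt6 (K%:R / n%:R) * E)).
    by rewrite -big_nat_cond sumr_const_nat subn0 mulr_natr.
  by move=> k; rewrite andbT => /andP[_ ->].
by move=> k; rewrite andbT => /andP[h _]; rewrite ltnNge h.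
Qed.

End SixthRoot.

(** At most c n^(1/2) a-loops, c n^(1/3) b-loops and c n^(2/3) isolated edges. *)
Definition typical (R : realType) (V : finType) (c : R) (a : {perm V})
    (x : {perm V} * {set V}) :=
  [&& (fixn a)%:R <= c * rt6 #|V|%:R ^+ 3, #|loops x|%:R <= c * rt6 #|V|%:R ^+ 2
    & #|x.2|%:R <= c * rt6 #|V|%:R ^+ 4].

(** The two counts give 'C(n, k)^(1/2 + 1/3) up to exponentials, and k! (n - k)! is n! / 'C(n, k),
    so 'C(n, k)^(-1/6) remains. For a typical pair each of the three exponents is at most c
    (2k)^(2/3). *)
Lemma stable_pairs_le (R : realType) (c : R) (V : finType) (a : {perm V})
    (x : {perm V} * {set V}) k :
  0 < c -> a \in involutions V -> x \in bstructures V -> typical c a x ->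
  (0 < k)%N -> (k.*2 <= #|V|)%N ->
  (#|stables a k| * #|stables x.1 k| * (k`! * (#|V| - k)`!))%:R <=
    ((#|V|)`!)%:R * qterm (3 * c) #|V| k.
Proof.
move=> c0 ai xB /and3P[fa lx ex] k0 kn.
set n := #|V| in kn fa lx ex *.
have n0 : (0 < n)%N by lia.
have nR0 : 0 < n%:R :> R by rewrite ltr0n.
have kn' : (k <= n)%N by lia.
set C : R := 'C(n, k)%:R.
have C0 : 0 < C by rewrite ltr0n bin_gt0.
set rC := rt6 C; have rC0 : 0 < rC by exact: rt6_gt0.
have rC0' := ltW rC0.
have rC6 : rC ^+ 6 = C by rewrite rt6K // ltW.
set y : R := k.*2%:R / n%:R; have y0 : 0 <= y by rewrite divr_ge0.
set ry := rt6 y; have ry0 : 0 <= ry by exact: rt6_ge0.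
have ry6 : ry ^+ 6 = y by rewrite rt6K.
set nu := rt6 n%:R in fa lx ex; have nu0 : 0 <= nu by exact: rt6_ge0.
set ka := rt6 (k.*2%:R : R).
(* A count of order nu^i is multiplied by ry^i, which gives ka^i, and ka^i <= ka^4 because ka >=
   1. *)
have kaE : ka = ry * nu by rewrite /ka /ry /nu -rt6M // /y divfK // gt_eqF.
have ka1 : 1 <= ka by rewrite rt6_ge1 // ler1n double_gt0.
have ka0 : 0 <= ka by exact: le_trans ler01 ka1.
have hA : #|stables a k|%:R <= rC ^+ 3 * expR ((fixn a)%:R * ry ^+ 3).
  apply: (le_trans (@stables_involution R _ _ _ (rC ^+ 3) (ry ^+ 3) ai n0 kn _ _ _ _));
    rewrite ?exprn_ge0 ?(ltW rC0) -?exprM //.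
  by rewrite ler_pM2l ?exprn_gt0 // pow1D_le_expR // exprn_ge0.
have hB : #|stables x.1 k|%:R <=
    rC ^+ 2 * expR (#|loops x|%:R * ry ^+ 2) * expR (#|x.2|%:R * ry ^+ 4).
  apply: (le_trans (@stables_bstructure R _ _ _ (rC ^+ 2) (ry ^+ 2) xB n0 kn _ _ _ _));
    rewrite ?exprn_ge0 ?(ltW rC0) -?exprM //.
  rewrite -[leLHS]mulrA -[leRHS]mulrA; apply: ler_wpM2l; first exact: exprn_ge0.
  apply: ler_pM; [| |exact: pow1D_le_expR _ (exprn_ge0 2 ry0)|].
  - by rewrite exprn_ge0 // addr_ge0 // exprn_ge0.
  - by rewrite exprn_ge0 // addr_ge0 // exprn_ge0.
  - exact: pow1D_le_expR _ (exprn_ge0 4 ry0).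
have hE : expR ((fixn a)%:R * ry ^+ 3) * (expR (#|loops x|%:R * ry ^+ 2) *
     expR (#|x.2|%:R * ry ^+ 4)) <= expR (3 * c * ka ^+ 4).
  rewrite -!expRD ler_expR.
  have g m i : (i <= 4)%N -> m <= c * nu ^+ i -> m * ry ^+ i <= c * ka ^+ 4.
    move=> i4 h; apply: (@le_trans _ _ (c * ka ^+ i)); last first.
      by rewrite ler_pM2l // ler_weXn2l.
    by rewrite kaE exprMn [ry ^+ i * _]mulrC mulrA ler_wpM2r // exprn_ge0.
  have := @g _ 3 isT fa; have := @g _ 2 isT lx; have := @g _ 4 isT ex; lra.
have hC : 1 <= rC * rt6 (k%:R / n%:R) ^+ k.
  have q0 : 0 <= k%:R / n%:R :> R by rewrite divr_ge0.
  rewrite -(@ler_pXn2r _ 6) ?nnegrE ?mulr_ge0 ?exprn_ge0 ?rt6_ge0 ?(ltW rC0) //.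
  rewrite expr1n exprMn rC6 -exprM mulnC exprM rt6K // expr_div_n mulrA.
  rewrite ler_pdivlMr ?exprn_gt0 // mul1r -!natrX -natrM ler_nat.
  exact: bin_lower.
have fE : (k`! * (n - k)`!)%:R * rC ^+ 6 = n`!%:R by rewrite rC6 -natrM mulnC bin_fact.
rewrite natrM [X in X * _]natrM; set F : R := (k`! * (n - k)`!)%:R in fE *.
have F0 : 0 <= F by rewrite ler0n.
apply: (@le_trans _ _ (rC ^+ 3 * expR ((fixn a)%:R * ry ^+ 3) *
   (rC ^+ 2 * expR (#|loops x|%:R * ry ^+ 2) * expR (#|x.2|%:R * ry ^+ 4)) * F)).
  by rewrite ler_wpM2r // ler_pM.
rewrite -fE /qterm -/ka.
apply: (@le_trans _ _ (rC ^+ 5 * F * expR (3 * c * ka ^+ 4))).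
  have -> : forall e1 e2 e3, rC ^+ 3 * e1 * (rC ^+ 2 * e2 * e3) * F =
     rC ^+ 5 * F * (e1 * (e2 * e3)) by move=> e1 e2 e3; ring.
  by rewrite ler_wpM2l // mulr_ge0 // exprn_ge0 // ltW.
have -> : F * rC ^+ 6 * (rt6 (k%:R / n%:R) ^+ k * expR (3 * c * ka ^+ 4)) =
  rC ^+ 5 * F * expR (3 * c * ka ^+ 4) * (rC * rt6 (k%:R / n%:R) ^+ k) by ring.
have X0 : 0 <= rC ^+ 5 * F * expR (3 * c * ka ^+ 4).
  by apply: mulr_ge0 (expR_ge0 _); apply: mulr_ge0 F0; apply: exprn_ge0.
by rewrite -[leLHS]mulr1; apply: ler_wpM2l.
Qed.

Lemma mostly_connected (R : realType) (c : R) : 0 < c -> exists n0,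
  forall (V : finType) (v : V) (a : {perm V}) (x : {perm V} * {set V}),
  (n0 <= #|V|)%N -> a \in involutions V -> x \in bstructures V -> typical c a x ->
  (2 * #|[set s : {perm V} | ~~ conn_from v (a ^ s)%g x.1]| <= (#|V|)`!)%N.
Proof.
move=> c0; have [|n0 hn0] := @sum_qterm R (3 * c); first by rewrite mulr_gt0.
exists n0 => V v a x Vn ai xB tp.
have := sum_nonconnected v a x.1; set n := #|V| in Vn *; set B := #|_| => hB.
rewrite -(ler_nat R) natrM.
have hB' : B%:R <= \sum_(1 <= k < n./2.+1) n`!%:R * qterm (3 * c) n k :> R.
  apply: (@le_trans _ _ ((\sum_(1 <= k < n./2.+1)
     #|stables a k| * #|stables x.1 k| * (k`! * (n - k)`!))%N%:R)); first by rewrite ler_nat.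
  rewrite natr_sum big_nat_cond [leRHS]big_nat_cond; apply: ler_sum => k.
  rewrite andbT => /andP[k1 kn]; apply: stable_pairs_le => //; rewrite -/n; lia.
rewrite -big_distrr /= in hB'.
have f0 : 0 <= n`!%:R :> R by [].
have := ler_wpM2l f0 (hn0 _ Vn); lra.
Qed.

End ConnectivityBounds.

(** * Normal forms *)

Section Groups.
Local Open Scope classical_set_scope.
Local Open Scope group_scope.

Section NormalForm.

(** Left multiplication by a letter, on normal words. *)
Definition push (l : letter) (w : word) : word :=
  match l, w with
  | La, La :: w' => w'
  | Lb, Lb :: w' => Lb' :: w'
  | Lb, Lb' :: w' => w'
  | Lb', Lb :: w' => w'
  | Lb', Lb' :: w' => Lb :: w'
  | _, _ => l :: w
  end.

Definition nf (w : word) : word := foldr push [::] w.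

Lemma push_normal l w : normal_word w -> normal_word (push l w).
Proof. by rewrite /normal_word; case: l; case: w => [|[] [|[] w]] //=. Qed.

Lemma nf_normal w : normal_word (nf w).
Proof. by elim: w => [//|l w IH]; exact: push_normal. Qed.

Lemma nf_id w : normal_word w -> nf w = w.
Proof.
elim: w => [//|l w IH] /= h; rewrite IH; last first.
  by move: h; rewrite /normal_word; case: w {IH} => [//|l' w] /= /andP[].
by move: h; rewrite /normal_word; case: l; case: w {IH} => [//|[] w].
Qed.

(** Each relator acts trivially on normal words by [push], so [nf] is an invariant of group
    elements; this is the uniqueness of normal forms. *)
Lemma nf_eqv u v : word_eqv u v -> nf u = nf v.
Proof.
elim=> {u v} [u r v rP|//|u v _ -> //|u v w _ -> _ -> //].
rewrite /nf !foldr_cat; congr (foldr _ _ _).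
have := nf_normal v; rewrite -/(nf v); move: (nf v) => x.
by move: rP; rewrite !inE /normal_word => /or4P[]/eqP->; case: x => [//|[] [//|[] x]].
Qed.

Lemma of_word_cons l w : of_word (l :: w) = of_word [:: l] * of_word w.
Proof. by rewrite -of_word_cat. Qed.

Lemma of_word_rel r : r \in relators -> of_word r = 1.
Proof.
move=> rP; apply/of_wordP; rewrite -[r]cats0 -[r ++ [::]]cat0s.
exact: (WordRel [::] [::] rP).
Qed.

Lemma mul_aa : of_word [:: La] * of_word [:: La] = 1.
Proof. by rewrite -of_word_cat of_word_rel. Qed.

Lemma mul_bb' : of_word [:: Lb] * of_word [:: Lb'] = 1.
Proof. by rewrite -of_word_cat of_word_rel. Qed.

Lemma mul_b'b : of_word [:: Lb'] * of_word [:: Lb] = 1.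
Proof. by rewrite -of_word_cat of_word_rel. Qed.

Lemma mul_bb : of_word [:: Lb] * of_word [:: Lb] = of_word [:: Lb'].
Proof.
apply: (mulIg (of_word [:: Lb])).
by rewrite mul_b'b -!of_word_cat of_word_rel.
Qed.

Lemma mul_b'b' : of_word [:: Lb'] * of_word [:: Lb'] = of_word [:: Lb].
Proof. by rewrite -{1}mul_bb -mulgA mul_bb' mulg1. Qed.

Lemma mul_linv l : of_word [:: l] * of_word [:: letter_inv l] = 1.
Proof. by case: l; [exact: mul_aa|exact: mul_bb'|exact: mul_b'b]. Qed.

Lemma of_word_push l w : of_word (push l w) = of_word (l :: w).
Proof.
by case: l; case: w => [//|[] w] //=; rewrite [RHS]of_word_cons [X in _ * X]of_word_cons mulgA
  ?mul_aa ?mul_bb ?mul_b'b' ?mul_bb' ?mul_b'b ?mul1g // -of_word_cons.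
Qed.

Lemma of_word_nf w : of_word (nf w) = of_word w.
Proof.
elim: w => [//|l w IH] /=.
by rewrite of_word_push [LHS]of_word_cons IH -of_word_cons.
Qed.

Lemma of_word_inj_nf u v : of_word u = of_word v -> nf u = nf v.
Proof. by move/of_wordP/nf_eqv. Qed.

End NormalForm.

(** * Graphs of subgroups *)

Section Cosets.
Variables (G : groupType).
Implicit Types (H K : set G) (g h : G).

Lemma cosetM K g h : coset (coset K g) h = coset K (g * h).
Proof.
apply/seteqP; split=> x /= [y].
  by move=> [k Kk <-] <-; exists k; rewrite // mulgA.
by move=> Kk <-; exists (y * g); [exists y|rewrite mulgA].
Qed.

Lemma coset1 K : coset K 1 = K.
Proof.
apply/seteqP; split=> x /=; first by move=> [y Ky <-]; rewrite mulg1.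
by move=> Kx; exists x; rewrite ?mulg1.
Qed.

Lemma coset_eq H g h : subgroup H -> (coset H g = coset H h) <-> H (g * h^-1).
Proof.
move=> [H1 HM HV]; split=> [E|Hgh].
  have : coset H h g by rewrite -E; exists 1; rewrite ?mul1g.
  by move=> [x Hx <-]; rewrite mulgK.
apply/seteqP; split=> x [y Hy <-].
  by exists (y * (g * h^-1)); [exact: HM|rewrite -!mulgA mulVg mulg1].
exists (y * (g * h^-1)^-1); first by apply: HM => //; exact: HV.
by rewrite invgM invgK -!mulgA mulVg mulg1.
Qed.

Lemma coset_id H g : subgroup H -> H g -> coset H g = H.
Proof. by move=> sH Hg; rewrite -[RHS]coset1; apply/coset_eq; rewrite ?invg1 ?mulg1. Qed.

Lemma coset_eq_id H g : subgroup H -> coset H g = H -> H g.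
Proof.
move=> sH; rewrite -[in RHS](coset1 H) => /coset_eq; rewrite invg1 mulg1; exact.
Qed.

End Cosets.

Section Schreier.
Variable H : set psl2z.
Hypothesis sH : subgroup H.

Lemma step_schreier K l K' :
  step (schreier H) K l K' <-> range (coset H) K /\ K' = coset K (of_word [:: l]).
Proof.
have e m g : coset H (g * of_word [:: m]) = coset (coset H g) (of_word [:: m]).
  by rewrite cosetM.
case: l => /=; split.
- by move=> [g _ [<- <-]]; split; [exists g|rewrite e].
- by move=> [[g _ <-] ->]; exists g; rewrite // e.
- by move=> [g _ [<- <-]]; split; [exists g|rewrite e].
- by move=> [[g _ <-] ->]; exists g; rewrite // e.
- move=> [g _ [<- <-]]; split; first by exists (g * of_word [:: Lb]).
  by rewrite cosetM -mulgA mul_bb' mulg1.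
- move=> [[g _ <-] ->]; exists (g * of_word [:: Lb']) => //.
  by rewrite -mulgA mul_b'b mulg1 cosetM.
Qed.

Lemma path_schreier K w K' : path_labeled (schreier H) K w K' <->
  range (coset H) K /\ K' = coset K (of_word w).
Proof.
elim: w K K' => [|l w IH] K K' /=.
  by rewrite (_ : of_word [::] = 1) // coset1; split=> -[h E].
split=> [[K1 /step_schreier[rK ->]] /IH[_ ->]|[rK ->]].
  by split=> //; rewrite cosetM -of_word_cons.
exists (coset K (of_word [:: l])); first exact/step_schreier.
apply/IH; rewrite cosetM -of_word_cons; split=> //.
by case: rK => g _ <-; rewrite cosetM; exists (g * of_word [:: l]).
Qed.

Lemma range_id : range (coset H) H. Proof. by exists 1; rewrite ?coset1. Qed.

Lemma visitedP K : visited H K <-> exists w1 w2,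
  [/\ normal_word (w1 ++ w2), H (of_word (w1 ++ w2)) & K = coset H (of_word w1)].
Proof.
split=> [[w1 [w2 [nw Hw /path_schreier[_ ->] _]]]|[w1 [w2 [nw Hw ->]]]].
  by exists w1, w2.
exists w1, w2; split=> //; apply/path_schreier; split=> //.
  exact: range_id.
by rewrite cosetM -of_word_cat coset_id.
Qed.

Lemma visited_id : visited H H.
Proof.
apply/visitedP; exists [::], [::]; split=> //; first by case: sH => h _ _; exact: h.
exact/esym/coset1.
Qed.

Lemma normal_cat w1 w2 : normal_word (w1 ++ w2) -> normal_word w1 /\ normal_word w2.
Proof. by move=> /cat_sorted2[]. Qed.

(* Every vertex other than the root has an [a]-edge and a [b]-edge, because a
   loop through it reads two letters of different types around it. *)
Lemma visited_next K : visited H K -> K <> H ->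
  visited H (coset K (of_word [:: La])) /\
  (visited H (coset K (of_word [:: Lb])) \/ visited H (coset K (of_word [:: Lb']))).
Proof.
move=> /visitedP[w1 [w2 [nw Hw ->]]] KH.
have next l w : w2 = l :: w -> visited H (coset (coset H (of_word w1)) (of_word [:: l])).
  move=> E; apply/visitedP; exists (w1 ++ [:: l]), w.
  by rewrite -catA cat1s -E cosetM -of_word_cat.
have prev l w : w1 = rcons w l ->
    visited H (coset (coset H (of_word w1)) (of_word [:: letter_inv l])).
  move=> E; apply/visitedP; exists w, (l :: w2).
  have E2 : w ++ l :: w2 = w1 ++ w2 by rewrite E cat_rcons.
  by rewrite E2; split=> //; rewrite cosetM E -cats1 of_word_cat -mulgA mul_linv mulg1.
case/lastP: w1 nw Hw KH next prev => [|w l] nw Hw KH next prev.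
  by case: KH; exact: coset1.
case: w2 nw Hw next => [|l' w'] nw Hw next.
  by case: KH; apply: coset_id => //; move: Hw; rewrite cats0.
have hp := prev l w erefl; have hn := next l' w' erefl.
have : (l == La) != (l' == La).
  move: nw; rewrite cat_rcons => /normal_cat[_].
  by rewrite /normal_word /= => /andP[].
by case: l hp {prev nw Hw KH next} hn => /=; case: l' => //= hp hn _; split=> //; tauto.
Qed.

End Schreier.

(** * Partial labeled graphs and the groups of their loops *)

Section Graph.
Variables (V : eqType) (stp : letter -> V -> option V).
Hypothesis stp_inv : forall l u v, stp l u = Some v -> stp (letter_inv l) v = Some u.
Hypothesis stp_tri : forall u v w, stp Lb u = Some v -> stp Lb v = Some w ->
  stp Lb w = Some u.

Fixpoint run (u : V) (w : word) : option V :=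
  if w is l :: w' then (if stp l u is Some u' then run u' w' else None) else Some u.

Lemma run_cat u w1 w2 v : run u (w1 ++ w2) = Some v <->
  exists2 x, run u w1 = Some x & run x w2 = Some v.
Proof.
elim: w1 u => [|l w1 IH] u /=; first by split=> [h|[x [<-]]//]; exists u.
case: (stp l u) => [u'|]; first exact: IH.
by split=> // -[].
Qed.

Lemma stp_tri' u v w : stp Lb' u = Some v -> stp Lb' v = Some w -> stp Lb' w = Some u.
Proof. by move=> /stp_inv/= h1 /stp_inv/= h2; exact/(@stp_inv Lb)/(stp_tri h2 h1). Qed.

(** Cancellations are followed by [stp_inv]; when two letters b merge into b^-1, the triangle closed
    by [stp_tri] provides the edge. Thus normal forms are read along paths with the same ends. *)
Lemma run_push l u v w x : stp l u = Some v -> run v w = Some x ->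
  run u (push l w) = Some x.
Proof.
move=> lu; have := stp_inv lu.
case: l lu; case: w => [|[] w] //= lu lv; rewrite ?lu ?lv //.
- by case E: (stp Lb v) => [z|//]; have /(@stp_inv Lb) := stp_tri lu E; rewrite /= => ->.
- by case E: (stp Lb' v) => [z|//]; have /(@stp_inv Lb') := stp_tri' lu E; rewrite /= => ->.
Qed.

Lemma run_nf u w v : run u w = Some v -> run u (nf w) = Some v.
Proof.
elim: w u => [//|l w IH] u /=; case E: (stp l u) => [u'|//] /IH.
exact: run_push E.
Qed.

Lemma run_inv u w v : run u w = Some v -> run v (word_inv w) = Some u.
Proof.
elim: w u => [u [->]//|l w IH] u /=; case E: (stp l u) => [u'|//] /IH h.
rewrite /word_inv /= rev_cons -cats1; apply/run_cat; exists u' => //=.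
by rewrite (stp_inv E).
Qed.

Definition grp r : set psl2z := [set x | exists2 w, of_word w = x & run r w = Some r].

Lemma grpP r w : grp r (of_word w) <-> run r (nf w) = Some r.
Proof.
split=> [[w' /of_word_inj_nf <- /run_nf]//|h].
by exists (nf w); rewrite ?of_word_nf.
Qed.

Lemma grp_subgroup r : subgroup (grp r).
Proof.
split; first by exists [::].
  move=> _ _ [u <- hu] [v <- hv]; exists (u ++ v); first exact: of_word_cat.
  by apply/run_cat; exists r.
by move=> _ [u <- hu]; exists (word_inv u); [exact: of_word_inv|exact: run_inv].
Qed.

(** If p equals a loop w followed by q in the group, then p and wq have the same normal form and end
    at the same vertex. *)
Lemma grp_coset_eq r p q u v : run r p = Some u -> run r q = Some v ->
  coset (grp r) (of_word p) = coset (grp r) (of_word q) <-> u = v.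
Proof.
move=> ru rv; rewrite coset_eq; last exact: grp_subgroup.
rewrite -of_word_inv -of_word_cat; split=> [|uv]; last first.
  exists (p ++ word_inv q) => //; apply/run_cat; exists u => //.
  by rewrite uv; exact: run_inv.
move=> [w E hw].
have : of_word (w ++ q) = of_word p.
  by rewrite of_word_cat E of_word_cat of_word_inv -mulgA mulVg mulg1.
move=> /of_word_inj_nf E2.
have /run_nf : run r (w ++ q) = Some v by apply/run_cat; exists r.
by rewrite E2 (run_nf ru) => -[].
Qed.

End Graph.

(** * Extension of finite graphs to permutations *)

Section FinGraph.
Variables (V : finType) (stp : letter -> V -> option V).
Hypothesis stp_inv : forall l u v, stp l u = Some v -> stp (letter_inv l) v = Some u.
Hypothesis stp_tri : forall u v w, stp Lb u = Some v -> stp Lb v = Some w ->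
  stp Lb w = Some u.

(** Total steps: a missing edge becomes a fixed point, and an isolated b-edge becomes a
    transposition. *)
Definition stepa u := odflt u (stp La u).
Definition stepb u := odflt (odflt u (stp Lb' u)) (stp Lb u).
Definition stepb' u := odflt (odflt u (stp Lb u)) (stp Lb' u).

Lemma stepaK : involutive stepa.
Proof.
move=> u; rewrite /stepa; case E: (stp La u) => [v|] /=; last by rewrite E.
by rewrite (stp_inv E).
Qed.

(** Otherwise two consecutive b-edges end at [u], and their triangle has an edge leaving [u]. *)
Lemma not_out_in u t : stp Lb u = None -> stp Lb' u = Some t -> stp Lb' t = None.
Proof.
move=> n E; case E2: (stp Lb' t) => [z|//].
have /= h1 := stp_inv E; have /= h2 := stp_inv E2.
by rewrite (stp_tri h2 h1) in n.
Qed.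

Lemma not_in_out u t : stp Lb' u = None -> stp Lb u = Some t -> stp Lb t = None.
Proof.
move=> n E; case E2: (stp Lb t) => [z|//].
by have := stp_inv (stp_tri E E2); rewrite /= n.
Qed.

Lemma stepbK : cancel stepb stepb'.
Proof.
move=> u; rewrite /stepb /stepb'; case E: (stp Lb u) => [v|] /=.
  by have /= -> := stp_inv E.
case E': (stp Lb' u) => [t|] /=; last by rewrite E' E.
by rewrite (not_out_in E E') (stp_inv E').
Qed.

Lemma stepb'K : cancel stepb' stepb.
Proof.
move=> u; rewrite /stepb /stepb'; case E: (stp Lb' u) => [v|] /=.
  by have /= -> := stp_inv E.
case E': (stp Lb u) => [t|] /=; last by rewrite E' E.
by rewrite (not_in_out E E') (stp_inv E').
Qed.

Section Complete.
Hypothesis compa : forall u, stp La u != None.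
Hypothesis compb : forall u, (stp Lb u != None) || (stp Lb' u != None).

Definition tstep l := match l with La => stepa | Lb => stepb | Lb' => stepb' end.

Lemma tstep_inj l : injective (tstep l).
Proof.
case: l => /=; [exact: inv_inj stepaK|exact: can_inj stepbK|exact: can_inj stepb'K].
Qed.

(** The letter really read by a total step: on an isolated edge, b and b^-1 may be exchanged. *)
Definition lab l u := if stp l u is Some _ then l else letter_inv l.

Lemma lab_step l u : stp (lab l u) u = Some (tstep l u).
Proof.
rewrite /lab; case: l => /=; rewrite /stepa /stepb /stepb'.
- by have := compa u; case E: (stp La u).
- by have := compb u; case E: (stp Lb u) => [v|] //=; case: (stp Lb' u).
- by have := compb u; case E: (stp Lb' u) => [v|] //=; case: (stp Lb u).
Qed.

Lemma lab_stepE l u v : stp l u = Some v -> lab l u = l /\ tstep l u = v.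
Proof.
by rewrite /lab => E; rewrite E; split=> //; case: l E; rewrite /= /stepa /stepb /stepb' => ->.
Qed.

Fixpoint relabel w u : word := if w is l :: w' then lab l u :: relabel w' (tstep l u) else [::].
Fixpoint twalk w u : V := if w is l :: w' then twalk w' (tstep l u) else u.

Lemma twalk_inj w : injective (twalk w).
Proof. by elim: w => [//|l w IH] u v /= /IH /tstep_inj. Qed.

Lemma run_relabel w u : run stp u (relabel w u) = Some (twalk w u).
Proof. by elim: w u => [//|l w IH] u /=; rewrite lab_step. Qed.

Lemma relabel_run w u v : run stp u w = Some v -> relabel w u = w /\ twalk w u = v.
Proof.
elim: w u => [u [->]//|l w IH] u /=; case E: (stp l u) => [x|//].
by have [-> ->] := lab_stepE E => /IH[-> ->].
Qed.

Lemma relabel_cat w1 w2 u : relabel (w1 ++ w2) u = relabel w1 u ++ relabel w2 (twalk w1 u).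
Proof. by elim: w1 u => [//|l w IH] u /=; rewrite IH. Qed.

Lemma twalk_cat w1 w2 u : twalk (w1 ++ w2) u = twalk w2 (twalk w1 u).
Proof. by elim: w1 u => [//|l w IH] u /=; rewrite IH. Qed.

Let alt : rel letter := fun l l' => (l == La) != (l' == La).

Lemma normal_isa w : normal_word w = sorted (fun x y : bool => x != y) (map (fun l => l == La) w).
Proof. by rewrite sorted_map. Qed.

(** Relabeling only exchanges b and b^-1, while normality depends only on the places of the letters
    a. *)
Lemma normal_relabel w u : normal_word (relabel w u) = normal_word w.
Proof.
rewrite !normal_isa; congr (sorted _ _); elim: w u => [//|l w IH] u /=.
by rewrite IH /lab; case: (stp l u) => //; case: l.
Qed.

Lemma twalk_nseq m w u : twalk (flatten (nseq m w)) u = iter m (twalk w) u.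
Proof. by elim: m u => [//|m IH] u; rewrite iterSr /= twalk_cat IH. Qed.

Lemma normal_nseq m l w : path alt l w -> alt (last l w) l ->
  normal_word (flatten (nseq m (l :: w))).
Proof.
move=> p c; have h k : path alt (last l w) (flatten (nseq k (l :: w))).
  by elim: k => [//|k IH] /=; rewrite c /= cat_path p.
by case: m => [//|m]; rewrite /normal_word /= cat_path p h.
Qed.

Lemma normal_extend l w u : path alt l w -> exists l', alt (last l w) l' /\ stp l' u != None.
Proof.
move=> _; rewrite /alt; case: (eqVneq (last l w) La) => h.
  by have /orP[h'|h'] := compb u; [exists Lb|exists Lb'].
by exists La.
Qed.

(* A path can be read forever, by permutations of the finite vertex set, without
   breaking the normal form; hence it comes back to its origin. *)
Lemma normal_loop r p u : normal_word p -> run stp r p = Some u ->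
  exists q, normal_word (p ++ q) /\ run stp r (p ++ q) = Some r.
Proof.
have main l w x : path alt l w -> alt (last l w) l -> run stp r (l :: w) = Some x ->
    exists q, normal_word ((l :: w) ++ q) /\ run stp r ((l :: w) ++ q) = Some r.
  move=> pw c rw; set t := l :: w.
  have inj := @twalk_inj t.
  (* The injective map [twalk t] brings [r] back after [order] steps; the first copy of [t] is the
     given path, so [k] copies remain to be read. *)
  set k := (fingraph.order (twalk t) r).-1.
  have [tE xE] := relabel_run rw.
  have E : t ++ relabel (flatten (nseq k t)) x = relabel (flatten (nseq k.+1 t)) r.
    by rewrite [nseq _.+1 _]/= [flatten _]/= [RHS]relabel_cat tE xE.
  exists (relabel (flatten (nseq k t)) x); rewrite E normal_relabel normal_nseq //.
  split=> //; rewrite run_relabel twalk_nseq /k prednK ?fingraph.order_gt0 //.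
  by rewrite fingraph.iter_order.
case: p => [|l w].
  by move=> _ _; exists [::].
move=> np rp; have pw : path alt l w by exact: np.
have [c|nc] := boolP (alt (last l w) l); first exact: main rp.
(* If the ends of the word do not alternate cyclically, one more letter makes them do so. *)
have [l' [al' ]] := normal_extend u pw; case E: (stp l' u) => [y|//] _.
have [| |//|q] := main l (rcons w l') y.
- by rewrite rcons_path pw.
- by rewrite last_rcons; move: al' nc; rewrite /alt; do 3 case: (_ == La).
- by rewrite -rcons_cons -cats1; apply/run_cat; exists u; rewrite //= E.
by rewrite -rcons_cons cat_rcons => h; exists (l' :: q).
Qed.

Section Connected.
Variable r : V.
Hypothesis conn : forall u, exists p, run stp r p = Some u.

Let H := grp stp r.
Let sH : subgroup H. Proof. exact: grp_subgroup. Qed.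

Definition spath u : word := if u == r then [::] else xget [::] [set p | run stp r p = Some u].

Lemma run_spath u : run stp r (spath u) = Some u.
Proof.
rewrite /spath; case: eqP => [->//|_].
by case: xgetP => [p -> //|h]; have [p /h] := conn u.
Qed.

Lemma spath_root : spath r = [::]. Proof. by rewrite /spath eqxx. Qed.

Definition vcoset u : set psl2z := coset H (of_word (spath u)).

Lemma vcoset_inj : injective vcoset.
Proof. by move=> u v; exact: (proj1 (grp_coset_eq stp_inv stp_tri (run_spath u) (run_spath v))). Qed.

Lemma vcosetE u p : run stp r p = Some u -> vcoset u = coset H (of_word p).
Proof. by move=> h; exact: (proj2 (grp_coset_eq stp_inv stp_tri (run_spath u) h)). Qed.

Lemma vcoset_root : vcoset r = H.
Proof. by rewrite /vcoset spath_root; exact: coset1. Qed.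

Lemma vcoset_step l u v : stp l u = Some v -> vcoset v = coset (vcoset u) (of_word [:: l]).
Proof.
move=> E; rewrite cosetM -of_word_cat; apply: vcosetE.
by apply/run_cat; exists u; rewrite ?run_spath //= E.
Qed.

(** By [normal_loop] every vertex lies on a loop at the root with a normal label, so the whole graph
    is the Stallings graph of its group. *)
Lemma visited_grp : visited H = range vcoset.
Proof.
apply/seteqP; split=> [K /visitedP-/(_ sH)[w1 [w2 [nw Hw ->]]]|_ [u _ <-]].
  move: Hw => /grpP-/(_ stp_inv stp_tri); rewrite nf_id // => /run_cat[u ru _].
  by exists u => //; exact: vcosetE.
apply/visitedP => //; have /(run_nf stp_inv stp_tri) ru := run_spath u.
have [q [nq rq]] := normal_loop (nf_normal _) ru.
exists (nf (spath u)), q; split=> //; last by rewrite (vcosetE ru).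
by exists (nf (spath u) ++ q).
Qed.

(** Schreier generators: each edge gives one generator, and along a loop their product
    telescopes. *)
Lemma fg_grp : finitely_generated H.
Proof.
pose gen (t : V * letter * V) :=
  of_word (spath t.1.1) * of_word [:: t.1.2] * (of_word (spath t.2))^-1.
exists (gen @` [set t | stp t.1.2 t.1.1 = Some t.2]).
  exact/finite_image/finite_finset.
apply/seteqP; split.
  move=> x Hx A [[A1 AM AV] SA].
  have key w u v : run stp u w = Some v ->
     A (of_word (spath u) * of_word w * (of_word (spath v))^-1).
    elim: w u => [|l w IH] u /=; first by move=> [->]; rewrite mulg1 mulgV.
    case E: (stp l u) => [y|//] /IH h.
    have -> : of_word (spath u) * of_word (l :: w) * (of_word (spath v))^-1 =
      gen (u, l, y) * (of_word (spath y) * of_word w * (of_word (spath v))^-1).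
      by rewrite /gen /= of_word_cons !mulgA mulgKV.
    by apply: AM => //; apply: SA; exists (u, l, y).
  case: Hx => w <- /key; rewrite spath_root.
  by rewrite (_ : of_word [::] = 1) // mul1g invg1 mulg1.
apply: smallest_sub => // _ [[[u l] v] /= E <-].
rewrite /gen /= -of_word_inv -!of_word_cat; exists ((spath u ++ [:: l]) ++ word_inv (spath v)) => //.
apply/run_cat; exists v; last exact/(run_inv stp_inv)/run_spath.
by apply/run_cat; exists u; rewrite ?run_spath //= E.
Qed.

(** Suppose a b-edge from [x] to [y] of the Schreier graph is missing. Then some edge enters [x]
    from a vertex [t]. An edge leaving [y] would end at [t], as bb = b^-1, and its triangle would
    give the missing edge; an edge entering [y] would start at [x]. *)
Lemma vcoset_stepE l u v : stp l u = Some v <-> vcoset v = coset (vcoset u) (of_word [:: l]).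
Proof.
split; first exact: vcoset_step.
have sb x y : vcoset y = coset (vcoset x) (of_word [:: Lb]) -> stp Lb x = Some y.
  move=> E; case E1: (stp Lb x) => [x'|].
    by congr Some; apply: vcoset_inj; rewrite E (vcoset_step E1).
  have := compb x; rewrite E1 /=; case E2: (stp Lb' x) => [t|//] _.
  have Et := vcoset_step E2.
  have Eyb : coset (vcoset y) (of_word [:: Lb']) = vcoset x.
    by rewrite E cosetM mul_bb' coset1.
  have := compb y; case E3: (stp Lb y) => [y'|] /=.
    move=> _; have yt : y' = t.
      by apply: vcoset_inj; rewrite (vcoset_step E3) Et E cosetM mul_bb.
    rewrite yt in E3; have /= E4 := stp_inv E2.
    by rewrite (stp_tri E3 E4) in E1.
  case E5: (stp Lb' y) => [t'|//] _.
  have t'x : t' = x by apply: vcoset_inj; rewrite (vcoset_step E5).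
  by have := stp_inv E5; rewrite t'x /= E1.
case: l => E; last 1 first.
- apply/(@stp_inv Lb)/sb; rewrite E cosetM mul_b'b coset1 //.
- case E1: (stp La u) (compa u) => [x|//] _.
  by congr Some; apply: vcoset_inj; rewrite E (vcoset_step E1).
- exact: sb.
Qed.

End Connected.
End Complete.
End FinGraph.

End Groups.

(** * Encoding subgroups by permutations *)

Section Codes.
Variable V : finType.

Definition permf (f : V -> V) : {perm V} :=
  odflt 1%g [pick s : {perm V} | [forall u, s u == f u]].

Lemma permfE f : injective f -> permf f =1 f.
Proof.
move=> fi u; rewrite /permf; case: pickP => [s /forallP h|h] /=; first exact/eqP.
by have /negP[] := h (perm fi); apply/forallP => v; rewrite permE.
Qed.

Definition gcode := ({perm V} * ({perm V} * {set V}))%type.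

Definition gencode (stp : letter -> V -> option V) : gcode :=
  (permf (stepa stp), (permf (stepb stp),
     [set u | (stp Lb u != None) && (stp Lb' u == None)]%SET)).

(** Whether a b-edge leaves [u]: a genuine loop, the origin of an isolated edge, or a triangle. *)
Definition oute (c : gcode) (fb : bool) (r u : V) :=
  [|| (c.2.1 u == u) && ~~ (fb && (u == r)), u \in c.2.2 | c.2.1 (c.2.1 u) != u].

(* The flags [fa] and [fb] tell that the loop of the code at the root [r] stands
   for a missing [a]-edge or [b]-edge. *)
Definition gdecode (c : gcode) (fa fb : bool) (r : V) (l : letter) (u : V) : option V :=
  match l with
  | La => if fa && (u == r) then None else Some (c.1 u)
  | Lb => if oute c fb r u then Some (c.2.1 u) else None
  | Lb' => let v := c.2.1^-1%g u in if oute c fb r v then Some v else None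
  end.

Section Encode.
Variable stp : letter -> V -> option V.
Hypothesis stp_inv : forall l u v, stp l u = Some v -> stp (letter_inv l) v = Some u.
Hypothesis stp_tri : forall u v w, stp Lb u = Some v -> stp Lb v = Some w ->
  stp Lb w = Some u.

Lemma encode_a : (gencode stp).1 =1 stepa stp.
Proof. by apply: permfE; apply: inv_inj; exact: stepaK. Qed.

Lemma encode_b : (gencode stp).2.1 =1 stepb stp.
Proof. by apply: permfE; apply: can_inj; exact: stepbK. Qed.

Lemma encode_involution : (gencode stp).1 \in involutions V.
Proof. by apply/involutionsP => u; rewrite !encode_a stepaK. Qed.

Lemma encode_out u v : stp Lb u = Some v -> (gencode stp).2.1 u = v.
Proof. by rewrite encode_b /stepb => ->. Qed.

Lemma encode_in u t : stp Lb u = None -> stp Lb' u = Some t -> (gencode stp).2.1 u = t.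
Proof. by rewrite encode_b /stepb => -> ->. Qed.

Lemma encode_none u : stp Lb u = None -> stp Lb' u = None -> (gencode stp).2.1 u = u.
Proof. by rewrite encode_b /stepb => -> ->. Qed.

Lemma encode_bstructure : (gencode stp).2 \in bstructures V.
Proof.
apply/bstructuresP => u; rewrite !inE.
case E: (stp Lb u) => [v|].
  rewrite !(encode_out E) /=; case E1: (stp Lb v) => [w|].
    rewrite !(encode_out E1); have E2 := stp_tri E E1; rewrite (encode_out E2).
    have := stp_inv E; have := stp_inv E2; rewrite /= => -> ->.
    rewrite /= eqxx; case: (eqVneq w u) => // wu; rewrite wu in E1.
    by have := stp_tri E1 E; rewrite E1 => -[->]; rewrite eqxx.
  have /= E2 := stp_inv E; rewrite !(encode_in E1 E2) eqxx.
  case E3: (stp Lb' u) => [t|].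
    by have := stp_tri (stp_inv E3) E; rewrite E1.
  by rewrite eq_sym; case: (eqVneq u v) => // uv; move: E1; rewrite -uv E.
case E': (stp Lb' u) => [t|].
  have /= E2 := stp_inv E'; rewrite !(encode_in E E') !(encode_out E2) eqxx /= E2.
  rewrite (not_out_in stp_inv stp_tri E E') /=.
  by case: (eqVneq t u) => // tu; move: E2; rewrite tu E.
by rewrite !(encode_none E E') eqxx E.
Qed.

Variable r : V.
Hypothesis compa : forall u, u != r -> stp La u != None.
Hypothesis compb : forall u, u != r -> (stp Lb u != None) || (stp Lb' u != None).

Definition flaga := stp La r == None.
Definition flagb := (stp Lb r == None) && (stp Lb' r == None).

(** The set of origins orients the isolated edges, and the flags tell genuine loops at the root from
    missing edges, so the code determines the graph. *)
Lemma decode_encode : stp =2 gdecode (gencode stp) flaga flagb r.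
Proof.
have hb u : stp Lb u = gdecode (gencode stp) flaga flagb r Lb u.
  rewrite /gdecode /oute; case E: (stp Lb u) => [v|].
    rewrite (encode_out E); case: (eqVneq v u) => [vu|vu] /=.
      by case: eqP => [ur|]; rewrite ?andbF // /flagb -ur E.
    rewrite !inE E /=; case E': (stp Lb' u) => [t|//] /=.
    rewrite (encode_out (stp_tri (stp_inv E') E)).
    case: (eqVneq t u) => // tu; move: (stp_inv E'); rewrite tu /= E => -[vu'].
    by rewrite vu' eqxx in vu.
  case E': (stp Lb' u) => [t|].
    have /= E2 := stp_inv E'; rewrite (encode_in E E') (encode_out E2) eqxx !inE E.
    by case: (eqVneq t u) => //= tu; move: E2; rewrite tu E.
  rewrite !(encode_none E E') eqxx !inE E /=.
  case: (eqVneq u r) => [ur|ur]; first by rewrite /flagb -ur E E'.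
  by have := compb ur; rewrite E E'.
case=> u; [|exact: hb|].
  rewrite /gdecode; case: (eqVneq u r) => [->|ur].
    by rewrite andbT /flaga encode_a /stepa; case: (stp La r).
  by rewrite andbF encode_a /stepa; have := compa ur; case: (stp La u).
pose v := ((gencode stp).2.1^-1)%g u.
have vu : (gencode stp).2.1 v = u by rewrite /v permKV.
have hv : stp Lb v = if oute (gencode stp) flagb r v then Some ((gencode stp).2.1 v) else None.
  exact: hb.
rewrite vu in hv; rewrite -[RHS]/(if oute (gencode stp) flagb r v then Some v else None).
case E: (stp Lb' u) => [t|].
  have /= E1 := stp_inv E.
  have tv : t = v by apply: (@perm_inj _ (gencode stp).2.1); rewrite vu (encode_out E1).
  by rewrite tv in E1 *; move: hv; rewrite E1; case: oute.
by move: hv; case: oute => // /stp_inv /=; rewrite E.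
Qed.

End Encode.

Section Decode.
Variables (c : gcode) (r : V).
Hypotheses (ca : c.1 \in involutions V) (cb : c.2 \in bstructures V).
Let b := c.2.1.
Let stp := gdecode c false false r.

Let aK : involutive c.1. Proof. exact/involutionsP. Qed.
Let bP := bstructuresP _ cb.

Lemma outeE u : oute c false r u = [|| b u == u, u \in c.2.2 | b (b u) != u].
Proof. by rewrite /oute andbT. Qed.

Lemma noute u : ~~ oute c false r u -> [/\ b u != u, b (b u) = u & oute c false r (b u)].
Proof.
rewrite !outeE !negb_or negbK => /and3P[bu uD /eqP bbu].
split=> //; have := bP u; rewrite -/b bbu eqxx (negPf uD) bu add0n.
by case: (b u \in c.2.2) => // _; rewrite orbT.
Qed.

Lemma decode_inv l u v : stp l u = Some v -> stp (letter_inv l) v = Some u.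
Proof.
case: l => /=.
- by move=> [<-]; rewrite aK.
- by case: ifP => // o [<-]; rewrite permK o.
- by case: ifP => // o [<-]; rewrite o permKV.
Qed.

Lemma decode_tri u v w : stp Lb u = Some v -> stp Lb v = Some w -> stp Lb w = Some u.
Proof.
move=> /=; case: ifP => // ou [<-]; case: ifP => // + [<-]; rewrite -/b => ov.
have [bu|bu] := eqVneq (b u) u; first by rewrite !bu ou.
have := bP u; rewrite -/b; case: eqP => [bbu|/eqP bbu].
  move: ou ov; rewrite !outeE !bbu (eq_sym u) (negPf bu) !eqxx !orbF /= => -> ->.
  by [].
move=> /andP[/eqP b3 _]; rewrite b3.
by rewrite outeE b3 (inj_eq (@perm_inj _ b)) (eq_sym u (b u)) bu !orbT.
Qed.

Lemma decode_compa u : stp La u != None. Proof. by []. Qed.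

Lemma decode_compb u : (stp Lb u != None) || (stp Lb' u != None).
Proof.
rewrite /=; case: ifP => //= /negbT /noute[_ bbu o].
by rewrite -[u in (b^-1)%g u]bbu permK o.
Qed.

Lemma decode_stepb u : stepb stp u = b u.
Proof.
rewrite /stepb /=; case E: (oute c false r u) => //=; have [_ bbu o] := noute (negbT E).
by rewrite -[u in (b^-1)%g u]bbu permK o.
Qed.

Lemma encode_decode : gencode stp = c.
Proof.
rewrite [RHS]surjective_pairing [c.2 in RHS]surjective_pairing; congr (_, (_, _)).
- by apply/permP => u; rewrite (encode_a decode_inv).
- by apply/permP => u; rewrite (encode_b decode_inv decode_tri) decode_stepb.
- apply/setP => u; rewrite inE.
  have -> : (stp Lb u != None) = oute c false r u by rewrite /=; case: oute.
  have -> : (stp Lb' u == None) = ~~ oute c false r (b^-1 u)%g.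
    by rewrite -[b]/c.2.1 /=; case: oute.
  have := bP u; rewrite -/b !outeE; have [bu|bu] := eqVneq (b u) u.
    have -> : (b^-1 u)%g = u by rewrite -{1}bu permK.
    by rewrite !bu eqxx; case: (u \in c.2.2).
  have [bbu|bbu] := eqVneq (b (b u)) u.
    have -> : (b^-1 u)%g = b u by rewrite -{1}bbu permK.
    rewrite !bbu (eq_sym u) (negPf bu) !eqxx /= !orbF.
    by case: (u \in c.2.2); case: (b u \in c.2.2).
  move=> /andP[/eqP b3 /negPf ->].
  have -> : (b^-1 u)%g = b (b u) by rewrite -{1}b3 permK.
  by rewrite b3 (inj_eq (@perm_inj _ b)) (eq_sym u (b u)) bu !orbT andbF.
Qed.

(** The vertices reached by paths form a set stable under both permutations, because a permutation
    step follows an edge in one of its directions. *)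
Lemma decode_conn : conn_from r c.1 c.2.1 -> forall u, exists p, run stp r p = Some u.
Proof.
move=> /forallP cn; pose U := [set u | `[< exists p, run stp r p = Some u >]]%SET.
suff h : U = [set: V]%SET.
  move=> u; have : u \in U by rewrite h inE.
  by rewrite inE => /asboolP.
have ext l u v : stp l u = Some v -> u \in U -> v \in U.
  move=> E uU; have /asboolP[p ru] : `[< exists p, run stp r p = Some u >] by move: uU; rewrite inE.
  rewrite inE; apply/asboolP; exists (p ++ [:: l]).
  by apply/run_cat; exists u => //=; rewrite -/stp E.
apply/eqP; have /implyP := cn U; apply; apply/and3P; split.
- by rewrite inE; apply/asboolP; exists [::].
- by apply/stableP => v; apply/idP/idP; apply: (ext La); rewrite /= ?aK.
- apply/stableP => v; have E := lab_step decode_compa decode_compb Lb v.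
  have /= E2 : tstep stp Lb v = b v by exact: decode_stepb.
  rewrite [tstep _ _ _]E2 in E; apply/idP/idP; last exact: ext E.
  exact: ext (decode_inv E).
Qed.

End Decode.
End Codes.

(** * Cycles labeled by powers of ba and almost malnormality *)

Section Counting.
Local Open Scope classical_set_scope.
Local Open Scope group_scope.

Section Malnormal.
Variables (V : finType) (stp : letter -> V -> option V) (r : V).
Hypothesis stp_inv : forall l u v, stp l u = Some v -> stp (letter_inv l) v = Some u.
Hypothesis stp_tri : forall u v w, stp Lb u = Some v -> stp Lb v = Some w ->
  stp Lb w = Some u.
Hypothesis compa : forall u, stp La u != None.
Hypothesis compb : forall u, (stp Lb u != None) || (stp Lb' u != None).
Hypothesis conn : forall u, exists p, run stp r p = Some u.

Let a := (gencode stp).1.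
Let b := (gencode stp).2.1.
Let ba : word := [:: Lb; La].

Lemma run_triangle v : tri b v -> run stp v ba = Some (ab b a v).
Proof.
move=> /andP[/eqP b3 b1] /=.
have -> : stp Lb v = Some (b v).
  case E: (stp Lb v) => [w|]; first by rewrite /b (encode_out stp_inv stp_tri E).
  have := compb v; rewrite E; case E': (stp Lb' v) => [t|//] _.
  have bv : b v = t by rewrite /b (encode_in stp_inv stp_tri E E').
  have bt : b t = v by rewrite /b (encode_out stp_inv stp_tri (stp_inv E')).
  by move: b3 b1; rewrite bv bt bv => ->; rewrite eqxx.
have := compa (b v); rewrite /ab /a (encode_a stp_inv) /stepa.
by case: (stp La (b v)).
Qed.

Lemma of_word_nseq w k : of_word (flatten (nseq k w)) = of_word w ^+ k.
Proof.
by elim: k => [//|k IH] /=; rewrite of_word_cat IH expgS.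
Qed.

Lemma nf_nseq k : nf (flatten (nseq k ba)) = flatten (nseq k ba).
Proof. by apply: nf_id; exact: normal_nseq. Qed.

(* A loop [(ba)^i] based at a vertex which [ba] moves: a conjugate of a power of
   [ba] lies in [H] and in a conjugate of [H], by an element which is not in [H]. *)
Lemma malnormal_acyc N : almost_malnormal (grp stp r) -> a \in acyc b N.
Proof.
move=> mal; apply/acycP; split; first exact: encode_involution.
move=> i y i1 _; apply/negP => /and3P[/eqP iy ny ty].
have [p ry] := conn y.
set H := grp stp r; have sH : subgroup H by exact: grp_subgroup.
set x := of_word p * of_word ba * (of_word p)^-1.
have xk k : x ^+ k = of_word p * of_word ba ^+ k * (of_word p)^-1.
  elim: k => [|k IH]; first by rewrite !expg0 mulg1 mulgV.
  by rewrite expgS IH /x expgS !mulgA mulgKV.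
have runk k : (k <= i)%N -> run stp y (flatten (nseq k ba)) = Some (iter k (ab b a) y).
  elim: k => [//|k IH] ki.
  have -> : flatten (nseq k.+1 ba) = flatten (nseq k ba) ++ ba.
    by rewrite -[in LHS]addn1 nseqD flatten_cat.
  apply/run_cat; exists (iter k (ab b a) y); first by rewrite IH // ltnW.
  by rewrite run_triangle //; exact: (forallP ty (Ordinal ki)).
have runm m : run stp y (flatten (nseq (m * i) ba)) = Some y.
  elim: m => [//|m IH]; rewrite mulSn nseqD flatten_cat; apply/run_cat; exists y => //.
  by rewrite runk // iy.
have Hx m : H (x ^+ (m * i)).
  rewrite xk -of_word_nseq -of_word_inv -!of_word_cat.
  exists ((p ++ flatten (nseq (m * i) ba)) ++ word_inv p) => //.
  apply/run_cat; exists y; last exact: run_inv.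
  by apply/run_cat; exists y.
(* If [x] were in [H], the paths [p ++ ba] and [p] would end at the same vertex, but ba moves
   [y]. *)
have nHx : ~ H x.
  rewrite /x -of_word_cat => /(coset_eq _ _ sH).
  have r1 : run stp r (p ++ ba) = Some (iter 1%N (ab b a) y).
    by apply/run_cat; exists y => //; have := runk 1%N (ltnW i1); rewrite /= => ->.
  move=> /(grp_coset_eq stp_inv stp_tri r1 ry) E.
  by have := forallP ny (Ordinal i1); rewrite /= -[ab b a y]/(iter 1%N (ab b a) y) E eqxx.
have := mal x nHx.
pose z (m : nat) := x ^+ (m * i).
(* The powers of ba are normal words of different lengths, so [x] has infinite order. *)
have zinj : injective z.
  move=> m m'; rewrite /z !xk => /mulIg/mulgI; rewrite -!of_word_nseq.
  move=> /of_word_inj_nf; rewrite !nf_nseq => /(congr1 size).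
  by rewrite !size_flatten /shape !map_nseq !sumn_nseq /= => /eqP; rewrite !eqn_pmul2l // eqn_pmul2r 1?ltnW // => /eqP.
have sub : range z `<=` H `&` conj_set H x.
  move=> _ [m _ <-]; split; first exact: Hx.
  exists (z m) => //; first exact: Hx.
  by rewrite /z conjgE -expgSr expgS mulKg.
move=> /(sub_finite_set sub).
rewrite (eq_finite_set (inj_card_eq (in2W zinj))).
exact: infinite_nat.
Qed.

End Malnormal.

(* The subgraph of the Schreier graph induced on the image of [iota]. *)
Definition induced (V : finType) (iota : V -> set psl2z) (l : letter) (u : V) : option V :=
  [pick v | `[< iota v = coset (iota u) (of_word [:: l]) >]].

(** * Stallings graphs as partial labeled graphs *)

Section Induced.
Variables (V : finType) (iota : V -> set psl2z) (H : set psl2z) (r : V).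
Hypotheses (sH : subgroup H) (inj : injective iota) (rng : range iota = visited H)
  (root_r : iota r = H).
Let stp := induced iota.

Lemma inducedP l u v : stp l u = Some v <-> iota v = coset (iota u) (of_word [:: l]).
Proof.
rewrite /stp /induced; split.
  by case: pickP => // w /asboolP E [<-].
move=> E; case: pickP => [w /asboolP E'|/(_ v)].
  by congr Some; apply: inj; rewrite E.
by move/asboolP.
Qed.

Lemma induced_inv l u v : stp l u = Some v -> stp (letter_inv l) v = Some u.
Proof. by move/inducedP => E; apply/inducedP; rewrite E cosetM mul_linv coset1. Qed.

Lemma induced_tri u v w : stp Lb u = Some v -> stp Lb v = Some w -> stp Lb w = Some u.
Proof.
move=> /inducedP E /inducedP E'; apply/inducedP.
by rewrite E' E !cosetM mul_bb mul_bb' coset1.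
Qed.

Lemma induced_vis l u : visited H (coset (iota u) (of_word [:: l])) -> stp l u != None.
Proof. by rewrite -rng => -[v _ /inducedP E]; rewrite E. Qed.

Lemma induced_neq u : u != r -> iota u <> H.
Proof. by move=> /eqP ur; rewrite -root_r => /inj. Qed.

Lemma visited_iota u : visited H (iota u). Proof. by rewrite -rng; exists u. Qed.

Lemma induced_compa u : u != r -> stp La u != None.
Proof.
move=> /induced_neq ur; apply: induced_vis.
by have [] := visited_next sH (visited_iota u) ur.
Qed.

Lemma induced_compb u : u != r -> (stp Lb u != None) || (stp Lb' u != None).
Proof.
move=> /induced_neq ur; have [_ [h|h]] := visited_next sH (visited_iota u) ur.
  by rewrite induced_vis.
by rewrite orbC induced_vis.
Qed.

Lemma run_induced w u : run stp r w = Some u -> iota u = coset H (of_word w).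
Proof.
rewrite -root_r; move: {1 2}r => s; elim: w s => [|l w IH] s /=.
  by move=> [->]; exact/esym/coset1.
case E: (stp l s) => [v|//] /IH ->.
by move/inducedP: E => ->; rewrite cosetM -of_word_cons.
Qed.

(** Every prefix of a normal word of [H] ends at a visited coset, so its path stays in the induced
    graph. *)
Lemma run_induced_normal w1 w2 : normal_word (w1 ++ w2) -> H (of_word (w1 ++ w2)) ->
  exists u, run stp r w1 = Some u.
Proof.
elim/last_ind: w1 w2 => [|w1 l IH] w2 nw Hw; first by exists r.
have [u ru] : exists u, run stp r w1 = Some u by apply: (IH (l :: w2)); rewrite -cat_rcons.
have : visited H (coset H (of_word (rcons w1 l))).
  by apply/visitedP => //; exists (rcons w1 l), w2.
rewrite -rng => -[v _ E]; exists v; rewrite -cats1; apply/run_cat; exists u => //=.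
suff -> : stp l u = Some v by [].
by apply/inducedP; rewrite E (run_induced ru) cosetM -of_word_cat cats1.
Qed.

Lemma grp_induced : grp stp r = H.
Proof.
apply/seteqP; split=> [x [w <- /run_induced]|x Hx].
  by rewrite root_r => E; apply: (coset_eq_id sH); rewrite -E.
have nw := nf_normal (generic_quotient.repr x); have xE : of_word (nf (generic_quotient.repr x)) = x.
  by rewrite of_word_nf of_word_repr.
exists (nf (generic_quotient.repr x)) => //.
have [||u ru] := @run_induced_normal (nf (generic_quotient.repr x)) [::].
- by rewrite cats0.
- by rewrite cats0 xE.
rewrite ru; congr Some; apply: inj; rewrite root_r (run_induced ru) xE.
exact: coset_id.
Qed.

Lemma conn_induced u : exists p, run stp r p = Some u.
Proof.
have /visitedP-/(_ sH)[w1 [w2 [nw Hw E]]] := visited_iota u.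
have [v rv] := run_induced_normal nw Hw; exists w1; rewrite rv; congr Some.
by apply: inj; rewrite E (run_induced rv).
Qed.

End Induced.

(** * Subgroups with labeled vertices against codes *)

Section Count.
Variable n : nat.
Let V : finType := 'I_n.+1.
Let r : V := ord0.
Let Sub := subgroups_of_size n.+1.

Definition labeling_of (H : set psl2z) (f : V -> set psl2z) : Prop :=
  [/\ injective f, range f = visited H & f r = H].

Definition labeling (H : set psl2z) : V -> set psl2z :=
  if pselect (exists f, labeling_of H f) is left h then projT1 (cid h) else fun _ => set0.

Lemma labelingP H : Sub H -> labeling_of H (labeling H).
Proof.
move=> [sH _ card]; suff [f hf] : exists f, labeling_of H f.
  by rewrite /labeling; case: pselect => [h|[]]; [exact: (projT2 (cid h))|exists f].
have /card_set_bijP[f [fsub finj fsurj]] : ([set: V] #= visited H)%card.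
  by rewrite card_eq_sym; apply: card_eq_trans card card_II.
have fi : injective f by move=> u v E; apply: finj; rewrite ?inE.
have [u0 _ fu0] : (f @` [set: V]) H by apply: fsurj; exact: visited_id.
(* The transposition moves the root to the vertex [r]. *)
exists (f \o tperm r u0); split.
- by apply: inj_comp => //; exact: perm_inj.
- apply/seteqP; split=> [_ [u _ <-]|K /fsurj[u _ <-]]; first exact: fsub.
  by exists (tperm r u0 u) => //=; rewrite tpermK.
- by rewrite /= tpermL.
Qed.

(** The root is always the vertex [r], so these permutations give the labelings of a subgroup from a
    chosen one. *)
Definition fixing : {set {perm V}} := [set s : {perm V} | s r == r]%SET.

Lemma fixing_gt0 : (0 < #|fixing|)%N.
Proof. by rewrite card_gt0; apply/set0Pn; exists 1; rewrite inE perm1. Qed.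

Definition relabeling (p : set psl2z * {perm V}) : V -> set psl2z := labeling p.1 \o p.2.

Lemma relabelingP p : Sub p.1 -> p.2 \in fixing -> labeling_of p.1 (relabeling p).
Proof.
move=> /labelingP[li lr l0]; rewrite inE => /eqP pr; split.
- by apply: inj_comp => //; exact: perm_inj.
- rewrite -lr; apply/seteqP; split=> [_ [u _ <-]|_ [u _ <-]]; first by exists (p.2 u).
  by exists (p.2^-1 u) => //; rewrite /relabeling /= permKV.
- by rewrite /relabeling /= pr.
Qed.

Definition encoding (p : set psl2z * {perm V}) : (gcode V * bool * bool)%type :=
  let stp := induced (relabeling p) in (gencode stp, flaga stp r, flagb stp r).

(** Code and flags determine the graph, hence the subgroup and, along paths from the root, the coset
    at each vertex; this gives the permutation too. *)
Lemma encoding_inj p q : Sub p.1 -> p.2 \in fixing -> Sub q.1 -> q.2 \in fixing ->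
  encoding p = encoding q -> p = q.
Proof.
move=> Sp fp Sq fq; rewrite /encoding.
have [i1 r1 v1] := relabelingP Sp fp; have [i2 r2 v2] := relabelingP Sq fq.
have [s1 _ _] := Sp; have [s2 _ _] := Sq.
have D1 := decode_encode (induced_inv i1) (induced_tri i1) (induced_compa s1 i1 r1 v1)
  (induced_compb s1 i1 r1 v1).
have D2 := decode_encode (induced_inv i2) (induced_tri i2) (induced_compa s2 i2 r2 v2)
  (induced_compb s2 i2 r2 v2).
move=> [E1 E2 E3 E4 E5].
have E : induced (relabeling p) = induced (relabeling q).
  apply/funext => l; apply/funext => u; rewrite D1 D2 E4 E5; congr (gdecode _ _ _ _ _ _).
  by rewrite /gencode E1 E2 E3.
have EH : p.1 = q.1 by rewrite -(grp_induced s1 i1 r1 v1) E (grp_induced s2 i2 r2 v2).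
have El u : relabeling p u = relabeling q u.
  have [w rw] := conn_induced s1 i1 r1 v1 u.
  by rewrite (run_induced i1 v1 rw) EH; apply/esym/(run_induced i2 v2); rewrite -E.
case: p q EH El {D1 D2 E1 E2 E3 E4 E5 E i1 r1 v1 i2 r2 v2 s1 s2 Sq fp fq} Sp => [H s] [H' s'] /=.
move=> <- El /labelingP[li _ _]; congr (_, _); apply/permP => u; exact: li (El u).
Qed.

(** A flag forces a loop of the code at the root; without flags the graph is complete and
    [malnormal_acyc] applies. *)
Lemma encoding_valid p : Sub p.1 -> p.2 \in fixing ->
  let c := (encoding p).1.1 in
  [/\ c.1 \in involutions V, c.2 \in bstructures V,
      (encoding p).1.2 -> c.1 r == r, (encoding p).2 -> c.2.1 r == r &
      ~~ (encoding p).1.2 -> ~~ (encoding p).2 -> almost_malnormal p.1 ->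
        forall N, c.1 \in acyc c.2.1 N].
Proof.
move=> Sp fp; have [i1 r1 v1] := relabelingP Sp fp; have [s1 _ _] := Sp.
have inv := induced_inv i1; have tri := induced_tri i1.
split; rewrite /encoding /=.
- exact: encode_involution.
- exact: encode_bstructure.
- by rewrite /flaga encode_a // /stepa => /eqP ->.
- by rewrite /flagb encode_b // /stepb => /andP[/eqP -> /eqP ->].
move=> fa fb mal N.
apply: (@malnormal_acyc _ _ r inv tri) => [u|u|u|].
- have [->|] := eqVneq u r; first exact: fa.
  exact: (induced_compa s1 i1 r1 v1).
- have [->|] := eqVneq u r; last exact: (induced_compb s1 i1 r1 v1).
  by move: fb; rewrite /flagb negb_and.
- exact: (conn_induced s1 i1 r1 v1).
- by rewrite (grp_induced s1 i1 r1 v1).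
Qed.

Definition conn_codes : {set gcode V} := [set c : gcode V |
  [&& c.1 \in involutions V, c.2 \in bstructures V & conn_from r c.1 c.2.1]]%SET.

Definition graph_of (c : gcode V) := gdecode c false false r.

(** The permutation compares the chosen labeling of the subgroup with the labeling of its cosets by
    the vertices of the code. *)
Definition decoding (c : gcode V) : set psl2z * {perm V} :=
  let H := grp (graph_of c) r in
  (H, permf (fun u => odflt r [pick v | `[< labeling H v = vcoset (graph_of c) r u >]])).

Lemma decodingP c : c \in conn_codes ->
  [/\ Sub (decoding c).1, (decoding c).2 \in fixing &
      forall u, relabeling (decoding c) u = vcoset (graph_of c) r u].
Proof.
rewrite inE => /and3P[ca cb cc]; set stp := graph_of c.
have inv := decode_inv ca : forall l u v, stp l u = Some v -> _.
have tri := decode_tri cb : forall u v w, stp Lb u = Some v -> _ -> stp Lb w = Some u.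
have ca' := @decode_compa _ c r : forall u, stp La u != None.
have cb' := decode_compb r cb : forall u, (stp Lb u != None) || (stp Lb' u != None).
have cn := decode_conn ca cb cc : forall u, exists p, run stp r p = Some u.
have vi := vcoset_inj inv tri cn.
have vis := visited_grp inv tri ca' cb' cn.
have SH : Sub (grp stp r).
  split; [exact: grp_subgroup|exact: fg_grp|].
  rewrite /= vis; apply: card_eq_trans (inj_card_eq (in2W vi)) _.
  by rewrite card_eq_sym; exact: card_II.
have [li lr l0] := labelingP SH.
pose f u := odflt r [pick v | `[< labeling (grp stp r) v = vcoset stp r u >]].
have fE u : labeling (grp stp r) (f u) = vcoset stp r u.
  rewrite /f; case: pickP => [v /asboolP //|h].
  have : range (labeling (grp stp r)) (vcoset stp r u) by rewrite lr vis; exists u.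
  by move=> [v _ E]; have /asboolP[] := h v.
have fi : injective f by move=> u v E; apply: vi; rewrite -!fE E.
rewrite /decoding /=; split=> //.
  rewrite inE (permfE fi); apply/eqP/li.
  by rewrite fE vcoset_root l0.
by move=> u; rewrite /relabeling /= (permfE fi) fE.
Qed.

(** Equal labelings by cosets have the same edges by [vcoset_stepE], hence come from the same
    code. *)
Lemma decoding_inj : {in conn_codes &, injective decoding}.
Proof.
move=> c d cc dc E.
have [_ _ hc] := decodingP cc; have [_ _ hd] := decodingP dc.
have Ev u : vcoset (graph_of c) r u = vcoset (graph_of d) r u by rewrite -hc -hd E.
move: cc; rewrite inE => /and3P[ca cb cc]; move: dc; rewrite inE => /and3P[da db dc].
rewrite -(encode_decode r ca cb) -(encode_decode r da db); congr gencode.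
apply/funext => l; apply/funext => u.
have P1 := vcoset_stepE (decode_inv ca) (decode_tri cb) (@decode_compa _ c r)
  (decode_compb r cb) (decode_conn ca cb cc).
have P2 := vcoset_stepE (decode_inv da) (decode_tri db) (@decode_compa _ d r)
  (decode_compb r db) (decode_conn da db dc).
have iff v : gdecode c false false r l u = Some v <-> gdecode d false false r l u = Some v.
  by rewrite P1 P2 !Ev.
case E1: (gdecode c _ _ _ _ _) => [v|].
  by apply/esym/iff.
by case E2: (gdecode d _ _ _ _ _) => [v|//]; rewrite -E1; apply/iff.
Qed.

Hypothesis finS : finite_set Sub.

Definition bad_codes N : {set gcode V} := [set c : gcode V |
  [&& c.1 \in involutions V, c.2 \in bstructures V & c.1 \in acyc c.2.1 N]]%SET.
Definition fixa_codes : {set gcode V} := [set c : gcode V |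
  [&& c.1 \in involutions V, c.2 \in bstructures V & c.1 r == r]]%SET.
Definition fixb_codes : {set gcode V} := [set c : gcode V |
  [&& c.1 \in involutions V, c.2 \in bstructures V & c.2.1 r == r]]%SET.

Lemma card_conn_codes : (#|conn_codes| <= #|` fset_set Sub| * #|fixing|)%N.
Proof.
rewrite cardE -(size_map decoding) [X in (_ * X)%N]cardE.
rewrite -(size_allpairs pair (fset_set Sub : seq _) (enum fixing)).
apply: uniq_leq_size.
  rewrite map_inj_in_uniq ?enum_uniq // => c d; rewrite !mem_enum; exact: decoding_inj.
move=> _ /mapP[c + ->]; rewrite mem_enum => /decodingP[S1 S2 _].
apply/allpairsP; exists (decoding c); rewrite mem_enum; split=> //.
  by rewrite in_fset_set // inE.
Qed.

(** An encoding without flags is acyclic; one with a flag has a loop at the root, and the factors 2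
    count the values of the other flag. *)
Lemma card_malnormal_codes N :
  (#|` fset_set (Sub `&` @almost_malnormal psl2z)| * #|fixing| <=
    #|bad_codes N| + 2 * #|fixa_codes| + 2 * #|fixb_codes|)%N.
Proof.
have finM : finite_set (Sub `&` @almost_malnormal psl2z) by exact: finite_setIl.
rewrite [X in (_ * X)%N]cardE.
pose M : seq (set psl2z) := fset_set (Sub `&` @almost_malnormal psl2z).
have MP H : H \in M -> Sub H /\ almost_malnormal H.
  by rewrite /M in_fset_set // inE.
rewrite -[X in (X * _)%N]/(size M) -(size_allpairs pair M (enum fixing)) -(size_map encoding).
pose T : seq (gcode V * bool * bool)%type :=
  [seq (c, false, false) | c <- enum (bad_codes N)] ++
  ([seq (c, true, fb) | c <- enum fixa_codes, fb <- [:: false; true]] ++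
  [seq (c, fa, true) | c <- enum fixb_codes, fa <- [:: false; true]]).
have sT : size T = (#|bad_codes N| + 2 * #|fixa_codes| + 2 * #|fixb_codes|)%N.
  by rewrite !size_cat size_map !size_allpairs -!cardE /=; lia.
rewrite -sT; apply: uniq_leq_size.
  rewrite map_inj_in_uniq.
    apply: allpairs_uniq; [exact: fset_uniq|exact: enum_uniq|by move=> [? ?] [? ?]].
  move=> p q /allpairsP[p' [/MP[p1 _] + ->]] /allpairsP[q' [/MP[q1 _] + ->]].
  by rewrite !mem_enum => p2 q2; apply: encoding_inj.
move=> _ /mapP[p /allpairsP[[H s] [/MP[/= SH mH] + ->]] ->]; rewrite mem_enum => fs.
have := @encoding_valid (H, s) SH fs; move: (encoding (H, s)) => [[c fa] fb] /= [ca cb ha hb hm].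
rewrite !mem_cat; case: fa ha hm => ha hm.
  apply/orP; right; apply/orP; left; apply/allpairsP; exists (c, fb).
  by split=> //; [rewrite mem_enum finset.in_set ca cb ha|case: (fb)].
case: fb hb hm => hb hm.
  apply/orP; right; apply/orP; right; apply/allpairsP; exists (c, false).
  by split=> //; rewrite mem_enum finset.in_set ca cb hb.
apply/orP; left; apply/mapP; exists c => //.
by rewrite mem_enum finset.in_set ca cb hm.
Qed.

End Count.

End Counting.

(** * Asymptotics *)

Local Open Scope classical_set_scope.
Local Open Scope ring_scope.

Lemma floor_nat (R : realType) (x : R) : 1 <= x ->
  exists s : nat, [/\ (0 < s)%N, s%:R <= x & x < s.+1%:R].
Proof.
move=> x1; exists (Num.truncn x).
have /andP[h1 h2] := truncn_itv (le_trans ler01 x1).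
split=> //; rewrite lt0n; apply/negP => /eqP h; move: h2; rewrite h; lra.
Qed.

(** * Means and proportions over all codes *)

Section Averages.
Variables (R : realType) (V : finType).
Hypothesis V0 : (0 < #|V|)%N.
Let w : R := rt6 #|V|%:R.
Let I := #|involutions V|.
Let B := #|bstructures V|.

Let w1 : 1 <= w. Proof. by rewrite rt6_ge1 // ler1n. Qed.
Let w0 : 0 < w. Proof. exact: lt_le_trans ltr01 w1. Qed.
Let w6 : w ^+ 6 = #|V|%:R. Proof. exact: rt6K. Qed.
Let wk1 k : 1 <= w ^+ k. Proof. exact: exprn_ege1. Qed.

(** With [s] the integer part of n^(1/2), s (s + 1) + n <= 2 s^2 + 4 s^2. *)
Lemma mean_fix : (\sum_(a in involutions V) fixn a)%:R <= 6 * w ^+ 3 * I%:R.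
Proof.
have [s [s0 sw ws]] := floor_nat (wk1 3).
have := sum_fix V s; set S := (\sum_(a in _) _)%N => h.
have nS : (#|V| <= 4 * s ^ 2)%N.
  rewrite -(ler_nat R) natrM natrX -w6 (_ : w ^+ 6 = (w ^+ 3) ^+ 2); last by rewrite -exprM.
  have s1 : 1 <= s%:R :> R by rewrite ler1n.
  have : w ^+ 3 <= 2 * s%:R by move: ws; rewrite -natr1; lra.
  have : 0 <= w ^+ 3 by exact: le_trans ler01 (wk1 3).
  by nra.
have hS : (S <= 6 * s * I)%N.
  rewrite -(leq_pmul2l s0); apply: (leq_trans h); rewrite [leqRHS]mulnA leq_mul2r; apply/orP; right.
  by rewrite -!mulnn in nS *; nia.
apply: (@le_trans _ _ ((6 * s * I)%N%:R)); first by rewrite ler_nat.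
by rewrite !natrM ler_wpM2r // ler_pM2l.
Qed.

Let cube : exists s : nat, [/\ (0 < s)%N, s%:R <= w ^+ 2 & (#|V| <= 8 * s ^ 3)%N].
Proof.
have [s [s0 sw ws]] := floor_nat (wk1 2); exists s; split=> //.
rewrite -(ler_nat R) natrM natrX -w6 (_ : w ^+ 6 = (w ^+ 2) ^+ 3); last by rewrite -exprM.
have s1 : 1 <= s%:R :> R by rewrite ler1n.
have -> : 8 * s%:R ^+ 3 = (2 * s%:R) ^+ 3 :> R by ring.
rewrite lerXn2r // ?nnegrE ?mulr_ge0 // ?exprn_ge0 ?(ltW w0) //.
by move: ws; rewrite -natr1; lra.
Qed.

(** With [s] the integer part of n^(1/3), s^2 (s + 2) + n <= 3 s^3 + 8 s^3. *)
Lemma mean_loops : (\sum_(x in bstructures V) #|loops x|)%:R <= 11 * w ^+ 2 * B%:R.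
Proof.
have [s [s0 sw nS]] := cube.
have := sum_loops V s; set S := (\sum_(x in _) _)%N => h.
have hS : (S <= 11 * s * B)%N.
  have s20 : (0 < s ^ 2)%N by rewrite expn_gt0 s0.
  rewrite -(leq_pmul2l s20); apply: (leq_trans h); rewrite [leqRHS]mulnA leq_mul2r; apply/orP; right.
  rewrite expnS in nS; set t := (s ^ 2)%N in nS *; nia.
apply: (@le_trans _ _ ((11 * s * B)%N%:R)); first by rewrite ler_nat.
by rewrite !natrM ler_wpM2r // ler_pM2l.
Qed.

(** With the same [s], s (s + 2) (s + 1) + n <= 6 s^3 + 8 s^3. *)
Lemma mean_edges : (\sum_(x in bstructures V) #|x.2|)%:R <= 14 * w ^+ 4 * B%:R.
Proof.
have [s [s0 sw nS]] := cube.
have := sum_edges_bound V s; set S := (\sum_(x in _) _)%N => h.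
have hS : (S <= 14 * s ^ 2 * B)%N.
  rewrite -(leq_pmul2l s0); apply: (leq_trans h); rewrite [leqRHS]mulnA leq_mul2r; apply/orP; right.
  have E : (s.+2 * s.+1 <= 6 * s ^ 2)%N by rewrite -mulnn; nia.
  apply: (leq_trans (leq_add (leq_mul (leqnn s) E) nS)).
  by rewrite expnS; set t := (s ^ 2)%N; nia.
apply: (@le_trans _ _ ((14 * s ^ 2 * B)%N%:R)); first by rewrite ler_nat.
rewrite 2!natrM natrX ler_wpM2r // ler_pM2l // (_ : w ^+ 4 = (w ^+ 2) ^+ 2); last by rewrite -exprM.
by rewrite lerXn2r // nnegrE // exprn_ge0 // ltW.
Qed.

(** Markov's inequality. *)
Lemma markov_card (T : finType) (A : {set T}) (F : T -> nat) (c m : R) : 0 < c -> 0 < m ->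
  (\sum_(x in A) F x)%:R <= m * #|A|%:R ->
  #|[set x in A | c * m < (F x)%:R]%SET|%:R * c <= #|A|%:R.
Proof.
move=> c0 m0 h; rewrite -(ler_pM2r m0) [leRHS]mulrC; apply: le_trans h.
rewrite -mulrA mulr_natl natr_sum -sumr_const.
rewrite [leRHS](bigID (fun x => c * m < (F x)%:R)) /=.
apply: ler_wpDr; first by apply: sumr_ge0.
rewrite [leLHS](eq_bigl (fun x => (x \in A) && (c * m < (F x)%:R))); last by move=> x; rewrite inE.
by apply: ler_sum => x /andP[_ /ltW].
Qed.

Lemma many_typical : (I * B)%:R <= 2 * #|[set p : {perm V} * ({perm V} * {set V}) |
  [&& p.1 \in involutions V, p.2 \in bstructures V & typical (1000%:R : R) p.1 p.2]]%SET|%:R :> R.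
Proof.
set T := [set p | _]%SET.
(* Each of the three statistics exceeds 40 times its mean bound in a proportion at most 1/40, which
   leaves more than half of the pairs; the largest threshold constant, 40 * 14, is below 1000. *)
have c0 : 0 < 40 :> R by [].
have m1 : 0 < 6 * w ^+ 3 by rewrite mulr_gt0 // exprn_gt0.
have m2 : 0 < 11 * w ^+ 2 by rewrite mulr_gt0 // exprn_gt0.
have m3 : 0 < 14 * w ^+ 4 by rewrite mulr_gt0 // exprn_gt0.
have h1 := markov_card c0 m1 mean_fix; have h2 := markov_card c0 m2 mean_loops.
have h3 := markov_card c0 m3 mean_edges.
move: h1 h2 h3; set U1 := [set _ in _ | _]%SET; set U2 := [set _ in _ | _]%SET.
set U3 := [set _ in _ | _]%SET => h1 h2 h3.
have cov : finset.setX (involutions V) (bstructures V) \subset T :|: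
    (finset.setX U1 (bstructures V) :|:
     (finset.setX (involutions V) U2 :|: finset.setX (involutions V) U3)).
  apply/fintype.subsetP => -[a x]; rewrite finset.in_setX /= => /andP[ai xB].
  have e0 : ((a, x) \in T) = typical (1000%:R : R) a x by rewrite finset.in_set /= ai xB.
  have e1 : (a \in U1) = (40 * (6 * w ^+ 3) < (fixn a)%:R) by rewrite finset.in_set ai.
  have e2 : (x \in U2) = (40 * (11 * w ^+ 2) < #|loops x|%:R) by rewrite finset.in_set xB.
  have e3 : (x \in U3) = (40 * (14 * w ^+ 4) < #|x.2|%:R) by rewrite finset.in_set xB.
  rewrite !finset.in_setU !finset.in_setX e0 e1 e2 e3 /= ai xB /=.
  have leX (m d : R) k : d <= 40 * (m * w ^+ k) -> 0 <= m -> m <= 14 -> d <= 1000 * w ^+ k.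
    move=> dm m0' m14; apply: le_trans dm _; rewrite mulrA ler_wpM2r ?exprn_ge0 ?(ltW w0) //.
    lra.
  case: ltP => [_|f1] /=; first by rewrite ?orbT.
  case: ltP => [_|f2] /=; first by rewrite ?orbT.
  case: ltP => [_|f3] /=; first by rewrite ?orbT.
  rewrite ?orbF /typical -/w; apply/and3P; split.
  - by apply: leX f1 _ _; lra.
  - by apply: leX f2 _ _; lra.
  - by apply: leX f3 _ _; lra.
have := subset_leq_card cov.
have cU := leq_card_setU.
move=> /leq_trans/(_ (cU _ _ _)) h.
have h' := leq_trans h (leq_add (leqnn _) (cU _ _ _)).
have h'' := leq_trans h' (leq_add (leqnn _) (leq_add (leqnn _) (cU _ _ _))).
move: h''; rewrite !finset.cardsX -(ler_nat R) !natrD !natrM -/I -/B => h4.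
have I0 : 0 <= I%:R :> R by []. have B0 : 0 <= B%:R :> R by [].
have k1 := ler_wpM2r B0 h1.
have k2 := ler_wpM2l I0 h2. have k3 := ler_wpM2l I0 h3.
rewrite -/I -/B in k1 k2 k3.
have := mulr_ge0 I0 B0; lra.
Qed.

(** For each typical pair at least half of the conjugations of [a] give a connected pair, and the
    conjugated pair together with the conjugating permutation determines the original one. This
    factor 2 combines with that of [many_typical]. *)
Lemma codes_connected (v : V) :
  (forall a x, a \in involutions V -> x \in bstructures V -> typical (1000%:R : R) a x ->
    (2 * #|[set s : {perm V} | ~~ conn_from v (a ^ s)%g x.1]%SET| <= (#|V|)`!)%N) ->
  (I * B)%:R <= 4 * #|[set c : {perm V} * ({perm V} * {set V}) | [&& c.1 \in involutions V,
     c.2 \in bstructures V & conn_from v c.1 c.2.1]]%SET|%:R :> R.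
Proof.
move=> hc; apply: le_trans many_typical _; set T := [set p | _]%SET; set C := [set c | _]%SET.
have Sn : #|[set: {perm V}]%SET| = (#|V|)`!.
  rewrite -cardsT -card_perm; apply: eq_card => s; rewrite inE; apply/esym/fintype.subsetP => y _.
  by rewrite inE.
suff : (#|T| * (#|V|)`! <= 2 * (#|C| * (#|V|)`!))%N.
  rewrite mulnA leq_pmul2r ?fact_gt0 // -(ler_nat R) natrM; lra.
rewrite -Sn -finset.cardsX.
apply: (@leq_trans (2 * (\sum_(p in T) #|[set s : {perm V} | conn_from v (p.1 ^ s)%g p.2.1]%SET|))%N).
  rewrite finset.cardsX Sn -sum_nat_const big_distrr /=; apply: leq_sum => -[a x]; rewrite finset.in_set /=.
  move=> /and3P[ai xB tp]; pose P := [set s : {perm V} | conn_from v (a ^ s)%g x.1]%SET.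
  have := hc a x ai xB tp; have := cardsC P.
  rewrite (_ : #|[set s : {perm V} | ~~ conn_from v (a ^ s)%g x.1]%SET| = #|~: P|); last first.
    by apply: eq_card => s; rewrite !inE.
  rewrite -Sn finset.cardsT => E h; rewrite -[leqRHS]/(2 * #|P|)%N.
  by move: #|P| #|~: P| #|{: {perm V}}| E h => p q m E h; lia.
rewrite leq_mul2l /= (card_dep T (fun p s => conn_from v (p.1 ^ s)%g p.2.1)) -finset.cardsX.
apply: (@leq_card_inj _ _ _ _ (fun q : {perm V} * ({perm V} * {set V}) * {perm V} => ((q.1.1 ^ q.2)%g, q.1.2, q.2))).
  by move=> [[a x] s] [[a' x'] s'] _ _ /= [E -> ss]; subst s'; move/conjg_inj: E => ->.
move=> [[a x] s]; rewrite finset.in_set /= => /andP[].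
rewrite finset.in_set /= => /and3P[/involutionsP ai xB _] cn.
rewrite finset.in_setX finset.in_setT andbT finset.in_set /= cn xB !andbT.
apply/involutionsP => u.
by rewrite conjgE !permM permK ai permKV.
Qed.

Let N := Num.truncn w.

(** [acyc_bound] is summed over the b-structures, with [N] the integer part of w = n^(1/6). The main
    term contributes 2 / w and the bad vertices 4 * 153 / w. *)
Lemma codes_acyclic : 2 <= w ->
  #|[set c : {perm V} * ({perm V} * {set V}) | [&& c.1 \in involutions V,
     c.2 \in bstructures V & c.1 \in acyc c.2.1 N]]%SET|%:R <= 614 * (I * B)%:R / w.
Proof.
move=> w2; set C := [set c | _]%SET.
have /andP[Nw wN] := truncn_itv (ltW w0); rewrite -/N in Nw wN.
have N0 : (0 < N)%N.
  by rewrite lt0n; apply/negP => /eqP h; move: wN; rewrite h; lra.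
have pw k : 0 < w ^+ k by exact: exprn_gt0.
have Nn : (8 * N + 2 <= #|V|)%N.
  rewrite -(ler_nat R) natrD natrM -w6.
  have w5 : 32 <= w ^+ 5 by rewrite (_ : 32 = 2 ^+ 5) ?lerXn2r // ?nnegrE //; [exact: ltW|rewrite -natrX].
  have : w * 32 <= w ^+ 6 by rewrite exprS ler_pM2l.
  lra.
set F := (\sum_(a in involutions V) fixn a)%N.
set E := (\sum_(x in bstructures V) ntri x.1)%N.
have hC : (N.+1 * #|V| * #|C| <= 2 * #|V| * I * B +
   N * (4 * ((2 * N).+1 * I * E + 2 * N * F * B + 24 * N ^ 2 * I * B)))%N.
  have -> : #|C| = (\sum_(x in bstructures V) #|acyc x.1 N|)%N.
    rewrite (eq_bigr (fun x => #|[set a : {perm V} | a \in acyc x.1 N]%SET|)); last first.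
      by move=> x _; rewrite [RHS]cardsE.
    rewrite (card_dep (bstructures V) (fun x a => a \in acyc x.1 N)).
    pose sw (p : {perm V} * ({perm V} * {set V})) := (p.2, p.1).
    have swi : injective sw by move=> [? ?] [? ?] [-> ->].
    rewrite -(card_imset _ swi).
    apply: eq_card => -[x a]; rewrite [RHS]finset.in_set /=; apply/imsetP/idP.
      move=> [[a' x']]; rewrite finset.in_set /= => /and3P[_ xB ac] [-> ->].
      by rewrite xB ac.
    move=> /andP[xB ac]; exists (a, x) => //.
    have ai : a \in involutions V by have [] := acycP _ _ _ ac.
    by rewrite finset.in_set /= ai xB ac.
  rewrite big_distrr /=.
  apply: (@leq_trans (\sum_(x in bstructures V) (2 * #|V| * I + N * bad_bound x.1 N))%N).
    by apply: leq_sum => x _; exact: acyc_bound.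
  rewrite big_split /= sum_nat_const [(_ * B)%N]mulnC leq_add2l -big_distrr /= leq_mul2l.
  apply/orP; right; rewrite /bad_bound -big_distrr /= leq_mul2l /= !big_split /= !sum_nat_const.
  rewrite -/B -/I -/F -big_distrl -big_distrr /= -/E; apply: eq_leq; ring.
(* 39 = 11 + 2 * 14, from the means of loops and isolated edges. *)
have hE : E%:R <= 39 * w ^+ 4 * B%:R.
  apply: (@le_trans _ _ ((\sum_(x in bstructures V) #|loops x|)%N%:R +
     2 * (\sum_(x in bstructures V) #|x.2|)%N%:R)).
    rewrite -natrM -natrD ler_nat big_distrr -big_split /=; apply: leq_sum => x.
    exact: ntri_bound.
  have := mean_loops; have := mean_edges.
  have w24 : w ^+ 2 <= w ^+ 4 by rewrite ler_weXn2l.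
  have := ler_wpM2r (ler0n R B) w24.
  move: (w ^+ 2) (w ^+ 4) => x y; lra.
have hF := mean_fix; rewrite -/F in hF.
move: hC; rewrite -(addn1 N) -(addn1 (2 * N)) -(ler_nat R) !(natrD, natrM).
set n : R := #|V|%:R; set i : R := I%:R; set bb : R := B%:R; set c : R := #|C|%:R.
move: hE hF; rewrite -/bb -/i; set e : R := E%:R; set f : R := F%:R => hE hF.
have i0 : 0 <= i by []. have b0 : 0 <= bb by []. have c0 : 0 <= c by [].
have e0 : 0 <= e by []. have f0 : 0 <= f by [].
rewrite -natr1 in wN; set m : R := N%:R in Nw wN *; have m0 : 0 <= m by [].
have nw : n = w ^+ 6 by rewrite w6.
have ib0 : 0 <= i * bb by exact: mulr_ge0.
move=> hC.
have B1 : (2 * m + 1) * i * e <= 117 * w ^+ 5 * (i * bb).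
  have h1 : (2 * m + 1) * i <= 3 * w * i by rewrite ler_wpM2r //; lra.
  apply: le_trans (ler_pM _ e0 h1 hE) _; first by rewrite mulr_ge0 // addr_ge0 // mulr_ge0.
  by rewrite le_eqVlt; apply/orP; left; apply/eqP; ring.
have B2 : 2 * m * f * bb <= 12 * w ^+ 5 * (i * bb).
  apply: (@le_trans _ _ (2 * w * (6 * w ^+ 3 * i) * bb)).
    by rewrite ler_wpM2r // ler_pM // ?mulr_ge0 // ler_pM2l.
  have -> : 2 * w * (6 * w ^+ 3 * i) * bb = 12 * w ^+ 4 * (i * bb) by ring.
  by rewrite ler_wpM2r // ler_pM2l // ler_weXn2l.
have B3 : 24 * (m * m) * i * bb <= 24 * w ^+ 5 * (i * bb).
  rewrite -[leLHS]mulrA ler_wpM2r // ler_pM2l //; apply: (@le_trans _ _ (w ^+ 2)).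
    by rewrite expr2 ler_pM.
  by rewrite ler_weXn2l.
have B4 : (2 * m + 1) * i * e + 2 * m * f * bb + 24 * (m * m) * i * bb <= 153 * w ^+ 5 * (i * bb).
  have -> : 153 * w ^+ 5 * (i * bb) = 117 * w ^+ 5 * (i * bb) + 12 * w ^+ 5 * (i * bb)
    + 24 * w ^+ 5 * (i * bb) by ring.
  by rewrite !lerD.
have B5 : m * (4 * ((2 * m + 1) * i * e + 2 * m * f * bb + 24 * (m * m) * i * bb)) <=
    612 * n * (i * bb).
  apply: (@le_trans _ _ (w * (4 * (153 * w ^+ 5 * (i * bb))))).
    apply: ler_pM => //; last by rewrite ler_pM2l.
    by rewrite !(mulr_ge0, addr_ge0).
  by rewrite nw le_eqVlt; apply/orP; left; apply/eqP; ring.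
have n0 : 0 < n by rewrite nw.
rewrite ler_pdivlMr // -(ler_pM2l n0).
apply: (@le_trans _ _ ((m + 1) * n * c)).
  have -> : n * (c * w) = w * (n * c) by ring.
  by rewrite -mulrA ler_wpM2r ?mulr_ge0 // ltW.
apply: le_trans hC _; apply: le_trans (lerD (lexx _) B5) _.
by rewrite le_eqVlt; apply/orP; left; apply/eqP; rewrite -/i -/bb; ring.
Qed.

End Averages.

(** * The probability for a fixed size *)

Section Root.
Variables (R : realType) (n : nat).
Let V : finType := 'I_n.+1.
Let w : R := rt6 n.+1%:R.
Let I := #|involutions V|.
Let B := #|bstructures V|.

Let w1 : 1 <= w. Proof. by rewrite rt6_ge1 // ler1n. Qed.
Let w0 : 0 < w. Proof. exact: lt_le_trans ltr01 w1. Qed.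
Let cV : #|V| = n.+1. Proof. exact: card_ord. Qed.
Let V0 : (0 < #|V|)%N. Proof. by rewrite cV. Qed.
Let wE : rt6 #|V|%:R = w. Proof. by rewrite cV. Qed.
Let w6 : w ^+ 6 = n.+1%:R. Proof. exact: rt6K. Qed.

(** By symmetry a given vertex is an a-loop in a proportion at most 6 n^(-1/2), weakened here to the
    order n^(-1/6) of the acyclic codes. *)
Lemma card_fixa_codes : #|fixa_codes n|%:R <= 6 * (I * B)%:R / w.
Proof.
have h := card_fix_at (ord0 : V); have := mean_fix R V0; rewrite wE -/I.
set S := (\sum_(a in _) _)%N in h * => hS.
have sub : (#|fixa_codes n| <= #|[set a in involutions V | a ord0 == ord0]%SET| * B)%N.
  rewrite -finset.cardsX; apply/subset_leq_card/fintype.subsetP => c.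
  rewrite finset.in_set => /and3P[ca cb cr]; case: c ca cb cr => a x /= ca cb cr.
  by rewrite finset.in_setX cb andbT finset.in_set ca.
set k := #|[set a in _ | _]%SET| in h sub.
have hk : w ^+ 6 * k%:R <= 6 * w ^+ 3 * I%:R.
  by apply: le_trans hS; rewrite w6 -natrM ler_nat -cV.
apply: (@le_trans _ _ (k%:R * B%:R)); first by rewrite -natrM ler_nat.
have hk2 : k%:R * w <= 6 * I%:R.
  have w3 : 0 < w ^+ 3 by exact: exprn_gt0.
  rewrite -(ler_pM2l w3); apply: le_trans (_ : w ^+ 6 * k%:R <= _).
    have -> : w ^+ 3 * (k%:R * w) = w ^+ 4 * k%:R by ring.
    by rewrite ler_wpM2r // ler_weXn2l.
  by apply: le_trans hk _; rewrite le_eqVlt; apply/orP; left; apply/eqP; ring.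
rewrite ler_pdivlMr // natrM mulrAC mulrA.
by rewrite ler_wpM2r.
Qed.

Lemma card_fixb_codes : #|fixb_codes n|%:R <= 11 * (I * B)%:R / w.
Proof.
have h := card_loop_at (ord0 : V); have := mean_loops R V0; rewrite wE -/B.
set S := (\sum_(x in _) _)%N in h * => hS.
have sub : (#|fixb_codes n| <= I * #|[set x in bstructures V | x.1 ord0 == ord0]%SET|)%N.
  rewrite -finset.cardsX; apply/subset_leq_card/fintype.subsetP => c.
  rewrite finset.in_set => /and3P[ca cb cr]; case: c ca cb cr => a x /= ca cb cr.
  by rewrite finset.in_setX ca finset.in_set cb.
set k := #|[set a in _ | _]%SET| in h sub.
have hk : w ^+ 6 * k%:R <= 11 * w ^+ 2 * B%:R.
  by apply: le_trans hS; rewrite w6 -natrM ler_nat -cV.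
apply: (@le_trans _ _ (I%:R * k%:R)); first by rewrite -natrM ler_nat.
have hk2 : k%:R * w <= 11 * B%:R.
  have w2 : 0 < w ^+ 2 by exact: exprn_gt0.
  rewrite -(ler_pM2l w2); apply: le_trans (_ : w ^+ 6 * k%:R <= _).
    have -> : w ^+ 2 * (k%:R * w) = w ^+ 3 * k%:R by ring.
    by rewrite ler_wpM2r // ler_weXn2l.
  by apply: le_trans hk _; rewrite le_eqVlt; apply/orP; left; apply/eqP; ring.
have -> : 11 * (I * B)%:R = I%:R * (11 * B%:R) :> R by rewrite natrM; ring.
by rewrite ler_pdivlMr // -mulrA ler_wpM2l.
Qed.

(** The numbers of labelings cancel in the quotient. The constant is 648 = 614 + 2 * 6 + 2 * 11, and
    the factor 4 comes from the proportion of connected codes. *)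
Lemma prob_malnormal_le (E : (I * B)%:R <= 4 * #|conn_codes n|%:R :> R) : 2 <= w ->
  prob_size R n.+1 (@almost_malnormal psl2z) <= 4 * 648 / w.
Proof.
move=> w2; rewrite /prob_size.
have K0 : 0 <= 4 * 648 / w.
  by apply: mulr_ge0; [apply: mulr_ge0; exact: ler0n|rewrite invr_ge0; exact: ltW].
(* For an infinite set, [fset_set] would be empty and the quotient 0 by convention. *)
have [finS|nfin] := pselect (finite_set (subgroups_of_size n.+1)); last first.
  have -> : fset_set (subgroups_of_size n.+1) = fset0 by rewrite /fset_set; case: pselect.
  by rewrite cardfs0 invr0 mulr0.
have h1 := card_conn_codes finS; have h2 := card_malnormal_codes finS (Num.truncn w).
set F := #|` _| in h1 *; set M := #|` _| in h2 *; set P := #|fixing n| in h1 h2.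
have P0 : 0 < P%:R :> R by rewrite ltr0n fixing_gt0.
have [F0|F0] := posnP F; first by rewrite F0 invr0 mulr0.
rewrite ler_pdivrMr ?ltr0n // -(ler_pM2r P0).
have h3 := @codes_acyclic R V V0; rewrite wE in h3; have {}h3 := h3 w2.
rewrite !mul2n -!addnn in h2.
move: h1 h2; rewrite -!(ler_nat R) !natrD !natrM => h1 h2; apply: (le_trans h2).
have h4 := card_fixa_codes; have h5 := card_fixb_codes.
apply: (@le_trans _ _ (648 * (I * B)%:R / w)).
  have -> : 648 * (I * B)%:R / w = 614 * (I * B)%:R / w + 2 * (6 * (I * B)%:R / w) +
    2 * (11 * (I * B)%:R / w) by ring.
  apply: lerD; last by move: h5; lra.
  by apply: lerD; [exact: h3|move: h4; lra].
have -> : 4 * 648 / w * F%:R * P%:R = 648 * (4 * (F%:R * P%:R)) / w by ring.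
by rewrite ler_pM2r ?invr_gt0 // ler_pM2l ?ltr0n //; apply: le_trans E _; rewrite ler_pM2l ?ltr0n.
Qed.

End Root.

(** * The asymptotic estimate *)

Unset Implicit Arguments.
Set Strict Implicit.
Set Printing Implicit Defensive.

Theorem theorem6p4 (R : realType) (alpha : R) (alpha_gt0 : 0 < alpha)
    (alpha_lt : alpha < 6^-1) :
  (fun n : nat => prob_size R n (@almost_malnormal psl2z))
    =O_\oo (fun n : nat => n%:R `^ (- alpha)).
Proof.
have c0 : 0 < 1000%:R :> R by rewrite ltr0n.
have [n0 hn0] := mostly_connected c0.
have bound n : (64 <= n)%N -> (n0 <= n)%N ->
    `|prob_size R n (@almost_malnormal psl2z)| <= 4 * 648 * `|n%:R `^ (- alpha)|.
  case: n => [//|n] n64 nn0.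
  (* The threshold 64 is 2^6. *)
  have w2 : 2 <= rt6 n.+1%:R :> R.
    rewrite -(@ler_pXn2r _ 6) ?nnegrE ?rt6_ge0 // rt6K //.
    by apply: le_trans (_ : 64%:R <= _); [rewrite -natrX ler_nat|rewrite ler_nat].
  rewrite ger0_norm; last by rewrite /prob_size divr_ge0.
  rewrite ger0_norm ?powR_ge0 //.
  apply: le_trans (prob_malnormal_le _ w2) _.
    apply: codes_connected; first by rewrite card_ord.
    by move=> a x ai xB tp; apply: hn0; rewrite ?card_ord.
  by rewrite ler_pM2l ?mulr_gt0 ?ltr0n // /rt6 -powRN ler_powR ?ler1n // lerN2 ltW.
apply/eqO_exP; exists (4 * 648); first by rewrite mulr_gt0 ?ltr0n.
near=> n; apply: bound; near: n; exact: nbhs_infty_ge.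
Unshelve. all: by end_near.
Qed.
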